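(* Let $\varphi$ be a bounded toll function with additive functional $\Phi(T)=\sum_{v\in T}\varphi(T^v)$, and suppose that $\varphi=\varphi_+-\varphi_-$ for some bounded toll functions $\varphi_\pm$ such that the corresponding additive functionals $\Phi_\pm$ are increasing. Let $\chi$, $f_{\mathsf E}$, $\psi_{\mathsf E}$, $H$, $d_{\mathbf p}$ be as defined in the context. (i) As $\lambda\to\infty$ and $n\to\infty$, with convergence in probability, $$\frac{\Phi(\widetilde{\mathcal T}_\lambda)}{\lambda}-H^{-1}\psi_{\mathsf E}(\log\lambda)-\chi\overset{p}{\longrightarrow}0,\qquad \frac{\Phi(\mathcal T_n)}{n}-H^{-1}\psi_{\mathsf E}(\log n)-\chi\overset{p}{\longrightarrow}0.$$ In particular, if $d_{\mathbf p}=0$, then, as $n\to\infty$, $$\frac{\Phi(\mathcal T_n)}{n}\overset{p}{\longrightarrow}H^{-1}f_{\mathsf E}^*(-1)+\chi=H^{-1}\int_0^\infty f_{\mathsf E}(\lambda)\lambda^{-2}\,d\lambda+\chi.$$ (ii) If furthermore $\varphi\ge0$ and $\mathbb P(\varphi(\mathcal T_n)>0)>0$ for some $n\ge1$, then $\inf_t\bigl(H^{-1}\psi_{\mathsf E}(t)+\chi\bigr)>0$, and thus, for some $c>0$, as $n\to\infty$, $$\mathbb P\bigl(\Phi(\mathcal T_n)\ge cn\bigr)\to1.$$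
   Context: Strings. $\mathcal A$ is a fixed finite alphabet with $|\mathcal A|\ge2$; $\mathbf p=(p_\alpha)_{\alpha\in\mathcal A}$ is a probability distribution with all $p_\alpha>0$. $\mathcal A^*=\bigcup_{m\ge0}\mathcal A^m$ is the set of finite strings, with empty string $\epsilon$. $\Xi^{(1)},\Xi^{(2)},\dots$ are i.i.d. random infinite strings, each with i.i.d. letters having distribution $\mathbf p$. Tries. Given a set of $n$ distinct infinite strings, let $\nu_{\boldsymbol\alpha}$ be the number of them having prefix $\boldsymbol\alpha\in\mathcal A^*$. The trie they generate is the empty tree $\emptyset$ if $n=0$; otherwise it is the finite rooted tree (root $\epsilon$, the children of $\boldsymbol\alpha$ being the nodes $\boldsymbol\alpha\gamma$, $\gamma\in\mathcal A$) whose nodes are all $\boldsymbol\alpha\in\mathcal A^*$ with either $\nu_{\boldsymbol\alpha}\ge2$ (internal nodes), or $\nu_{\boldsymbol\alpha}=1$ and $\boldsymbol\alpha=\epsilon$ or the parent of $\boldsymbol\alpha$ is an internal node (external nodes = leaves). A trie is any tree arising in this way. $\bullet$ is the trie with only one node. For a trie $T$ and $v\in\mathcal A^*$, the fringe tree is $T^v:=\{\boldsymbol\beta\in\mathcal A^*:v\boldsymbol\beta\in T\}$, again a trie. $\mathcal T_n$ is the random trie generated by $\Xi^{(1)},\dots,\Xi^{(n)}$; for $\lambda>0$, $N_\lambda\sim\mathrm{Po}(\lambda)$ is independent of the strings and $\widetilde{\mathcal T}_\lambda$ is the random trie generated by $\Xi^{(1)},\dots,\Xi^{(N_\lambda)}$.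 Functionals. A toll function is a real-valued function $\varphi$ on the set of tries with $\varphi(\emptyset)=0$; its additive functional is $\Phi(T)=\sum_{v\in T}\varphi(T^v)$. A functional $\Phi$ is increasing if $\Phi(T_1)\le\Phi(T_2)$ whenever $T_1,T_2$ are tries and $T_1$ is a subtree of $T_2$. Constants. $\log$ is the natural logarithm. $H=-\sum_{\alpha}p_\alpha\log p_\alpha$. $d_{\mathbf p}$ is the largest $d>0$ such that $\log p_\alpha\in d\mathbb Z$ for all $\alpha\in\mathcal A$ if such a $d$ exists, and $d_{\mathbf p}=0$ otherwise. Mellin transform: $f^*(s)=\int_0^\infty f(x)x^{s-1}\,dx$. $\chi:=\varphi(\bullet)$ and $f_{\mathsf E}(\lambda):=\mathbb E\varphi(\widetilde{\mathcal T}_\lambda)-\chi\lambda e^{-\lambda}$ for $\lambda>0$. If $d_{\mathbf p}=0$, $\psi_{\mathsf E}(t):=f_{\mathsf E}^*(-1)$ for all $t$; if $d=d_{\mathbf p}>0$, $\psi_{\mathsf E}(t):=d\sum_{k=-\infty}^\infty e^{kd-t}f_{\mathsf E}(e^{t-kd})$, a continuous $d$-periodic function with Fourier series $\sum_{m\in\mathbb Z}f_{\mathsf E}^*(-1-\frac{2\pi m}{d}\mathrm i)e^{2\pi\mathrm imt/d}$. *)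

(* Defs.v *)
From HB Require Import structures.
From mathcomp Require Import all_boot all_order all_algebra finmap.
From mathcomp Require Import all_classical all_reals all_analysis.

Set Implicit Arguments.
Unset Strict Implicit.
Unset Printing Implicit Defensive.

Import Order.TTheory GRing.Theory Num.Theory.
Import numFieldNormedType.Exports.

Local Open Scope classical_set_scope.
Local Open Scope ring_scope.

Section Tries.
Variable A : finType.

(* [x i : nat -> A] is the i-th infinite string; only x 0, ..., x n.-1 are
   used to build the trie of size n. *)
Implicit Types (n : nat) (x : nat -> nat -> A) (v : seq A).
Implicit Types T : {fset seq A}.

Definition nu n x v : nat := #|[pred i : 'I_n | v == mkseq (x i) (size v)]|.

Definition internal_node n x v : Prop := (2 <= nu n x v)%N.

(* the parent of a nonempty v is v without its last letter *)
Definition external_node n x v : Prop :=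
  nu n x v = 1%N /\ (v = [::] \/ internal_node n x (take (size v).-1 v)).

Definition distinct_strings n x : Prop :=
  forall i j, (i < n)%N -> (j < n)%N -> x i = x j -> i = j.

(* If the n strings are distinct, the set of nodes is finite and trie n x is
   that set.  Otherwise every prefix of a repeated string is an internal node,
   and fset_set maps this infinite set of nodes to fset0; for the random
   strings below this happens with probability 0. *)
Definition trie n x : {fset seq A} :=
  fset_set [set v | internal_node n x v \/ external_node n x v].

Definition is_trie T : Prop :=
  exists n x, distinct_strings n x /\ T = trie n x.

Definition bullet : {fset seq A} := [fset [::]]%fset.

Definition fringe T v : {fset seq A} :=
  fset_set [set b : seq A | v ++ b \in T].

Variable R : realType.

(* A function on the set of tries is represented by a total function on
   {fset seq A}; all conditions on it are restricted to tries. *)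
Implicit Types phi : {fset seq A} -> R.

Definition bounded_toll phi : Prop :=
  phi fset0 = 0 /\ exists M : R, forall T, is_trie T -> `|phi T| <= M.

Definition additive_functional phi T : R := \sum_(v <- T) phi (fringe T v).

Definition increasing_functional (Phi : {fset seq A} -> R) : Prop :=
  forall T1 T2, is_trie T1 -> is_trie T2 -> (T1 `<=` T2)%fset ->
    Phi T1 <= Phi T2.

End Tries.

Section Probability.
Context d (Omega : measurableType d) (R : realType) (P : probability Omega R).

Definition independent_sigma_algebras (I : choiceType)
    (F : I -> set (set Omega)) : Prop :=
  forall (J : {fset I}) (E : I -> set Omega),
    (forall j, j \in J -> F j (E j)) ->
    P (\bigcap_(j in [set` J]) E j) = (\prod_(j <- J) P (E j))%E.

Definition sigma_discrete (S : Type) (X : Omega -> S) : set (set Omega) :=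
  [set X @^-1` B | B in [set: set S]].

Definition sigma_string (A : finType) (X : Omega -> nat -> A) :
    set (set Omega) :=
  <<s \bigcup_k sigma_discrete (fun w => X w k) >>.

Definition sigma_strings (A : finType) (Xi : nat -> Omega -> nat -> A) :
    set (set Omega) :=
  <<s \bigcup_i sigma_string (Xi i) >>.

Definition iid_strings (A : finType) (p : A -> R)
    (Xi : nat -> Omega -> nat -> A) : Prop :=
  [/\ forall i k (a : A), measurable [set w | Xi i w k = a],
      forall i k (a : A), P [set w | Xi i w k = a] = (p a)%:E,
      forall i, independent_sigma_algebras
        (fun k => sigma_discrete (fun w => Xi i w k)) &
      independent_sigma_algebras (fun i => sigma_string (Xi i))].

Definition poisson_variable (lambda : R) (N : Omega -> nat) : Prop :=
  (forall k, measurable [set w | N w = k]) /\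
  (forall k, P [set w | N w = k] = (poisson_pmf lambda k)%:E).

Definition independent_of_strings (A : finType)
    (Xi : nat -> Omega -> nat -> A) (N : Omega -> nat) : Prop :=
  forall E F, sigma_discrete N E -> sigma_strings Xi F ->
    P (E `&` F) = (P E * P F)%E.

Definition trie_n (A : finType) (Xi : nat -> Omega -> nat -> A)
    (n : nat) (w : Omega) : {fset seq A} := trie n (fun i => Xi i w).

Definition trie_poisson (A : finType) (Xi : nat -> Omega -> nat -> A)
    (N : R -> Omega -> nat) (lambda : R) (w : Omega) : {fset seq A} :=
  trie (N lambda w) (fun i => Xi i w).

Definition fE (A : finType) (Xi : nat -> Omega -> nat -> A)
    (N : R -> Omega -> nat) (phi : {fset seq A} -> R) (lambda : R) : R :=
  fine 'E_P[fun w => phi (trie_poisson Xi N lambda w)]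
  - phi (bullet A) * lambda * expR (- lambda).

Definition cvg_in_probability (I : Type) (F : set_system I)
    (Y : I -> Omega -> R) (c : R) : Prop :=
  forall e : R, 0 < e ->
    P [set w | e < `|Y i w - c|] @[i --> F] --> 0%E.

End Probability.

Section Constants.
Variables (R : realType) (A : finType) (p : A -> R).

Definition entropy : R := - \sum_a p a * ln (p a).

Definition lattice_step (d : R) : Prop :=
  0 < d /\ forall a, exists k : int, ln (p a) = k%:~R * d.

(* the largest lattice step, or 0 if there is none *)
Definition dp : R :=
  xget 0 [set d | lattice_step d /\ forall d', lattice_step d' -> d' <= d].

(* Mellin transform, at real arguments only *)
Definition mellin (f : R -> R) (s : R) : R :=
  \int[@lebesgue_measure R]_(x in `]0, +oo[) (f x * x `^ (s - 1)).

(* sum over Z of an absolutely convergent family *)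
Definition sumZ (u : int -> R) : R :=
  limn (series (fun k : nat => u k%:Z)) +
  limn (series (fun k : nat => u (- k.+1%:Z))).

Definition psiE (f : R -> R) (t : R) : R :=
  if dp == 0 then mellin f (-1)
  else dp * sumZ (fun k => expR (k%:~R * dp - t) * f (expR (t - k%:~R * dp))).

End Constants.

(* Main.v *)
(* The trie of n strings with pairwise distinct prefixes of length K is a finite
   object, and changing one string changes the sum of the tolls over the nodes
   with at least two strings by at most 2 M K; Efron-Stein then gives a variance
   O(n K^2), and K ~ n^(1/4) is long enough for coincidences to be negligible.
   Only the mean matters from there on.  In the Poisson model the mean
   F(lambda) is the sum of f_E(p(v) lambda) over all strings v, so
   Z(t) = e^-t F(e^t) solves Z(t) = g(t) + sum_a p_a Z(t - x_a) with
   x_a = - log p_a and g(t) = e^-t f_E(e^t).  A limsup argument shows that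
   Z(t) - Z(t - x_a) tends to 0 for every a, hence Z(t) - Z(t - s) does for
   every s in the group generated by the x_a.  If that group is dense, Z is
   asymptotically constant on bounded intervals and comparing
   sum_a p_a (V(t) - V(t - x_a)), V' = Z, with the integral of g up to t yields
   H Z(t) -> f_E^*(-1); if it is d Z, the discrete analogue gives
   H Z(t) - psi_E(t) -> 0. *)
Require Import Defs.
From HB Require Import structures.
From mathcomp Require Import all_boot all_order all_algebra finmap.
From mathcomp Require Import all_classical all_reals all_analysis.
From mathcomp Require Import measurable_realfun ring lra zify.

Set Implicit Arguments.
Unset Strict Implicit.
Unset Printing Implicit Defensive.

Import Order.TTheory GRing.Theory Num.Theory.
Import numFieldNormedType.Exports.

Local Open Scope classical_set_scope.
Local Open Scope ring_scope.

(** * Mean functionals *)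

Section MeanFunctionals.
Variable R : realType.

(** Each of the n leaves contributes [chi], and these are split off at once: what remains sums over
    nodes holding at least two strings, so its Poisson toll is O(lambda^2) at 0. As the squares
    p(v)^2 over strings of length N add up to theta^N, with theta = [coincidence p] < 1, the sum
    over infinitely many v converges; the same theta^K is the price of cutting strings at K letters.
    Linear growth of F at infinity comes from comparison with the supersolution lambda^2 / (1 +
    lambda), without counting depths, and rescaled copies of it give the uniform continuity of Z.
    Averages over truncated strings are finite sums, so they are treated as positive linear
    functionals on lists; [P] enters through the law of the prefixes. Passing between fixed n and
    the Poisson model needs no complex analysis: the mean at depth K is Lipschitz in n with constant
    2 M K, so averaging it over a Poisson number of strings with mean n moves it by O(K sqrt n),
    which is o(n). *)

Record is_mean (X : Type) (mu : (X -> R) -> R) : Prop := IsMean {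
  meanD : forall f g, mu (fun x => f x + g x) = mu f + mu g;
  meanZ : forall c f, mu (fun x => c * f x) = c * mu f;
  mean_le : forall f g, (forall x, f x <= g x) -> mu f <= mu g;
  mean1 : mu (fun=> 1) = 1 }.

(** The expectation over [n] independent draws, as an iterated mean. Draws are kept as a list, so
    that deleting one or splitting the list by first letters stays within the same type. *)
Fixpoint list_mean (X : Type) (mu : (X -> R) -> R) n (f : seq X -> R) : R :=
  if n is m.+1 then mu (fun x => list_mean mu m (fun s => f (x :: s)))
  else f [::].

Section Mean.
Variables (X : Type) (mu : (X -> R) -> R).
Hypothesis hmu : is_mean mu.

Lemma eq_mean f g : f =1 g -> mu f = mu g.
Proof. by move=> fg; congr mu; apply/funext. Qed.

Lemma mean_cst c : mu (fun=> c) = c.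
Proof.
by rewrite -[RHS]mulr1 -(mean1 hmu) -(meanZ hmu); apply: eq_mean => x; rewrite mulr1.
Qed.

Lemma meanB f g : mu (fun x => f x - g x) = mu f - mu g.
Proof.
rewrite (meanD hmu f (fun x => - g x)); congr (_ + _).
by rewrite -mulN1r -(meanZ hmu); apply: eq_mean => x; rewrite mulN1r.
Qed.

Lemma mean_sum (I : Type) (r : seq I) (f : I -> X -> R) :
  mu (fun x => \sum_(i <- r) f i x) = \sum_(i <- r) mu (f i).
Proof.
elim: r => [|i r IH].
  rewrite big_nil -[RHS](mean_cst 0); apply: eq_mean => x; exact: big_nil.
rewrite big_cons -IH -(meanD hmu); apply: eq_mean => x; exact: big_cons.
Qed.

Lemma mean_norm f : `|mu f| <= mu (fun x => `|f x|).
Proof.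
rewrite ler_norml; apply/andP; split; last first.
  by apply: (mean_le hmu) => x; exact: ler_norm.
rewrite lerNl -mulN1r -(meanZ hmu); apply: (mean_le hmu) => x.
by rewrite mulN1r -normrN ler_norm.
Qed.

(** The cross term has mean zero: variance plus squared bias. *)
Lemma mean_sqr_dist f c :
  mu (fun x => (f x - c) ^+ 2)
  = mu (fun x => (f x - mu f) ^+ 2) + (mu f - c) ^+ 2.
Proof.
rewrite (@eq_mean _
  (fun x => ((f x - mu f) ^+ 2 + (2 * (mu f - c)) * (f x - mu f)) + (mu f - c) ^+ 2)).
  rewrite (meanD hmu (fun x => (f x - mu f) ^+ 2 + _) (fun=> (mu f - c) ^+ 2)).
  by rewrite (meanD hmu) (meanZ hmu) (meanB f (fun=> mu f)) !mean_cst; ring.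
by move=> x; ring.
Qed.

Lemma list_mean_is_mean n : is_mean (list_mean mu n).
Proof.
elim: n => [|n IH]; first by split=> //= f g fg.
split=> /=.
- by move=> f g; rewrite -(meanD hmu); apply: eq_mean => x; rewrite (meanD IH).
- by move=> c f; rewrite -(meanZ hmu); apply: eq_mean => x; rewrite (meanZ IH).
- by move=> f g fg; apply: (mean_le hmu) => x; apply: (mean_le IH) => s.
- by rewrite -[RHS](mean_cst 1); apply: eq_mean => x; rewrite (mean1 IH).
Qed.

End Mean.

Section EfronStein.
Variables (X : Type) (mu : (X -> R) -> R).
Hypothesis hmu : is_mean mu.

(** Conditioning on the first draw gives the mean conditional variance, bounded by induction, plus
    the variance of the conditional mean [g]. The hypothesis compares a list with the one from which
    an entry is deleted, so the mean over the remaining [n] entries is a centre independent of [x]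
    and within [c] of every [g x]. *)
Lemma efron_stein (c : R) n (f : seq X -> R) :
  (forall s1 x s2, `|f (s1 ++ x :: s2) - f (s1 ++ s2)| <= c) ->
  list_mean mu n (fun s => (f s - list_mean mu n f) ^+ 2) <= n%:R * c ^+ 2.
Proof.
elim: n f => [|n IH] f hf /=; first by rewrite subrr expr0n /= mul0r.
have hn := list_mean_is_mean hmu n.
have c0 : 0 <= c.
  have [[x _]|nX] := pselect (exists x : X, True).
    exact: le_trans (normr_ge0 _) (hf [::] x [::]).
  (* If [X] were empty, the constants 1 and 0 would be the same function, with two different
     means. *)
  have /eqP := mean_cst hmu 1; rewrite (@eq_mean _ mu _ (fun=> 0)) ?mean_cst //.
    by rewrite eq_sym oner_eq0.
  by move=> x; case: nX; exists x.
set g := fun x => list_mean mu n (fun s => f (x :: s)).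
rewrite (@eq_mean _ _ _ (fun x =>
  list_mean mu n (fun s => (f (x :: s) - g x) ^+ 2) + (g x - mu g) ^+ 2)); last first.
  by move=> x; rewrite (mean_sqr_dist hn).
rewrite (meanD hmu) mulrS mulrDl mul1r addrC; apply: lerD.
  (* Recentring [g] away from its mean only increases the second moment. *)
  apply: (@le_trans _ _ (mu (fun x => (g x - list_mean mu n f) ^+ 2))).
    by rewrite [leRHS](mean_sqr_dist hmu) lerDl sqr_ge0.
  rewrite -[leRHS](mean_cst hmu); apply: (mean_le hmu) => x.
  rewrite -(meanB hn) -real_normK ?num_real// lerXn2r ?nnegrE //.
  apply: (le_trans (mean_norm hn _)); rewrite -[leRHS](mean_cst hn).
  by apply: (mean_le hn) => s; exact: (hf [::]).
rewrite -[leRHS](mean_cst hmu); apply: (mean_le hmu) => x.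
by apply: IH => s1 y s2; exact: (hf (x :: s1)).
Qed.

End EfronStein.
End MeanFunctionals.

(** * Tries of lists of strings *)

Section TrieOfList.
Variable A : finType.
Implicit Types (s : seq (seq A)) (u v : seq A) (x : nat -> nat -> A).

Definition prefix_count v s := count (prefix v) s.

Definition list_node s v :=
  (2 <= prefix_count v s)%N ||
  ((prefix_count v s == 1%N) &&
   ((v == [::]) || (2 <= prefix_count (take (size v).-1 v) s)%N)).

Definition list_trie s : {fset seq A} := fset_set [set v | list_node s v].

Definition prefixes n K x : seq (seq A) := [seq mkseq (x i) K | i <- iota 0 n].

(** These are the strings that generate the fringe tree at the child [a], so fringe trees stay tries
    of lists and tolls can be summed by recursion on the string length. *)
Definition branch (a : A) s : seq (seq A) :=
  pmap (fun u => if u is b :: u' then if b == a then Some u' else None else None) s.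

Lemma list_node_cnt s v : list_node s v -> has (prefix v) s.
Proof. by rewrite has_count /list_node -/(prefix_count _ _); case: prefix_count. Qed.

Lemma finite_list_node s : finite_set [set v | list_node s v].
Proof.
apply: (@sub_finite_set _ _
  [set` flatten [seq [seq take k u | k <- iota 0 (size u).+1] | u <- s]]).
  move=> v /list_node_cnt /hasP[u us /prefixP[w uE]].
  apply/flattenP; exists [seq take k u | k <- iota 0 (size u).+1]; first exact: map_f.
  apply/mapP; exists (size v); last by rewrite uE take_size_cat.
  by rewrite mem_iota /= add0n ltnS uE size_cat leq_addr.
exact: finite_seq.
Qed.

Lemma in_list_trie s v : (v \in list_trie s) = list_node s v.
Proof.
rewrite in_fset_set; last exact: finite_list_node.
by apply/idP/idP; rewrite inE.
Qed.

Lemma prefix_count_cons a v s : prefix_count (a :: v) s = prefix_count v (branch a s).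
Proof.
rewrite /prefix_count; elim: s => [//|[|b u] s IH] /=.
  by rewrite IH.
rewrite IH [b == a]eq_sym; case: eqP => [->|] //=.
Qed.

Lemma prefix_count_nil s : prefix_count [::] s = size s.
Proof. by rewrite /prefix_count -count_predT; apply: eq_count => u; rewrite prefix0s. Qed.

(** Two strings make the root internal, which is what a one-letter node requires of its parent; for
    longer nodes the conditions on the node and on its parent both pass to the branch. *)
Lemma list_node_cons s a v : (2 <= size s)%N ->
  list_node s (a :: v) = list_node (branch a s) v.
Proof.
move=> s2; rewrite /list_node prefix_count_cons /=.
case: v => [|b v] /=; last by rewrite (prefix_count_cons a).
by rewrite (prefix_count_nil s) s2.
Qed.

Lemma list_trie_nil : list_trie [::] = fset0.
Proof. by apply/fsetP => v; rewrite in_list_trie inE /list_node /prefix_count. Qed.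

Lemma list_trie1 s : size s = 1%N -> list_trie s = bullet A.
Proof.
move=> s1; apply/fsetP => v; rewrite in_list_trie inE /list_node.
have [->|v0] := eqVneq v [::]; first by rewrite prefix_count_nil s1.
have c1 w : (prefix_count w s <= 1)%N by rewrite -s1 /prefix_count count_size.
by rewrite leqNgt ltnS c1 /= leqNgt ltnS c1 /= andbF.
Qed.

Lemma fringe_list_trie_nil s : fringe (list_trie s) [::] = list_trie s.
Proof. by rewrite /fringe /=; exact: set_fsetK. Qed.

Lemma fringe_list_trie_cons s a v : (2 <= size s)%N ->
  fringe (list_trie s) (a :: v) = fringe (list_trie (branch a s)) v.
Proof.
move=> s2; rewrite /fringe; congr fset_set; apply/seteqP.
by split=> b /=; rewrite !in_list_trie list_node_cons.
Qed.

Lemma list_trie_perm s : (2 <= size s)%N ->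
  perm_eq (list_trie s)
    ([::] :: flatten [seq map (cons a) (list_trie (branch a s)) | a <- enum A]).
Proof.
move=> s2; apply: uniq_perm; first exact: fset_uniq.
  rewrite /= -[flatten _]/(flatten _); apply/andP; split.
    by apply/flattenP => -[w /mapP[a _ ->] /mapP[]].
  have : uniq (enum A) by exact: enum_uniq.
  elim: (enum A) => [//|a e IH] /= /andP[ae ue].
  rewrite cat_uniq map_inj_uniq ?fset_uniq ?IH //=; last by move=> ? ? [].
  rewrite andbT; apply/hasPn => w /flattenP[t /mapP[b be ->]] /mapP[v _ ->].
  by apply/mapP => -[v' _ [ba _]]; move: ae; rewrite -ba be.
move=> [|a v]; first by rewrite in_list_trie inE /list_node prefix_count_nil s2.
rewrite in_list_trie inE /= list_node_cons // -in_list_trie.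
apply/idP/flattenP => [va|[w /mapP[b _ ->]] /mapP[v' v'b [-> ->]] //].
exists (map (cons a) (list_trie (branch a s))); last exact: map_f.
by apply/mapP; exists a; rewrite ?mem_enum.
Qed.

Lemma additive_functional_branch (R : realType) (phi : {fset seq A} -> R) s :
  (2 <= size s)%N ->
  additive_functional phi (list_trie s) =
  phi (list_trie s) + \sum_a additive_functional phi (list_trie (branch a s)).
Proof.
move=> s2; rewrite /additive_functional (perm_big _ (list_trie_perm s2)) big_cons.
rewrite fringe_list_trie_nil big_flatten big_map big_enum /=; congr (_ + _).
apply: eq_bigr => a _; rewrite big_map; apply: eq_bigr => v _.
by rewrite fringe_list_trie_cons.
Qed.

Lemma branch_uniq a s : uniq s -> uniq (branch a s).
Proof.
elim: s => [//|[|b u] s IH] /= /andP[us /IH{}IH] //; case: eqP => //= ba.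
rewrite IH andbT mem_pmap; apply: contra us => /mapP[[|c w]] //= ws.
by case: eqP => // ca [->]; rewrite ba -ca.
Qed.

Lemma branch_size a s K : all (fun u => size u == K.+1) s ->
  all (fun u => size u == K) (branch a s).
Proof. by elim: s => [//|[|b u] s IH] //= /andP[us /IH{}IH]; case: eqP => //= _; rewrite IH andbT. Qed.

Lemma sum_branch_size s K : all (fun u => size u == K.+1) s ->
  (\sum_a size (branch a s))%N = size s.
Proof.
elim: s => [_|[|b u] s IH] //=; first by rewrite big1.
move=> /andP[us /IH{}IH]; rewrite (bigD1 b) //= eqxx /= addSn -IH.
rewrite [in RHS](bigD1 b) //=; congr (_ + _).+1.
by apply: eq_bigr => a ab; rewrite eq_sym (negbTE ab).
Qed.

Lemma prefix_mkseq v (f : nat -> A) K :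
  prefix v (mkseq f K) = (size v <= K)%N && (v == mkseq f (size v)).
Proof.
rewrite prefixE; case: leqP => [vK|Kv] /=.
  by rewrite /mkseq -map_take take_iota (minn_idPl vK) eq_sym.
rewrite take_oversize; last by rewrite size_mkseq ltnW.
by apply/eqP => /(congr1 size); rewrite size_mkseq => vK; rewrite -vK ltnn in Kv.
Qed.

Lemma nu_prefixes n K x v : (size v <= K)%N -> nu n x v = prefix_count v (prefixes n K x).
Proof.
move=> vK; rewrite /nu /prefix_count /prefixes count_map cardE size_filter.
rewrite -(count_map val (fun i => v == mkseq (x i) (size v))) -enumT val_enum_ord.
by apply: eq_count => i /=; rewrite prefix_mkseq vK.
Qed.

Lemma prefix_count_uniq s v K : uniq s -> all (fun u => size u == K) s ->
  (K <= size v)%N -> (prefix_count v s <= 1)%N.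
Proof.
move=> us sK Kv; apply: (@leq_trans (count_mem v s)); last first.
  by rewrite count_uniq_mem ?leq_b1.
rewrite /prefix_count; move/allP in sK.
apply/eq_leq/eq_in_count => u /sK /eqP uK; rewrite prefixE /= eq_sym.
by rewrite -[in RHS](@take_oversize _ (size v) u) 1?uK // eq_sym.
Qed.

Lemma size_prefixes n K x : all (fun u => size u == K) (prefixes n K x).
Proof. by apply/allP => u /mapP[i _ ->]; rewrite size_mkseq. Qed.

Lemma nu_take n x v K : (nu n x v <= nu n x (take K v))%N.
Proof.
apply: subset_leq_card; apply/fintype.subsetP => i; rewrite !inE => /eqP {1}->.
rewrite /mkseq -map_take take_iota; apply/eqP; congr (map _ (iota _ _)).
by rewrite size_take_min.
Qed.

(** When the prefixes of length [K] are distinct, a node of depth at least [K] holds at most one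
    string, so no node is deeper than [K]; up to that depth, full strings and prefixes give the same
    counts. *)
Lemma trie_prefixes n K x : uniq (prefixes n K x) ->
  trie n x = list_trie (prefixes n K x).
Proof.
move=> us; rewrite /trie /list_trie; congr fset_set; apply/seteqP.
have le1 v : (K <= size v)%N -> (nu n x v <= 1)%N.
  move=> Kv; apply: leq_trans (nu_take n x v K) _.
  have sv : size (take K v) = K by rewrite size_takel.
  rewrite (@nu_prefixes n K) ?sv //.
  by apply: (prefix_count_uniq us (size_prefixes n K x)); rewrite sv.
have le1' v : (K <= size v)%N -> (prefix_count v (prefixes n K x) <= 1)%N.
  exact: (prefix_count_uniq us (size_prefixes n K x)).
have szP v : (K < size v)%N -> (K <= size (take (size v).-1 v))%N.
  by move=> Kv; rewrite size_takel; lia.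
have c0 v : (K < size v)%N -> prefix_count v (prefixes n K x) = 0%N.
  move=> Kv; apply/eqP; rewrite -leqn0 leqNgt -has_count; apply/hasPn => u.
  by move=> /mapP[i _ ->]; rewrite prefix_mkseq leqNgt Kv.
split=> v /=; rewrite /external_node /internal_node /list_node;
  have [Kv|vK] := ltnP K (size v).
- case; first by move=> /leq_trans/(_ (le1 _ (ltnW Kv))).
  case=> _ [v0|]; first by rewrite v0 in Kv.
  by move=> /leq_trans/(_ (le1 _ (szP _ Kv))).
- have tK : (size (take (size v).-1 v) <= K)%N.
    by rewrite size_take_min geq_min vK orbT.
  rewrite (nu_prefixes n x vK) (nu_prefixes n x tK).
  case=> [->//|[-> [->|->]]]; rewrite eqxx ?orbT //.
- by rewrite c0.
- have tK : (size (take (size v).-1 v) <= K)%N.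
    by rewrite size_take_min geq_min vK orbT.
  rewrite (nu_prefixes n x vK) (nu_prefixes n x tK).
  case/orP=> [->|/andP[/eqP -> /orP[/eqP->|->]]]; [by left|by right; split; [|left]|].
  by right; split; [|right].
Qed.

Lemma uniq_prefixes_distinct n K x : uniq (prefixes n K x) -> distinct_strings n x.
Proof.
move=> us i j ni nj xij; apply/eqP; rewrite -(nth_uniq [::] _ _ us) ?size_map ?size_iota //.
by rewrite !(nth_map 0%N) ?size_iota // !nth_iota // !add0n xij.
Qed.

(** The finite strings are padded with [a0] to infinite ones. Tolls are controlled on tries only, so
    this is what gives access to their bound. *)
Lemma list_trie_is_trie (a0 : A) K s : uniq s -> all (fun u => size u == K) s ->
  is_trie (list_trie s).
Proof.
move=> us /allP sK; pose x i k := nth a0 (nth [::] s i) k.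
have sE : s = prefixes (size s) K x.
  apply: (@eq_from_nth _ [::]); first by rewrite size_map size_iota.
  move=> i si; rewrite (nth_map 0%N) ?size_iota // nth_iota // add0n.
  have /eqP szi := sK _ (mem_nth [::] si).
  apply: (@eq_from_nth _ a0); first by rewrite size_mkseq.
  by move=> k; rewrite szi => kK; rewrite nth_mkseq.
rewrite sE in us; exists (size s), x; split; first exact: uniq_prefixes_distinct us.
by rewrite (trie_prefixes us) -sE.
Qed.

Lemma trie0 x : trie 0 x = fset0.
Proof.
by rewrite (@trie_prefixes 0 0 x) //= /prefixes /= list_trie_nil.
Qed.

(* Prefixes of a repeated string are infinitely many internal nodes, so
   [trie] returns the empty trie in that case. *)
Lemma trie_not_distinct n x : ~ distinct_strings n x -> trie n x = fset0.
Proof.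
move=> /existsNP[i /existsNP[j]].
move=> /not_implyP[ni] /not_implyP[nj] /not_implyP[xij] /eqP ij.
rewrite /trie /fset_set; case: pselect => // fS; exfalso.
apply: infinite_nat; have := finite_preimage _ fS => /(_ _ (mkseq (x i))) fS'.
apply: (sub_finite_set _ (fS' _)).
  move=> k _ /=; left.
  rewrite /internal_node /nu (cardD1 (Ordinal ni)) (cardD1 (Ordinal nj)) !inE size_mkseq.
  by rewrite eqxx -(inj_eq val_inj) /= eq_sym ij /= xij eqxx.
by move=> k l _ _ /(congr1 size); rewrite !size_mkseq.
Qed.

(** Coinciding strings give the default [fset0], which is the trie of no strings; bounds on [phi]
    therefore hold at every outcome, not just almost surely. *)
Lemma trie_is_trie n x : is_trie (trie n x).
Proof.
have [dx|dx] := pselect (distinct_strings n x); first by exists n, x.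
by exists 0%N, x; split=> //; rewrite trie0 trie_not_distinct.
Qed.

Lemma distinct_uniq_prefixes n x : distinct_strings n x -> exists K, uniq (prefixes n K x).
Proof.
move=> dx; have sep (i j : 'I_n) : exists k, i != j -> x i k != x j k.
  have [->|ij] := eqVneq i j; first by exists 0%N.
  have [k xk] : exists k, x i k <> x j k.
    by apply/existsNP => xij; move/eqP: ij; apply; apply: val_inj; apply: (dx _ _ (ltn_ord i) (ltn_ord j)); exact: funext xij.
  by exists k => _; apply/eqP.
have /choice[k hk] : forall i : 'I_n, exists k : 'I_n -> nat, forall j, i != j -> x i (k j) != x j (k j).
  by move=> i; have [k hk] := choice (sep i); exists k.
(* A length that goes past one separating position of every pair. *)
exists (\max_(i < n) \max_(j < n) (k i j).+1)%N.
rewrite map_inj_in_uniq ?iota_uniq // => i j; rewrite !mem_iota !add0n /= => ni nj xij.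
apply/eqP/negPn/negP => ij.
have /eqP := hk (Ordinal ni) (Ordinal nj) ij; apply.
have kK : (k (Ordinal ni) (Ordinal nj) < \max_(i < n) \max_(j < n) (k i j).+1)%N.
  apply: leq_trans (leq_bigmax (Ordinal ni)).
  exact: (leq_bigmax (F := fun j => (k (Ordinal ni) j).+1) (Ordinal nj)).
by rewrite /= -(nth_mkseq (x i 0%N) (x i) kK) xij nth_mkseq.
Qed.

End TrieOfList.

(** * Sums of tolls by recursion on the first letter *)

Section ListSums.
Variables (R : realType) (A : finType) (a0 : A) (phi : {fset seq A} -> R).
Implicit Types (s : seq (seq A)).

(** Leaves are left out, since they are accounted for by [chi]. The test [is_trie] holds for
    distinct strings of equal length; it is there so that the toll is bounded by [M] on every list,
    repetitions included, as the variance bound requires. *)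
Definition list_toll s : R :=
  if (2 <= size s)%N && `[< is_trie (list_trie s) >] then phi (list_trie s) else 0.

(** Stopping with 0 at depth [K] is exact for distinct strings of length [K], which are alone at
    that depth. For other lists the value is a convention. *)
Fixpoint list_sum K s : R :=
  if K is K'.+1 then list_toll s + \sum_a list_sum K' (branch a s) else 0.

Lemma size_branch (a : A) s : (size (branch a s) <= size s)%N.
Proof. by elim: s => [//|[|b u] s IH] /=; [exact: leqW|case: eqP => _ //=; exact: leqW]. Qed.

Lemma list_sum_small K s : (size s <= 1)%N -> list_sum K s = 0.
Proof.
elim: K s => [//|K IH] s s1 /=; rewrite /list_toll ltnNge s1 /= add0r big1 // => a _.
by apply: IH; exact: leq_trans (size_branch a s) s1.
Qed.

Lemma additive_functional_list_trie_small s : phi fset0 = 0 -> (size s <= 1)%N ->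
  additive_functional phi (list_trie s) = phi (bullet A) * (size s)%:R.
Proof.
move=> phi0; case: (ltngtP (size s) 1) => // s1 _.
  move: s1; rewrite ltnS leqn0 => /nilP ->.
  by rewrite list_trie_nil /additive_functional big_seq_fset0 mulr0.
have fb : fringe (bullet A) [::] = bullet A.
  by rewrite -(list_trie1 s1) fringe_list_trie_nil.
by rewrite list_trie1 // s1 mulr1 /additive_functional big_seq_fset1 fb.
Qed.

(** Every string ends in exactly one leaf, whose fringe tree is [bullet A]; the other nodes are
    those counted by [list_sum]. *)
Lemma additive_functional_list_sum K s :
  phi fset0 = 0 -> uniq s -> all (fun u => size u == K) s ->
  additive_functional phi (list_trie s) = phi (bullet A) * (size s)%:R + list_sum K s.
Proof.
move=> phi0; elim: K s => [|K IH] s us sK.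
  rewrite addr0; apply: additive_functional_list_trie_small => //.
  by rewrite -prefix_count_nil; exact: (prefix_count_uniq us sK).
have [s2|s1] := ltnP 1 (size s); last first.
  by rewrite list_sum_small // addr0 additive_functional_list_trie_small.
rewrite additive_functional_branch //= /list_toll s2 /=.
rewrite (asboolT (list_trie_is_trie a0 us sK)) addrCA; congr (_ + _).
rewrite -(sum_branch_size sK) natr_sum mulr_sumr -big_split /=.
by apply: eq_bigr => a _; apply: IH; [exact: branch_uniq|exact: branch_size].
Qed.

Variable M : R.
Hypothesis phiM : forall T, is_trie T -> `|phi T| <= M.

Lemma toll_bound_ge0 : 0 <= M.
Proof. exact: le_trans (normr_ge0 _) (phiM (trie_is_trie 0 (fun _ _ => a0))). Qed.

Lemma list_toll_bound s : `|list_toll s| <= M.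
Proof.
rewrite /list_toll; case: ifPn => [/andP[_ /asboolP/phiM]//|_].
by rewrite normr0 toll_bound_ge0.
Qed.

Lemma branch_cat (a : A) s1 s2 : branch a (s1 ++ s2) = branch a s1 ++ branch a s2.
Proof. exact: pmap_cat. Qed.

(** An additional string changes tolls only along its own path, one per level, each by at most 2 M;
    the branches at other letters do not see it. *)
Lemma list_sum_increment K s1 u s2 :
  `|list_sum K (s1 ++ u :: s2) - list_sum K (s1 ++ s2)| <= 2 * M * K%:R.
Proof.
have M0 := toll_bound_ge0.
elim: K s1 u s2 => [|K IH] s1 u s2 /=; first by rewrite subrr normr0 mulr0.
rewrite opprD addrACA -sumrB -[K.+1]add1n natrD mulrDr mulr1.
apply: le_trans (ler_normD _ _) _; apply: lerD.
  apply: le_trans (ler_normB _ _) _; rewrite mulr_natl mulr2n.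
  by apply: lerD; exact: list_toll_bound.
case: u => [|b u].
  rewrite big1 ?normr0 ?mulr_ge0 // => a _.
  by rewrite !branch_cat /= subrr.
rewrite (bigD1 b) //= big1 ?addr0 => [|a ab]; last first.
  by rewrite !branch_cat /= eq_sym (negbTE ab) subrr.
by rewrite !branch_cat /= eqxx; exact: IH.
Qed.

End ListSums.

(** * Strings of fixed length *)

Section LetterMeans.
Variables (R : realType) (A : finType) (p : A -> R).
Hypotheses (p_gt0 : forall a, 0 < p a) (p_sum : \sum_a p a = 1).

Definition letter_mean (f : A -> R) : R := \sum_a p a * f a.

Definition string_mean K : (seq A -> R) -> R := list_mean letter_mean K.

Definition strings_mean K n : (seq (seq A) -> R) -> R := list_mean (string_mean K) n.

(** The probability that two independent letters agree; its [K]-th power is the probability that two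
    independent strings share their first [K] letters. *)
Definition coincidence : R := \sum_a p a ^+ 2.

Definition binomial_mean (q : R) n (h : nat -> R) : R :=
  \sum_(k < n.+1) 'C(n, k)%:R * q ^+ k * (1 - q) ^+ (n - k) * h k.

Lemma letter_mean_is_mean : is_mean letter_mean.
Proof.
split=> [f g|c f|f g fg|]; rewrite /letter_mean.
- by rewrite -big_split /=; apply: eq_bigr => a _; rewrite mulrDr.
- by rewrite mulr_sumr; apply: eq_bigr => a _; rewrite mulrCA.
- by apply: ler_sum => a _; rewrite ler_wpM2l // ltW.
- by rewrite -[RHS]p_sum; apply: eq_bigr => a _; rewrite mulr1.
Qed.

Lemma string_mean_is_mean K : is_mean (string_mean K).
Proof. exact/list_mean_is_mean/letter_mean_is_mean. Qed.

Lemma strings_mean_is_mean K n : is_mean (strings_mean K n).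
Proof. exact/list_mean_is_mean/string_mean_is_mean. Qed.

Lemma string_meanS K f :
  string_mean K.+1 f = \sum_a p a * string_mean K (fun u => f (a :: u)).
Proof. by []. Qed.

Lemma strings_meanS K n f : strings_mean K n.+1 f =
  string_mean K (fun u => strings_mean K n (fun s => f (u :: s))).
Proof. by []. Qed.

Lemma binomial_mean0 q h : binomial_mean q 0 h = h 0%N.
Proof. by rewrite /binomial_mean big_ord1 bin0 !mul1r. Qed.

Lemma binomial_meanS q n h : binomial_mean q n.+1 h =
  q * binomial_mean q n (fun k => h k.+1) + (1 - q) * binomial_mean q n h.
Proof.
rewrite /binomial_mean 2!mulr_sumr big_ord_recl.
rewrite (@eq_bigr _ _ _ _ _ _ _ (fun i : 'I_n.+1 =>
  q * ('C(n, i)%:R * q ^+ i * (1 - q) ^+ (n - i) * h i.+1) +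
  'C(n, i.+1)%:R * q ^+ i.+1 * (1 - q) ^+ (n - i) * h i.+1)); last first.
  move=> i _; rewrite lift0 binS natrD subSS exprS; ring.
rewrite big_split /= addrCA; congr (_ + _).
rewrite [in RHS]big_ord_recl big_ord_recr /= (@bin_small n n.+1) // !mul0r addr0 ?bin0.
rewrite !subn0 exprS; congr (_ + _); first by ring.
apply: eq_bigr => i _; rewrite ?lift0 /bump ?leq0n ?add1n.
have -> : (n - i = (n - i.+1).+1)%N by rewrite subnSK.
by rewrite [(1 - q) ^+ _.+1]exprS; ring.
Qed.

(** The number of strings that begin with [a] is binomial with parameters [n] and [p a], and given
    this number the rest of these strings is again independent. *)
Lemma mean_branch (a : A) K n (g : seq (seq A) -> R) :
  strings_mean K.+1 n (fun s => g (branch a s)) =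
  binomial_mean (p a) n (fun k => strings_mean K k g).
Proof.
elim: n g => [|n IH] g; first by rewrite binomial_mean0.
rewrite binomial_meanS strings_meanS string_meanS (bigD1 a) //= eqxx; congr (_ + _).
  congr (_ * _); transitivity (string_mean K (fun u =>
      binomial_mean (p a) n (fun k => strings_mean K k (fun s => g (u :: s))))).
    by apply: eq_mean => u; exact: (IH (fun s => g (u :: s))).
  rewrite /binomial_mean (mean_sum (string_mean_is_mean K)).
  by apply: eq_bigr => k _; rewrite (meanZ (string_mean_is_mean K)).
have -> : 1 - p a = \sum_(b | b != a) p b.
  by rewrite -p_sum (bigD1 a) //= addrAC subrr add0r.
rewrite -IH mulr_suml.
apply: eq_bigr => b ba; congr (_ * _).
rewrite -[RHS](mean_cst (string_mean_is_mean K)); apply: eq_mean => u.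
by rewrite (negbTE ba).
Qed.

Lemma string_coincidence K :
  string_mean K (fun u => string_mean K (fun v => (v == u)%:R)) = coincidence ^+ K.
Proof.
elim: K => [//|K IH]; rewrite string_meanS exprS /coincidence mulr_suml; apply: eq_bigr => a _.
rewrite -IH expr2 -mulrA; congr (_ * _).
rewrite -(meanZ (string_mean_is_mean K)).
apply: eq_mean => u; rewrite string_meanS (bigD1 a) //= big1 ?addr0 => [|b ba].
  by congr (_ * _); apply: eq_mean => v; rewrite eqseq_cons eqxx.
rewrite (@eq_mean _ _ _ _ (fun=> 0)) ?(mean_cst (string_mean_is_mean K)) ?mulr0 //.
by move=> v; rewrite eqseq_cons (negbTE ba).
Qed.

Lemma mean_count_mem K n u :
  strings_mean K n (fun s => (count_mem u s)%:R) =
  n%:R * string_mean K (fun v => (v == u)%:R).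
Proof.
elim: n => [|n IH]; first by rewrite mul0r.
have hn := strings_mean_is_mean K n.
have hK := string_mean_is_mean K; rewrite strings_meanS.
transitivity (string_mean K (fun v =>
    (v == u)%:R + strings_mean K n (fun s => (count_mem u s)%:R))).
  apply: eq_mean => v; rewrite -[X in X + _](mean_cst hn) -(meanD hn).
  by apply: eq_mean => s; rewrite -natrD.
by rewrite (meanD hK) (mean_cst hK) IH -add1n natrD mulrDl mul1r.
Qed.

(** A union bound over pairs. The factor one half is given up: the second factorial moment that
    remains has the simple Poisson mean lambda^2. *)
Lemma mean_collision K n :
  strings_mean K n (fun s => (~~ uniq s)%:R) <= (n * n.-1)%:R * coincidence ^+ K.
Proof.
elim: n => [|n IH]; first by rewrite mul0n mul0r.
have hn := strings_mean_is_mean K n.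
have hK := string_mean_is_mean K.
apply: (@le_trans _ _ (string_mean K (fun u => strings_mean K n (fun s =>
    (count_mem u s)%:R + (~~ uniq s)%:R)))).
  apply: (mean_le hK) => u; apply: (mean_le hn) => s /=.
  rewrite negb_and negbK -natrD ler_nat -has_pred1 has_count.
  by case: (count_mem u s) => //= k; case: uniq.
under [leLHS]eq_mean => u do rewrite (meanD hn) mean_count_mem.
rewrite (meanD hK) (meanZ hK) (mean_cst hK) string_coincidence.
apply: (le_trans (lerD (lexx _) IH)); rewrite -mulrDl -natrD.
by rewrite ler_wpM2r ?exprn_ge0 ?sumr_ge0 // => [a _|]; rewrite ?sqr_ge0 // ler_nat; case: n {IH hn} => //= n; lia.
Qed.

Section Toll.
Variables (a0 : A) (phi : {fset seq A} -> R) (M : R).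
Hypothesis phiM : forall T, is_trie T -> `|phi T| <= M.

Definition mean_toll K n := strings_mean K n (list_toll phi).
Definition mean_sum_tolls K n := strings_mean K n (list_sum phi K).

Lemma mean_sum_tollsS K n : mean_sum_tolls K.+1 n =
  mean_toll K.+1 n + \sum_a binomial_mean (p a) n (mean_sum_tolls K).
Proof.
have hn := strings_mean_is_mean K.+1 n.
rewrite /mean_sum_tolls (meanD hn) (mean_sum hn); congr (_ + _).
by apply: eq_bigr => a _; exact: mean_branch.
Qed.

Lemma mean_toll_bound K n : `|mean_toll K n| <= M.
Proof.
have hn := strings_mean_is_mean K n.
apply: (le_trans (mean_norm hn _)); rewrite -[leRHS](mean_cst hn).
by apply: (mean_le hn) => s; exact: list_toll_bound.
Qed.

Lemma mean_sum_tolls_succ K n :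
  `|mean_sum_tolls K n.+1 - mean_sum_tolls K n| <= 2 * M * K%:R.
Proof.
have hn := strings_mean_is_mean K n; have hK := string_mean_is_mean K.
rewrite /mean_sum_tolls -[strings_mean K n _](mean_cst hK) -(meanB hK).
apply: (le_trans (mean_norm hK _)); rewrite -[leRHS](mean_cst hK).
apply: (mean_le hK) => u; rewrite -(meanB hn).
apply: (le_trans (mean_norm hn _)); rewrite -[leRHS](mean_cst hn).
by apply: (mean_le hn) => s; exact: (list_sum_increment a0 phiM K [::]).
Qed.

(** This Lipschitz bound is what later allows a fixed number of strings to be exchanged for a
    Poisson number. *)
Lemma mean_sum_tolls_dist K n m :
  `|mean_sum_tolls K n - mean_sum_tolls K m| <= 2 * M * K%:R * `|n%:R - m%:R|.
Proof.
wlog nm : n m / (m <= n)%N.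
  by move=> wl; case/orP: (leq_total m n) => /wl //; rewrite distrC (distrC n%:R).
rewrite -natrB // normr_nat -[in leLHS](subnK nm).
elim: (n - m)%N => [|k IH]; first by rewrite add0n subrr normr0 mulr0.
rewrite -[k.+1 in leRHS]add1n natrD mulrDr mulr1.
rewrite -(subrKA (mean_sum_tolls K (k + m))).
by apply: (le_trans (ler_normD _ _)); apply: lerD IH; exact: mean_sum_tolls_succ.
Qed.

Lemma mean_sum_tolls_small K n : (n <= 1)%N -> mean_sum_tolls K n = 0.
Proof.
have hK := string_mean_is_mean K.
case: n => [|[|//]] _; rewrite /mean_sum_tolls /strings_mean /= ?list_sum_small //.
by rewrite -[RHS](mean_cst hK); apply: eq_mean => u; rewrite list_sum_small.
Qed.

Lemma mean_toll_small K n : (n <= 1)%N -> mean_toll K n = 0.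
Proof.
have hK := string_mean_is_mean K.
case: n => [|[|//]] _; rewrite /mean_toll /strings_mean /= ?/list_toll //=.
by rewrite -[RHS](mean_cst hK); apply: eq_mean => u.
Qed.

Lemma variance_sum_tolls K n :
  strings_mean K n (fun s => (list_sum phi K s - mean_sum_tolls K n) ^+ 2)
    <= n%:R * (2 * M * K%:R) ^+ 2.
Proof.
apply: (efron_stein (string_mean_is_mean K)) => s1 u s2.
exact: (list_sum_increment a0 phiM).
Qed.

End Toll.
End LetterMeans.

(** * Poisson means *)

Section CauchyProduct.
Variable R : realType.
Implicit Types u v : R ^nat.

Lemma cauchy_product_partial u v N :
  \sum_(0 <= n < N) \sum_(0 <= k < n.+1) u k * v (n - k)%N =
  \sum_(0 <= k < N) u k * series v (N - k)%N.
Proof.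
elim: N => [|N IH]; first by rewrite !big_nil.
rewrite big_nat_recr //= IH [in RHS]big_nat_recr //= subSnn.
rewrite [in RHS](@eq_big_nat _ _ _ 0 N _ (fun k => u k * series v (N - k)%N + u k * v (N - k)%N)).
  rewrite big_split /= -addrA; congr (_ + _); rewrite big_nat_recr //= subnn.
  by rewrite /series /= big_nat1.
move=> k /andP[_ kN]; rewrite -mulrDr; congr (_ * _).
by rewrite subSn 1?ltnW // /series /= big_nat_recr.
Qed.

(** Partial sums of the product are sums of [u k] times partial sums of [v]. Below the index [n2]
    those partial sums are close to the limit [V]; above it they are merely bounded, but the tail of
    [u] is small. *)
Lemma cauchy_product u v : cvgn [normed series u] -> cvgn [normed series v] ->
  series (fun n => \sum_(0 <= k < n.+1) u k * v (n - k)%N) @ \oo -->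
  limn (series u) * limn (series v).
Proof.
move=> cu cv; have cv' := normed_cvg cv; have cu' := normed_cvg cu.
set V := limn (series v).
have [B hB] : exists B, forall j, `|series v j - V| <= B.
  have : cvgn (fun j => series v j - V) by apply: is_cvgB => //; exact: is_cvg_cst.
  move/cvg_seq_bounded => [B [_ hB]]; exists (B + 1) => j.
  by apply: hB => //; rewrite ltrDl.
have B0 : 0 <= B by exact: le_trans (hB 0%N).
set W := limn [normed series u].
have W0 : 0 <= W by apply: limr_ge => //; near=> n; rewrite /series /= sumr_ge0.
have UW N : [normed series u] N <= W.
  apply: nondecreasing_cvgn_le => //; apply/nondecreasing_seqP => n.
  by rewrite /series /= [leRHS]big_nat_recr //= lerDl.
suff D0 : (fun N => \sum_(0 <= k < N) u k * (series v (N - k)%N - V)) @ \oo --> (0 : R).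
  rewrite [X in X @ _ --> _](_ : _ = (fun N =>
    \sum_(0 <= k < N) u k * (series v (N - k)%N - V) + series u N * V)).
    by rewrite -[X in _ --> X]add0r; apply: cvgD => //; apply: cvgMl.
  apply/funext => N; rewrite [LHS]cauchy_product_partial /series /= mulr_suml -big_split /=.
  by apply: eq_bigr => k _; rewrite -mulrDr subrK.
(* [W] bounds the sum of the [u k] in norm and [B] the distance of the partial sums of [v] to [V];
   the two parts of the error cost W e' and B e', and the added 1 keeps the denominator positive. *)
apply/cvgrPdist_le => /= e e0; pose e' := e / (W + B + 1).
have WB : 0 < W + B + 1 by rewrite ltr_wpDl // addr_ge0.
have e'0 : 0 < e' by rewrite divr_gt0.
have [n1 _ h1] : \forall j \near \oo, `|series v j - V| <= e'.
  by move/cvgrPdist_le : cv' => /(_ _ e'0); apply: filterS => j; rewrite distrC.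
have [n2 _ h2] : \forall j \near \oo, W - [normed series u] j <= e'.
  move/cvgrPdist_le : cu => /(_ _ e'0); apply: filterS => j.
  by apply: le_trans; exact: ler_norm.
near=> N; rewrite sub0r normrN.
have N1 : (n1 + n2 <= N)%N by near: N; exact: nbhs_infty_ge.
have n2N : (n2 <= N)%N by apply: leq_trans N1; rewrite leq_addl.
rewrite (big_cat_nat (n := n2)) //=.
apply: le_trans (ler_normD _ _) _.
have -> : e = W * e' + B * e' + e' by rewrite /e'; field; rewrite gt_eqF.
rewrite -[leLHS]addr0; apply: lerD; last exact: ltW.
apply: lerD.
  apply: (@le_trans _ _ ([normed series u] n2 * e')); last by rewrite ler_wpM2r // ltW.
  apply: le_trans (ler_norm_sum _ _ _) _; rewrite /series /= mulr_suml.
  rewrite big_seq [leRHS]big_seq; apply: ler_sum => k; rewrite mem_index_iota => /andP[_ kn].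
  by rewrite normrM ler_wpM2l //; apply: h1 => /=; lia.
apply: (@le_trans _ _ ((\sum_(n2 <= k < N) `|u k|) * B)).
  apply: le_trans (ler_norm_sum _ _ _) _; rewrite mulr_suml.
  by apply: ler_sum => k _; rewrite normrM ler_wpM2l.
rewrite mulrC ler_wpM2l //; apply: le_trans (h2 n2 (leqnn _)).
rewrite lerBrDl; apply: le_trans (UW N).
by rewrite /series /= [leRHS](big_cat_nat (n := n2)).
Unshelve. all: by end_near. Qed.

End CauchyProduct.

Section PoissonMean.
Variable R : realType.
Implicit Types (h : nat -> R) (lam : R).

(** Any base would make the Poisson series converge absolutely; 4 is what n (n - 1) needs when each
    factor is bounded by 2^n. *)
Definition geometric_growth h := exists C, forall n, `|h n| <= C * 4 ^+ n.

Definition poisson_mean lam h : R :=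
  expR (- lam) * limn (series (fun n => h n * exp_coeff lam n)).

Lemma geometric_growthD g h : geometric_growth g -> geometric_growth h ->
  geometric_growth (fun n => g n + h n).
Proof.
move=> [C hC] [D hD]; exists (C + D) => n; rewrite mulrDl.
exact: le_trans (ler_normD _ _) (lerD _ _).
Qed.

Lemma geometric_growthZ c h : geometric_growth h -> geometric_growth (fun n => c * h n).
Proof. by move=> [C hC]; exists (`|c| * C) => n; rewrite normrM -mulrA ler_wpM2l. Qed.

Lemma geometric_growth_le g h : (forall n, `|g n| <= h n) ->
  geometric_growth h -> geometric_growth g.
Proof.
move=> gh [C hC]; exists C => n; apply: le_trans (gh n) _.
exact: le_trans (ler_norm _) (hC n).
Qed.

Lemma geometric_growth_cst c : geometric_growth (fun=> c).
Proof.
exists `|c| => n; rewrite -[leLHS]mulr1 ler_wpM2l // exprn_ege1 //.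
by rewrite ler1n.
Qed.

Lemma geometric_growth_nat : geometric_growth (fun n => n%:R).
Proof.
exists 1 => n; rewrite normr_nat mul1r -natrX ler_nat.
by apply: ltnW; exact: ltn_expl.
Qed.

Lemma geometric_growth_fact2 : geometric_growth (fun n => (n * n.-1)%:R).
Proof.
exists 1 => n; rewrite normr_nat mul1r -natrX ler_nat (_ : 4 = 2 * 2)%N // expnMn.
by apply: leq_mul; [|apply: leq_trans (leq_pred n) _]; apply: ltnW; exact: ltn_expl.
Qed.

Lemma exp_coeff_geometric_cvg lam h : 0 <= lam -> geometric_growth h ->
  cvgn [normed series (fun n => h n * exp_coeff lam n)].
Proof.
move=> l0 [C hC]; apply: (@series_le_cvg _ _ (fun n => C * exp_coeff (4 * lam) n)).
- by move=> n; exact: normr_ge0.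
- move=> n; rewrite mulr_ge0 ?exp_coeff_ge0 ?mulr_ge0 //.
  by apply: le_trans (normr_ge0 (h 0%N)) _; rewrite -[leRHS]mulr1 -(expr0 4).
- move=> n; rewrite /= normrM (ger0_norm (exp_coeff_ge0 n l0)).
  rewrite /exp_coeff /= exprMn !mulrA ler_wpM2r ?invr_ge0 ?ler0n //.
  by rewrite ler_wpM2r ?exprn_ge0.
- by apply: (@is_cvg_seriesZ _ (exp_coeff (4 * lam))); exact: is_cvg_series_exp_coeff.
Qed.

Lemma poisson_mean_cvg lam h : 0 <= lam -> geometric_growth h ->
  (fun N => expR (- lam) * series (fun n => h n * exp_coeff lam n) N) @ \oo
    --> poisson_mean lam h.
Proof.
move=> l0 gh; apply: cvgMr; apply: normed_cvg; exact: exp_coeff_geometric_cvg.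
Qed.

Lemma poisson_mean_lim lam h l : 0 <= lam -> geometric_growth h ->
  (fun N => expR (- lam) * series (fun n => h n * exp_coeff lam n) N) @ \oo --> l ->
  poisson_mean lam h = l.
Proof.
by move=> l0 gh; apply: cvg_unique; [exact: norm_hausdorff|exact: poisson_mean_cvg].
Qed.

Lemma poisson_meanD lam g h : 0 <= lam -> geometric_growth g -> geometric_growth h ->
  poisson_mean lam (fun n => g n + h n) = poisson_mean lam g + poisson_mean lam h.
Proof.
move=> l0 gg gh; apply: poisson_mean_lim => //; first exact: geometric_growthD.
rewrite [X in X @ _ --> _](_ : _ = (fun N =>
  expR (- lam) * series (fun n => g n * exp_coeff lam n) N +
  expR (- lam) * series (fun n => h n * exp_coeff lam n) N)).
  by apply: cvgD; exact: poisson_mean_cvg.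
apply/funext => N; rewrite -mulrDr /series /= -big_split /=; congr (_ * _).
by apply: eq_bigr => n _; rewrite mulrDl.
Qed.

Lemma poisson_meanZ lam c h : 0 <= lam -> geometric_growth h ->
  poisson_mean lam (fun n => c * h n) = c * poisson_mean lam h.
Proof.
move=> l0 gh; apply: poisson_mean_lim => //; first exact: geometric_growthZ.
rewrite [X in X @ _ --> _](_ : _ = (fun N =>
  c * (expR (- lam) * series (fun n => h n * exp_coeff lam n) N))).
  by apply: cvgMr; exact: poisson_mean_cvg.
apply/funext => N; rewrite mulrCA; congr (_ * _); rewrite /series /= mulr_sumr.
by apply: eq_bigr => n _; rewrite -mulrA.
Qed.

Lemma poisson_meanB lam g h : 0 <= lam -> geometric_growth g -> geometric_growth h ->
  poisson_mean lam (fun n => g n - h n) = poisson_mean lam g - poisson_mean lam h.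
Proof.
move=> l0 gg gh; rewrite -mulN1r -poisson_meanZ // -poisson_meanD //.
  by congr poisson_mean; apply/funext => n; rewrite mulN1r.
exact: geometric_growthZ.
Qed.

Lemma poisson_mean_sum lam (I : Type) (r : seq I) (h : I -> nat -> R) :
  0 <= lam -> (forall i, geometric_growth (h i)) ->
  poisson_mean lam (fun n => \sum_(i <- r) h i n) = \sum_(i <- r) poisson_mean lam (h i).
Proof.
move=> l0 gh; suff [] : geometric_growth (fun n => \sum_(i <- r) h i n) /\
  poisson_mean lam (fun n => \sum_(i <- r) h i n) = \sum_(i <- r) poisson_mean lam (h i) by [].
elim: r => [|i r [gr IH]].
  under eq_fun do rewrite big_nil; rewrite big_nil; split.
    exact: geometric_growth_cst.
  rewrite (_ : (fun=> 0) = (fun n : nat => 0 * 0)); last by apply/funext => ?; rewrite mul0r.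
  by rewrite poisson_meanZ ?mul0r //; exact: geometric_growth_cst.
under eq_fun do rewrite big_cons; rewrite big_cons -IH; split.
  exact: geometric_growthD.
exact: poisson_meanD.
Qed.

Lemma poisson_mean_le lam g h : 0 <= lam -> geometric_growth g -> geometric_growth h ->
  (forall n, g n <= h n) -> poisson_mean lam g <= poisson_mean lam h.
Proof.
move=> l0 gg gh glh; rewrite /poisson_mean ler_wpM2l ?expR_ge0 //.
apply: lim_series_le; [apply: normed_cvg| apply: normed_cvg|];
  try exact: exp_coeff_geometric_cvg.
by move=> n; rewrite ler_wpM2r ?exp_coeff_ge0.
Qed.

Lemma poisson_mean_norm lam g h : 0 <= lam -> geometric_growth h ->
  (forall n, `|g n| <= h n) -> `|poisson_mean lam g| <= poisson_mean lam h.
Proof.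
move=> l0 gh glh; have gg := geometric_growth_le glh gh.
rewrite ler_norml; apply/andP; split.
  rewrite lerNl -mulN1r -poisson_meanZ //; apply: poisson_mean_le => //.
    exact: geometric_growthZ.
  by move=> n; rewrite mulN1r; apply: le_trans (glh n); rewrite -normrN ler_norm.
apply: poisson_mean_le => // n; exact: le_trans (ler_norm _) (glh n).
Qed.

Lemma poisson_mean_cst lam c : 0 <= lam -> poisson_mean lam (fun=> c) = c.
Proof.
move=> l0; rewrite (_ : (fun=> c) = (fun n : nat => c * 1)); last by apply/funext => ?; rewrite mulr1.
rewrite poisson_meanZ //; last exact: geometric_growth_cst.
rewrite /poisson_mean; under [X in series X]eq_fun do rewrite mul1r.
by rewrite -/(expR lam) expRN mulVf ?mulr1 // gt_eqF // expR_gt0.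
Qed.

(** With g(n) = n h(n - 1), this is the identity E[N h(N - 1)] = lambda E[h(N)] that characterizes
    the Poisson law; the first two moments follow from it. *)
Lemma poisson_mean_shift lam g h : 0 <= lam -> geometric_growth g -> geometric_growth h ->
  g 0%N = 0 -> (forall n, g n.+1 = n.+1%:R * h n) ->
  poisson_mean lam g = lam * poisson_mean lam h.
Proof.
move=> l0 gg gh g0 gS; apply: poisson_mean_lim => //.
rewrite -cvg_shiftS /=.
rewrite [X in X @ _ --> _](_ : _ = (fun N =>
  lam * (expR (- lam) * series (fun n => h n * exp_coeff lam n) N))).
  by apply: cvgMr; exact: poisson_mean_cvg.
apply/funext => N; rewrite mulrCA; congr (_ * _); rewrite /series /= mulr_sumr.
rewrite big_nat_recl // g0 mul0r add0r; apply: eq_bigr => n _.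
rewrite gS /exp_coeff /= factS natrM exprS invfM.
have n0 : n.+1%:R != 0 :> R by rewrite pnatr_eq0.
have f0 : n`!%:R != 0 :> R by rewrite pnatr_eq0 -lt0n fact_gt0.
by field; rewrite nat1r n0 f0.
Qed.

Lemma poisson_mean_nat lam : 0 <= lam -> poisson_mean lam (fun n => n%:R) = lam.
Proof.
move=> l0; rewrite (@poisson_mean_shift lam _ (fun=> 1)) // ?poisson_mean_cst ?mulr1 //.
- exact: geometric_growth_nat.
- exact: geometric_growth_cst.
- by move=> n; rewrite mulr1.
Qed.

Lemma poisson_mean_fact2 lam : 0 <= lam ->
  poisson_mean lam (fun n => (n * n.-1)%:R) = lam ^+ 2.
Proof.
move=> l0; rewrite (@poisson_mean_shift lam _ (fun n => n%:R)) // ?poisson_mean_nat //.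
- exact: geometric_growth_fact2.
- exact: geometric_growth_nat.
- by move=> n; rewrite natrM.
Qed.

Lemma geometric_growth_sqr_dist lam : geometric_growth (fun n => (n%:R - lam) ^+ 2).
Proof.
apply: (@geometric_growth_le _ (fun n => (n * n.-1)%:R + ((1 + 2 * `|lam|) * n%:R + lam ^+ 2))).
  move=> n; rewrite ger0_norm ?sqr_ge0 // -subr_ge0.
  rewrite (_ : _ - _ = 2 * n%:R * (`|lam| + lam)).
    by rewrite !mulr_ge0 //; have := ler_norm (- lam); rewrite normrN; lra.
  by case: n => [|n]; rewrite ?natrM /= -?natr1; ring.
apply: geometric_growthD; first exact: geometric_growth_fact2.
apply: geometric_growthD; last exact: geometric_growth_cst.
exact/geometric_growthZ/geometric_growth_nat.
Qed.

Lemma poisson_mean_variance lam : 0 <= lam ->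
  poisson_mean lam (fun n => (n%:R - lam) ^+ 2) = lam.
Proof.
move=> l0; rewrite (_ : (fun n => _) =
  (fun n => (n * n.-1)%:R + ((1 - 2 * lam) * n%:R + lam ^+ 2))); last first.
  by apply/funext => -[|n]; rewrite ?natrM /= -?natr1; ring.
have g1 := geometric_growthZ (1 - 2 * lam) geometric_growth_nat.
have g2 := geometric_growth_cst (lam ^+ 2).
rewrite (poisson_meanD l0 geometric_growth_fact2 (geometric_growthD g1 g2)).
rewrite (poisson_meanD l0 g1 g2) (poisson_meanZ _ l0 geometric_growth_nat).
by rewrite poisson_mean_fact2 // poisson_mean_nat // poisson_mean_cst //; ring.
Qed.

Lemma binomial_mean_cst (q : R) n : binomial_mean q n (fun=> 1) = 1.
Proof.
elim: n => [|n IH]; first by rewrite binomial_mean0.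
by rewrite binomial_meanS IH; ring.
Qed.

Lemma binomial_mean_growth (q : R) h : 0 <= q <= 1 -> geometric_growth h ->
  geometric_growth (fun n => binomial_mean q n h).
Proof.
move=> /andP[q0 q1] [C hC].
have C0 : 0 <= C.
  by apply: le_trans (normr_ge0 (h 0%N)) _; rewrite -[leRHS]mulr1 -(expr0 4).
exists C => n; rewrite /binomial_mean.
apply: le_trans (ler_norm_sum _ _ _) _.
rewrite -[leRHS]mulr1 -[X in _ <= _ * X](binomial_mean_cst q n) /binomial_mean mulr_sumr.
apply: ler_sum => k _; rewrite mulr1.
have w0 : 0 <= 'C(n, k)%:R * q ^+ k * (1 - q) ^+ (n - k).
  by rewrite !mulr_ge0 ?exprn_ge0 ?subr_ge0.
rewrite normrM (ger0_norm w0) [leRHS]mulrC ler_wpM2l //; apply: le_trans (hC k) _.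
by rewrite ler_wpM2l // ler_weXn2l ?ler1n // -ltnS.
Qed.

(** The binomial coefficient splits lam^n / n! into the coefficients for q lam and (1 - q) lam, so
    the series is a Cauchy product whose second factor sums to an exponential. *)
Lemma poisson_thinning lam q h : 0 <= lam -> 0 <= q <= 1 -> geometric_growth h ->
  poisson_mean lam (fun n => binomial_mean q n h) = poisson_mean (q * lam) h.
Proof.
move=> l0 q01 gh; have /andP[q0 q1] := q01.
have ql0 : 0 <= q * lam by rewrite mulr_ge0.
have rl0 : 0 <= (1 - q) * lam by rewrite mulr_ge0 ?subr_ge0.
apply: poisson_mean_lim => //; first exact: binomial_mean_growth.
have ce : cvgn [normed series (exp_coeff ((1 - q) * lam))].
  by rewrite normed_series_exp_coeff; exact: is_cvg_series_exp_coeff.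
have := @cauchy_product _ (fun k => h k * exp_coeff (q * lam) k)
  (exp_coeff ((1 - q) * lam)) (exp_coeff_geometric_cvg ql0 gh) ce.
move=> /(cvgMr (a := expR (- lam))) /=.
rewrite -/(expR ((1 - q) * lam)) mulrCA -expRD (_ : - lam + _ = - (q * lam)); last by ring.
rewrite [_ * expR (- (q * lam))]mulrC -/(poisson_mean (q * lam) h) => H.
rewrite [X in X @ _ --> _](_ : _ = (fun N => expR (- lam) * series (fun n =>
  \sum_(0 <= k < n.+1) h k * exp_coeff (q * lam) k * exp_coeff ((1 - q) * lam) (n - k)%N) N)); first exact: H.
apply/funext => N; congr (_ * _).
rewrite /series /=; apply: eq_bigr => n _.
rewrite /binomial_mean mulr_suml big_mkord; apply: eq_bigr => -[k /= kn] _.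
have kn' : (k <= n)%N by rewrite -ltnS.
rewrite /exp_coeff /= !exprMn -[in lam ^+ n](subnKC kn') exprD.
have f1 m : m`!%:R != 0 :> R by rewrite pnatr_eq0 -lt0n fact_gt0.
have -> : 'C(n, k)%:R = n`!%:R / (k`!%:R * (n - k)`!%:R) :> R.
  by rewrite -(bin_fact kn') !natrM mulfK // mulf_neq0.
by field; rewrite !f1.
Qed.

End PoissonMean.

Lemma cvg_fin_sum (R : realType) (T : Type) (F : set_system T) (FF : Filter F)
    (I : Type) (r : seq I) (f : I -> T -> R) (l : I -> R) :
  (forall i, f i @ F --> l i) ->
  (fun x => \sum_(i <- r) f i x) @ F --> \sum_(i <- r) l i.
Proof.
move=> fl; elim: r => [|i r IH].
  by under eq_fun do rewrite big_nil; rewrite big_nil; exact: cvg_cst.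
by under eq_fun do rewrite big_cons; rewrite big_cons; exact: cvgD.
Qed.

Section PoissonTransform.
Variables (R : realType) (M : R) (a : nat -> R).
Hypotheses (aM : forall n, `|a n| <= M) (a_small : forall n, (n <= 1)%N -> a n = 0).

Lemma bounded_geometric_growth : geometric_growth a.
Proof. exact: geometric_growth_le aM (geometric_growth_cst M). Qed.

Lemma bound_ge0 : 0 <= M. Proof. exact: le_trans (normr_ge0 _) (aM 0%N). Qed.

Lemma poisson_mean_bound lam : 0 <= lam -> `|poisson_mean lam a| <= M.
Proof.
move=> l0; rewrite -[leRHS](poisson_mean_cst M l0).
by apply: poisson_mean_norm => //; exact: geometric_growth_cst.
Qed.

(** As [a] vanishes at 0 and 1, [a n] is at most M n (n - 1) in absolute value. *)
Lemma poisson_mean_sqr_bound lam : 0 <= lam -> `|poisson_mean lam a| <= M * lam ^+ 2.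
Proof.
move=> l0; rewrite -poisson_mean_fact2 // -poisson_meanZ //; last exact: geometric_growth_fact2.
apply: poisson_mean_norm => //; first exact/geometric_growthZ/geometric_growth_fact2.
move=> n; case: (leqP n 1) => n1; first by rewrite a_small // normr0 mulr_ge0 // bound_ge0.
apply: le_trans (aM n) _; rewrite -[leLHS]mulr1 ler_wpM2l ?bound_ge0 // ler1n.
by case: n n1 => [|[|n]].
Qed.

(** The quadratic bound for lam <= 1 and the constant bound beyond, merged into the form that the
    supersolution can absorb. The 4 is 2^2, from 1 + lam <= 2 and 1 + lam <= 2 lam respectively. *)
Lemma poisson_mean_ratio_bound lam : 0 <= lam ->
  `|poisson_mean lam a| <= 4 * M * (lam / (1 + lam)) ^+ 2.
Proof.
move=> l0; have M0 := bound_ge0; have l1 : 0 < 1 + lam by rewrite ltr_wpDr.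
rewrite expr_div_n mulrA ler_pdivlMr ?exprn_gt0 //.
have [l1'|l1'] := lerP lam 1.
  apply: le_trans (ler_wpM2r _ (poisson_mean_sqr_bound l0)) _; first exact: sqr_ge0.
  have -> : 4 * M * lam ^+ 2 = M * lam ^+ 2 * 2 ^+ 2 by ring.
  by rewrite ler_wpM2l ?mulr_ge0 ?sqr_ge0 // lerXn2r ?nnegrE; lra.
apply: le_trans (ler_wpM2r _ (poisson_mean_bound l0)) _; first exact: sqr_ge0.
have -> : 4 * M * lam ^+ 2 = M * (2 * lam) ^+ 2 by ring.
by rewrite ler_wpM2l // lerXn2r ?nnegrE; lra.
Qed.

(** The binomial count differs from [n] only if some trial fails, which has probability 1 - q^n <= n
    (1 - q). For n >= 2 this is at most (1 - q) n (n - 1), and for smaller [n] both terms vanish. *)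
Lemma binomial_mean_dist q n : 0 <= q <= 1 ->
  `|a n - binomial_mean q n a| <= 2 * M * (1 - q) * (n * n.-1)%:R.
Proof.
move=> /andP[q0 q1]; have M0 := bound_ge0.
have [n1|n1] := leqP n 1.
  rewrite a_small // (_ : binomial_mean q n a = 0) ?subrr ?normr0.
    by rewrite !mulr_ge0 // subr_ge0.
  rewrite /binomial_mean big1 // => -[k /= kn] _; rewrite a_small ?mulr0 //.
  by rewrite ltnS in kn; exact: leq_trans kn n1.
pose w k := 'C(n, k)%:R * q ^+ k * (1 - q) ^+ (n - k).
have w0 k : 0 <= w k by rewrite /w !mulr_ge0 ?exprn_ge0 // subr_ge0.
have w1 : \sum_(k < n.+1) w k = 1.
  by rewrite -(binomial_mean_cst q n); apply: eq_bigr => k _; rewrite mulr1.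
have wn : w n = q ^+ n by rewrite /w binn subnn expr0 mul1r mulr1.
have E : a n - binomial_mean q n a = \sum_(k < n) w k * (a n - a k).
  transitivity (\sum_(k < n.+1) w k * (a n - a k)).
    under eq_bigr do rewrite mulrBr; rewrite sumrB; congr (_ - _).
    by rewrite -mulr_suml w1 mul1r.
  by rewrite big_ord_recr /= subrr mulr0 addr0.
rewrite E; apply: le_trans (ler_norm_sum _ _ _) _.
apply: (@le_trans _ _ (\sum_(k < n) w k * (2 * M))).
  apply: ler_sum => k _; rewrite normrM ger0_norm // ler_wpM2l //.
  by apply: le_trans (ler_normB _ _) _; rewrite mulr_natl mulr2n lerD.
rewrite -mulr_suml mulrC -mulrA ler_wpM2l ?mulr_ge0 //.
have -> : \sum_(k < n) w k = 1 - q ^+ n.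
  by rewrite -w1 big_ord_recr /= wn addrK.
apply: (@le_trans _ _ ((1 - q) * n%:R)); last first.
  by rewrite ler_wpM2l ?subr_ge0 // ler_nat; case: n n1 {w w0 w1 wn E} => [|[|n]] //= _; lia.
elim: n {n1 w w0 w1 wn E} => [|n IH]; first by rewrite subrr mulr0.
rewrite exprS -natr1 mulrDr mulr1.
have -> : 1 - q * q ^+ n = (1 - q ^+ n) + (1 - q) * q ^+ n by ring.
by rewrite lerD // -[leRHS]mulr1 ler_wpM2l ?subr_ge0 // exprn_ile1.
Qed.

(** The Poisson law with mean lam is the thinning by 1/r of the one with mean r lam, and (1 - 1/r)
    (r lam)^2 = (r - 1) r lam^2. *)
Lemma poisson_mean_dist lam r : 0 <= lam -> 1 <= r ->
  `|poisson_mean (r * lam) a - poisson_mean lam a| <= 2 * M * ((r - 1) * r) * lam ^+ 2.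
Proof.
move=> l0 r1; have r0 : 0 < r by exact: lt_le_trans r1.
have r0' : r != 0 by rewrite gt_eqF.
have rl0 : 0 <= r * lam by rewrite mulr_ge0 // ltW.
have q01 : 0 <= r^-1 <= 1 by rewrite invr_ge0 ltW //= invf_le1.
have ga := bounded_geometric_growth.
rewrite -[in poisson_mean lam a](mulKf r0' lam) -(poisson_thinning rl0 q01 ga).
rewrite -poisson_meanB //; last exact: binomial_mean_growth.
apply: (@le_trans _ _ (2 * M * (1 - r^-1) * (r * lam) ^+ 2)).
  rewrite -poisson_mean_fact2 // -poisson_meanZ //; last exact: geometric_growth_fact2.
  apply: poisson_mean_norm => //; first exact/geometric_growthZ/geometric_growth_fact2.
  by move=> n; exact: binomial_mean_dist.
rewrite le_eqVlt; apply/orP; left; apply/eqP.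
by field; rewrite gt_eqF.
Qed.

End PoissonTransform.

(** * Sums over the tree of strings *)

Section BranchSums.
Variables (R : realType) (A : finType) (p : A -> R).
Hypotheses (p_gt0 : forall a, 0 < p a) (p_sum : \sum_a p a = 1).
Local Notation theta := (coincidence p).
Implicit Types (f g Q : R -> R) (lam : R).

(** The sum of f(p(v) lam) over all strings v of length less than [N], where p(v) is the product of
    the letter probabilities. *)
Fixpoint branch_sum N f lam : R :=
  if N is N'.+1 then f lam + \sum_a branch_sum N' f (p a * lam) else 0.

Definition tree_sum f lam : R := limn (fun N => branch_sum N f lam).

(** A comparison principle: a supersolution [Q] of the functional equation dominates all partial
    sums. *)
Lemma branch_sum_le f Q :
  (forall lam, 0 <= lam -> `|f lam| + \sum_a Q (p a * lam) <= Q lam) ->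
  (forall lam, 0 <= lam -> 0 <= Q lam) ->
  forall N lam, 0 <= lam -> `|branch_sum N f lam| <= Q lam.
Proof.
move=> fQ Q0; elim=> [|N IH] lam l0 /=; first by rewrite normr0 Q0.
apply: le_trans (fQ _ l0); apply: le_trans (ler_normD _ _) _; rewrite lerD2l.
apply: le_trans (ler_norm_sum _ _ _) _; apply: ler_sum => a _.
by apply: IH; rewrite mulr_ge0 // ltW.
Qed.

(** The increment is the level of strings of length [N], over which p(v)^2 sums to theta^N. *)
Lemma branch_sum_incr f C : (forall lam, 0 <= lam -> `|f lam| <= C * lam ^+ 2) ->
  forall N lam, 0 <= lam ->
  `|branch_sum N.+1 f lam - branch_sum N f lam| <= C * lam ^+ 2 * theta ^+ N.
Proof.
move=> fC; elim=> [|N IH] lam l0.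
  rewrite /= big1 // addr0 subr0 mulr1; exact: fC.
rewrite [branch_sum N.+2 f lam]/= [branch_sum N.+1 f lam]/= opprD addrACA subrr add0r -sumrB.
apply: le_trans (ler_norm_sum _ _ _) _.
apply: (@le_trans _ _ (\sum_a C * (p a * lam) ^+ 2 * theta ^+ N)).
  by apply: ler_sum => a _; apply: IH; rewrite mulr_ge0 // ltW.
rewrite (eq_bigr (fun a => p a ^+ 2 * (C * lam ^+ 2 * theta ^+ N))) => [|b _]; last by ring.
by rewrite -mulr_suml -/(coincidence p) [theta ^+ _.+1]exprS le_eqVlt; apply/orP; left; apply/eqP; ring.
Qed.

Variables (f : R -> R) (C : R).
Hypothesis fC : forall lam, 0 <= lam -> `|f lam| <= C * lam ^+ 2.

Lemma coincidence_ge0 : 0 <= theta.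
Proof. by apply: sumr_ge0 => a _; exact: sqr_ge0. Qed.

Hypothesis theta_lt1 : theta < 1.

Lemma tree_sum_cvg lam : 0 <= lam ->
  (fun N => branch_sum N f lam) @ \oo --> tree_sum f lam.
Proof.
move=> l0; pose u N := branch_sum N.+1 f lam - branch_sum N f lam.
have uE : (fun N => branch_sum N f lam) = series u.
  by apply/funext => N; rewrite /series /= telescope_sumr //= subr0.
suff : cvgn (series u) by rewrite -uE.
apply: normed_cvg; apply: (@series_le_cvg _ _ (geometric (C * lam ^+ 2) theta)).
- by move=> n; exact: normr_ge0.
- move=> n; rewrite /geometric /= mulr_ge0 ?exprn_ge0 ?coincidence_ge0 //.
  exact: le_trans (normr_ge0 _) (fC l0).
- by move=> n; exact: branch_sum_incr.
- by apply: is_cvg_geometric_series; rewrite ger0_norm ?coincidence_ge0.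
Qed.

Lemma tree_sum_eq lam : 0 <= lam ->
  tree_sum f lam = f lam + \sum_a tree_sum f (p a * lam).
Proof.
move=> l0; have := tree_sum_cvg l0; rewrite -cvg_shiftS /= => H.
apply: (cvg_unique _ H); first exact: norm_hausdorff.
apply: cvgD; first exact: cvg_cst.
apply: cvg_fin_sum => a; apply: tree_sum_cvg; by rewrite mulr_ge0 // ltW.
Qed.

Lemma tree_sum_le Q : (forall lam, 0 <= lam -> `|f lam| + \sum_a Q (p a * lam) <= Q lam) ->
  (forall lam, 0 <= lam -> 0 <= Q lam) ->
  forall lam, 0 <= lam -> `|tree_sum f lam| <= Q lam.
Proof.
move=> fQ Q0 lam l0; have cv : (fun N => `|branch_sum N f lam|) @ \oo --> `|tree_sum f lam|.
  exact: (cvg_norm (tree_sum_cvg l0)).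
rewrite -(cvg_lim (@norm_hausdorff _ _) cv); apply: limr_le.
  exact: (cvgP _ cv).
by apply: nearW => N; exact: branch_sum_le.
Qed.

(** [G] solves the functional equation of the tree sum up to a defect at each level. Defects travel
    to the root through the squares (p a lam)^2, whose sum over [a] supplies one factor theta per
    level; hence all [K] of them weigh B lam^2 theta^K. *)
Lemma tree_sum_approx (B C' : R) (G : nat -> R -> R) :
  (forall lam, 0 <= lam -> `|tree_sum f lam| <= C' * lam ^+ 2) ->
  (forall lam, 0 <= lam -> G 0%N lam = 0) ->
  (forall K lam, 0 <= lam ->
    `|f lam + \sum_a G K (p a * lam) - G K.+1 lam| <= B * lam ^+ 2 * theta ^+ K.+1) ->
  forall K lam, 0 <= lam ->
    `|tree_sum f lam - G K lam| <= (C' + B * K%:R) * lam ^+ 2 * theta ^+ K.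
Proof.
move=> FC G0 GS; elim=> [|K IH] lam l0.
  by rewrite G0 // subr0 mulr0 addr0 mulr1; exact: FC.
rewrite tree_sum_eq //.
have -> : f lam + \sum_a tree_sum f (p a * lam) - G K.+1 lam =
  \sum_a (tree_sum f (p a * lam) - G K (p a * lam)) +
  (f lam + \sum_a G K (p a * lam) - G K.+1 lam) by rewrite sumrB; ring.
apply: le_trans (ler_normD _ _) _.
have -> : (C' + B * K.+1%:R) * lam ^+ 2 * theta ^+ K.+1 =
  (C' + B * K%:R) * lam ^+ 2 * theta ^+ K.+1 + B * lam ^+ 2 * theta ^+ K.+1.
  by rewrite -[K.+1%:R]natr1; ring.
apply: lerD; last exact: GS.
apply: le_trans (ler_norm_sum _ _ _) _.
apply: (@le_trans _ _ (\sum_a (C' + B * K%:R) * (p a * lam) ^+ 2 * theta ^+ K)).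
  by apply: ler_sum => a _; apply: IH; rewrite mulr_ge0 // ltW.
rewrite (eq_bigr (fun a => p a ^+ 2 * ((C' + B * K%:R) * lam ^+ 2 * theta ^+ K))) => [|b _]; last by ring.
by rewrite -mulr_suml -/(coincidence p) [theta ^+ _.+1]exprS le_eqVlt; apply/orP; left; apply/eqP; ring.
Qed.

End BranchSums.

Section TreeSumPoisson.
Variables (R : realType) (A : finType) (p : A -> R).
Hypotheses (p_gt0 : forall a, 0 < p a) (p_sum : \sum_a p a = 1).
Local Notation theta := (coincidence p).
Hypothesis theta_lt1 : theta < 1.

Lemma le1_letter a : p a <= 1.
Proof. by rewrite -p_sum (bigD1 a) //= lerDl sumr_ge0 // => b _; exact: ltW. Qed.

(* [lam^2 / (1 + lam) = lam - lam / (1 + lam)] is strictly subadditive along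
   the branching [lam |-> (p a * lam)_a], which makes it a supersolution. *)
Lemma branch_supersolution lam : 0 <= lam ->
  (1 - theta) * (lam / (1 + lam)) ^+ 2 + \sum_a ((p a * lam) ^+ 2 / (1 + p a * lam))
  <= lam ^+ 2 / (1 + lam).
Proof.
move=> l0; have l1 : 0 < 1 + lam by rewrite ltr_wpDr.
have pl a : 0 < 1 + p a * lam by rewrite ltr_wpDr // mulr_ge0 // ltW.
(* Both this side and 1 - theta are spread over the letters with weights [p a], so the inequality
   can be checked letter by letter. *)
have -> : lam ^+ 2 / (1 + lam) = \sum_a p a * (lam ^+ 2 / (1 + lam)).
  by rewrite -mulr_suml p_sum mul1r.
have -> : 1 - theta = \sum_a p a * (1 - p a).
  rewrite (eq_bigr (fun a => p a - p a ^+ 2)) => [|a _]; last by ring.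
  by rewrite sumrB p_sum.
rewrite mulr_suml -big_split /=; apply: ler_sum => a _.
rewrite -lerBrDr -subr_ge0.
have -> : p a * (lam ^+ 2 / (1 + lam)) - (p a * lam) ^+ 2 / (1 + p a * lam) -
   p a * (1 - p a) * (lam / (1 + lam)) ^+ 2 =
   p a * (1 - p a) ^+ 2 * lam ^+ 3 / ((1 + lam) ^+ 2 * (1 + p a * lam)).
  by field; rewrite !gt_eqF.
have := le1_letter a; have := p_gt0 a => pa0 pa1.
by rewrite divr_ge0 ?mulr_ge0 ?exprn_ge0 ?subr_ge0 // ltW.
Qed.

Variables (M : R) (a : nat -> R).
Hypotheses (aM : forall n, `|a n| <= M) (a_small : forall n, (n <= 1)%N -> a n = 0).
Let f lam := poisson_mean lam a.
Let F := tree_sum p f.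

Let fC lam : 0 <= lam -> `|f lam| <= M * lam ^+ 2.
Proof. exact: poisson_mean_sqr_bound. Qed.

Lemma tree_sum_poisson_eq lam : 0 <= lam -> F lam = f lam + \sum_b F (p b * lam).
Proof. exact: (tree_sum_eq p_gt0 fC theta_lt1). Qed.

(** Scaled by 4 M / (1 - theta), the supersolution gains exactly the ratio bound on [f] at each
    branching. The result is quadratic at 0 and linear at infinity. *)
Lemma tree_sum_poisson_bound lam : 0 <= lam ->
  `|F lam| <= 4 * M / (1 - theta) * (lam ^+ 2 / (1 + lam)).
Proof.
have M0 := bound_ge0 aM.
have c0 : 0 <= 4 * M / (1 - theta) by rewrite divr_ge0 ?mulr_ge0 // subr_ge0 ltW.
apply: (tree_sum_le p_gt0 fC theta_lt1 (Q := fun lam => _ * (lam ^+ 2 / (1 + lam)))) => {}lam l0.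
  rewrite -mulr_sumr; apply: le_trans (ler_wpM2l c0 (branch_supersolution l0)).
  rewrite mulrDr lerD2r; apply: le_trans (poisson_mean_ratio_bound aM a_small l0) _.
  by rewrite [leRHS]mulrA divfK // subr_eq0 eq_sym lt_eqF.
by rewrite mulr_ge0 // divr_ge0 ?sqr_ge0 // addr_ge0.
Qed.

Lemma branch_sum_scale (g : R -> R) r N lam :
  branch_sum p N (fun x => g (r * x)) lam = branch_sum p N g (r * lam).
Proof.
elim: N lam => [//|N IH] lam /=; congr (_ + _); apply: eq_bigr => b _.
by rewrite IH mulrCA.
Qed.

Lemma branch_sumB (g h : R -> R) N lam :
  branch_sum p N (fun x => g x - h x) lam = branch_sum p N g lam - branch_sum p N h lam.
Proof.
elim: N lam => [|N IH] lam /=; first by rewrite subrr.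
by under eq_bigr do rewrite IH; rewrite sumrB; ring.
Qed.

(* For [x <= L] the difference of [f] is bounded by its modulus of
   continuity, and for [x >= L] by [2 M]. *)
Lemma tree_sum_poisson_dist lam r L : 0 <= lam -> 1 <= r -> 0 < L ->
  `|F (r * lam) - F lam| <=
  (2 * M * ((r - 1) * r) * (1 + L) ^+ 2 + 8 * M / L) / (1 - theta) * lam.
Proof.
move=> l0 r1 L0; have M0 := bound_ge0 aM; have r0 : 0 <= r by exact: le_trans r1.
have th0 : 0 < 1 - theta by rewrite subr_gt0.
pose al := 2 * M * ((r - 1) * r) * (1 + L) ^+ 2.
have r10 : 0 <= r - 1 by rewrite subr_ge0.
have al0 : 0 <= al by apply: mulr_ge0; [apply: mulr_ge0; apply: mulr_ge0|exact: sqr_ge0].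
pose h x : R := (x / (1 + x)) ^+ 2.
pose q x : R := x ^+ 2 / (1 + x).
have q0 x : 0 <= x -> 0 <= q x by move=> x0; rewrite divr_ge0 ?sqr_ge0 // addr_ge0.
have qx x : 0 <= x -> q x <= x.
  by move=> x0; rewrite ler_pdivrMr ?ltr_wpDr // expr2 ler_wpM2l // lerDr.
pose Q x := (al * q x + 8 * M * q (x / L)) / (1 - theta).
have Q0 x : 0 <= x -> 0 <= Q x.
  move=> x0; have xL0 : 0 <= x / L by rewrite divr_ge0 // ltW.
  apply: divr_ge0; last exact: ltW.
  by apply: addr_ge0; [apply: mulr_ge0 => //; exact: q0|apply: mulr_ge0; [exact: mulr_ge0|exact: q0]].
have fQ x : 0 <= x -> `|f (r * x) - f x| <= al * h x + 8 * M * h (x / L).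
  move=> x0; have h0 y : 0 <= h y by exact: sqr_ge0.
  have x1 : 0 < 1 + x by rewrite ltr_wpDr.
  have [xL|Lx] := lerP x L.
    rewrite -[leLHS]addr0; apply: lerD; last by apply: mulr_ge0 => //; exact: mulr_ge0.
    apply: le_trans (poisson_mean_dist aM a_small x0 r1) _.
    rewrite /al -[leRHS]mulrA; apply: ler_wpM2l.
      by apply: mulr_ge0; apply: mulr_ge0.
    rewrite /h expr_div_n mulrCA.
    rewrite ler_peMr ?sqr_ge0 // ler_pdivlMr ?exprn_gt0 // mul1r.
    by rewrite lerXn2r ?nnegrE; lra.
  rewrite -[leLHS]add0r; apply: lerD; first by rewrite mulr_ge0.
  apply: (@le_trans _ _ (2 * M)).
    apply: le_trans (ler_normB _ _) _; rewrite mulr_natl mulr2n.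
    by apply: lerD; apply: poisson_mean_bound => //; rewrite mulr_ge0.
  (* For x >= L the ratio (x/L) / (1 + x/L) is at least 1/2, so 8 M times its square covers 2 M. *)
  have -> : 8 * M * h (x / L) = (2 * M) * (2 * (x / L) / (1 + x / L)) ^+ 2.
    rewrite /h; field; rewrite gt_eqF ?addr_gt0 ?gt_eqF //; lra.
  rewrite ler_peMr ?mulr_ge0 // exprn_ege1 //.
  have xL : 1 <= x / L by rewrite ler_pdivlMr // mul1r ltW.
  by rewrite ler_pdivlMr; lra.
have fQ' x : 0 <= x -> `|f (r * x) - f x| + \sum_b Q (p b * x) <= Q x.
  move=> x0; rewrite /Q -mulr_suml ler_pdivlMr // mulrDl divfK ?gt_eqF //.
  rewrite big_split /= -!mulr_sumr.
  have xL0 : 0 <= x / L by rewrite divr_ge0 // ltW.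
  have := ler_wpM2l al0 (branch_supersolution x0).
  have M80 : 0 <= 8 * M by rewrite mulr_ge0.
  have := ler_wpM2l M80 (branch_supersolution xL0).
  have := ler_wpM2r (ltW th0) (fQ x x0); rewrite -/(h x) -/(h (x / L)) -/(q x) -/(q (x / L)).
  rewrite (eq_bigr (fun b => q (p b * x / L))) => [|b _]; last by rewrite /q mulrA.
  rewrite -/(q _); set s1 := \sum_(b in A) q _; set s2 := \sum_(b in A) _.
  lra.
have cv1 : (fun N => branch_sum p N f (r * lam)) @ \oo --> F (r * lam).
  by apply: (tree_sum_cvg p_gt0 fC theta_lt1); rewrite mulr_ge0.
have cv2 : (fun N => branch_sum p N f lam) @ \oo --> F lam.
  exact: (tree_sum_cvg p_gt0 fC theta_lt1).
have cv : (fun N => `|branch_sum p N f (r * lam) - branch_sum p N f lam|) @ \oo -->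
    `|F (r * lam) - F lam| by apply: cvg_norm; exact: cvgB.
apply: (@le_trans _ _ (Q lam)); last first.
  rewrite /Q [leRHS]mulrAC; apply: ler_wpM2r; first by rewrite invr_ge0 ltW.
  rewrite [leRHS]mulrDl; apply: lerD; first by apply: ler_wpM2l => //; exact: qx.
  rewrite -[leRHS]mulrA; apply: ler_wpM2l; first exact: mulr_ge0.
  by rewrite [leRHS]mulrC; apply: qx; rewrite divr_ge0 // ltW.
rewrite -(cvg_lim (@norm_hausdorff _ _) cv); apply: limr_le.
  exact: (cvgP _ cv).
apply: nearW => N; rewrite /= -branch_sum_scale -branch_sumB.
exact: (branch_sum_le p_gt0 fQ' Q0).
Qed.

End TreeSumPoisson.

(** * Renewal equations *)

Section Vanishing.
Variable R : realType.
Implicit Types h k : R -> R.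

Definition vanishing h := forall e, 0 < e -> exists T, forall t, T <= t -> `|h t| <= e.

Lemma vanishingP h : vanishing h <-> h t @[t --> +oo] --> 0.
Proof.
split=> [v|].
  apply/cvgrPdist_le => e /v[T hT]; near=> t; rewrite sub0r normrN; apply: hT.
  by near: t; apply: nbhs_pinfty_ge; exact: num_real.
move=> /cvgrPdist_le v e /v[T [_ hT]]; exists (T + 1) => t Tt.
have /hT : T < t by rewrite (lt_le_trans _ Tt) // ltrDl.
by rewrite /= sub0r normrN.
Unshelve. all: by end_near. Qed.

Lemma vanishing_le h k : (forall t, `|h t| <= k t) -> vanishing k -> vanishing h.
Proof.
move=> hk vk e /vk[T hT]; exists T => t /hT; apply: le_trans.
by apply: le_trans (hk t) _; exact: ler_norm.
Qed.

Lemma vanishingD h k : vanishing h -> vanishing k -> vanishing (fun t => h t + k t).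
Proof.
move=> vh vk e e0; have e2 : 0 < e / 2 by rewrite divr_gt0.
have [T1 h1] := vh _ e2; have [T2 h2] := vk _ e2; exists (Num.max T1 T2) => t.
rewrite ge_max => /andP[/h1 t1 /h2 t2]; apply: le_trans (ler_normD _ _) _.
by rewrite (splitr e) lerD.
Qed.

Lemma vanishing0 : vanishing (fun=> 0).
Proof. by move=> e e0; exists 0 => t _; rewrite normr0 ltW. Qed.

Lemma vanishing_sum (I : Type) (r : seq I) (h : I -> R -> R) :
  (forall i, vanishing (h i)) -> vanishing (fun t => \sum_(i <- r) h i t).
Proof.
move=> vh; elim: r => [|i r IH].
  by under eq_fun do rewrite big_nil; exact: vanishing0.
by under eq_fun do rewrite big_cons; exact: vanishingD.
Qed.

Lemma vanishingZ c h : vanishing h -> vanishing (fun t => c * h t).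
Proof.
move=> vh e e0; have c1 : 0 < `|c| + 1 by rewrite ltr_wpDl.
have [T hT] := vh _ (divr_gt0 e0 c1); exists T => t /hT ht.
rewrite normrM; apply: (@le_trans _ _ ((`|c| + 1) * `|h t|)).
  by rewrite ler_wpM2r // lerDl.
by rewrite mulrC -ler_pdivlMr.
Qed.

Lemma vanishing_shift c h : vanishing h -> vanishing (fun t => h (t - c)).
Proof.
by move=> vh e /vh[T hT]; exists (T + c) => t Tt; apply: hT; rewrite lerBrDr.
Qed.

Lemma vanishing_norm h : vanishing h -> vanishing (fun t => `|h t|).
Proof. by move=> vh e /vh[T hT]; exists T => t /hT; rewrite normr_id. Qed.

Lemma vanishingN h : vanishing h -> vanishing (fun t => - h t).
Proof. by move=> vh e /vh[T hT]; exists T => t /hT; rewrite normrN. Qed.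

End Vanishing.

(** * Subgroups of the real line are dense or cyclic *)

Section SubgroupDichotomy.
Variables (R : realType) (G : set R).
Hypotheses (GB : forall s t, G s -> G t -> G (s - t)).

Lemma subgroup0 s : G s -> G 0.
Proof. by move=> Gs; rewrite -(subrr s); exact: GB. Qed.

Lemma subgroupN s : G s -> G (- s).
Proof. by move=> Gs; rewrite -sub0r; apply: GB => //; exact: subgroup0 Gs. Qed.

Lemma subgroupD s t : G s -> G t -> G (s + t).
Proof. by move=> Gs Gt; rewrite -[t]opprK; apply: GB => //; exact: subgroupN. Qed.

Lemma subgroupMz s (k : int) : G s -> G (k%:~R * s).
Proof.
move=> Gs; have Gn n : G (n%:R * s).
  elim: n => [|n IH]; first by rewrite mul0r; exact: subgroup0 Gs.
  by rewrite -natr1 mulrDl mul1r; exact: subgroupD.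
case: k => n; first exact: Gn.
by rewrite NegzE rmorphN mulNr; apply: subgroupN; exact: Gn.
Qed.

Lemma subgroup_sum (I : Type) (r : seq I) (f : I -> R) :
  G 0 -> (forall i, G (f i)) -> G (\sum_(i <- r) f i).
Proof.
move=> G0 Gf; elim: r => [|i r IH]; first by rewrite big_nil.
by rewrite big_cons; exact: subgroupD.
Qed.

(** If all positive elements are at least [e], an element [d] within [e] of their infimum is the
    least one, since a smaller s would leave d - s strictly between 0 and [e]. The remainder of any
    element modulo [d] then has to vanish. *)
Lemma subgroup_dichotomy s0 : G s0 -> 0 < s0 ->
  (forall e, 0 < e -> exists s, [/\ G s, 0 < s & s < e]) \/
  (exists d, [/\ G d, 0 < d & forall s, G s -> exists k : int, s = k%:~R * d]).
Proof.
move=> Gs0 s00; have [small|] := pselect (forall e, 0 < e -> exists s, [/\ G s, 0 < s & s < e]).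
  by left.
move=> /existsNP[e /not_implyP[e0 nsmall]]; right.
have gap s : G s -> 0 < s -> e <= s.
  by move=> Gs sp; rewrite leNgt; apply/negP => se; apply: nsmall; exists s.
pose S := [set s | G s /\ 0 < s].
have S0 : has_inf S.
  split; first by exists s0.
  by exists 0 => s [_ /ltW].
have [d [Gd d0] dlt] := inf_adherent e0 S0.
have dmin s : G s -> 0 < s -> d <= s.
  move=> Gs sp; rewrite leNgt; apply/negP => sd.
  have := gap (d - s) (GB Gd Gs); rewrite subr_gt0 => /(_ sd).
  have : inf S <= s by apply: ge_inf => //; case: S0.
  lra.
exists d; split=> // s Gs; exists (Num.floor (s / d)).
apply/eqP; rewrite -subr_eq0; apply/eqP; set r := _ - _.
have Gr : G r by apply: GB => //; exact: subgroupMz.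
have r0 : 0 <= r.
  by rewrite subr_ge0 -ler_pdivlMr // floor_le.
have rd : r < d.
  have := floorD1_gt (s / d); rewrite ltr_pdivrMr // intrD mulrDl mul1r /r.
  by rewrite ltrBlDl.
apply: le_anti; rewrite r0 andbT leNgt; apply/negP => /(dmin _ Gr).
by rewrite leNgt rd.
Qed.

End SubgroupDichotomy.

Section Renewal.
Variables (R : realType) (A : finType) (p x : A -> R).
Hypotheses (p_gt0 : forall a, 0 < p a) (p_sum : \sum_a p a = 1) (x_gt0 : forall a, 0 < x a).

(* If [D] is close to its limsup at [t], then so is it at [t - j x b] for all
   bounded [j]; a positive limsup would make the telescoping sum of the
   [D (t - j x b)] exceed any bound of [Z]. *)
Lemma renewal_increment_le (Z g : R -> R) B b :
  (forall t, Z t = g t + \sum_a p a * Z (t - x a)) ->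
  (forall t, `|Z t| <= B) -> vanishing g ->
  forall e, 0 < e -> exists T, forall t, T <= t -> Z t - Z (t - x b) <= e.
Proof.
move=> ZE ZB vg e e0; pose D t := Z t - Z (t - x b).
pose r t := g t - g (t - x b).
have vr : vanishing r by apply: vanishingD => //; apply: vanishingN; exact: vanishing_shift.
have DE t : D t = r t + \sum_a p a * D (t - x a).
  rewrite /D /r (ZE t) (ZE (t - x b)); under [in RHS]eq_bigr do rewrite mulrBr.
  by rewrite sumrB; under [X in _ = _ + (_ - X)]eq_bigr do rewrite addrAC; ring.
have B0 : 0 <= B by exact: le_trans (ZB 0).
have ZZ s t : Z s - Z t <= 2 * B.
  have := ZB s; have := ZB t; rewrite !ler_norml => /andP[? ?] /andP[? ?]; lra.
have [//|nT] := pselect (exists T, forall t, T <= t -> D t <= e).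
exfalso; pose S := [set y | exists T, forall t, T <= t -> D t <= y].
have S2B : S (2 * B) by exists 0 => t _; exact: ZZ.
have Sge y : S y -> e <= y.
  move=> [T hT]; rewrite leNgt; apply/negP => ye; apply: nT; exists T => t /hT h.
  by apply: le_trans h _; exact: ltW.
have Sinf : has_inf S by split; [exists (2 * B)|exists e].
(* [y] is the limsup of [D], as the infimum of its eventual upper bounds; it is at least [e] by the
   assumption to be refuted. *)
set y := inf S; have ey : e <= y by apply: lb_le_inf; [exists (2 * B)|].
have y0 : 0 < y by exact: lt_le_trans ey.
(* If [m] consecutive increments are at least y/2 each, [Z] moves by more than its bound allows. *)
have [m hm] : exists m : nat, 2 * B < m%:R * (y / 2).
  exists (Num.truncn (2 * B / (y / 2))).+1.
  by rewrite -ltr_pdivrMr ?divr_gt0 // truncnS_gt.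
have pb := p_gt0 b.
have pb1 : p b <= 1 by rewrite -p_sum (bigD1 b) //= lerDl sumr_ge0 // => a _; exact: ltW.
(* A defect c^j dl of [D] below [y] at s, together with errors of at most 2 dl from [r] and from the
   other letters, is divided by [p b] when passed on to s - x b. The total is at most 3 c^j dl / p
   b. *)
pose c := 3 / p b; have c1 : 1 <= c by rewrite ler_pdivlMr //; lra.
have c0 : 0 < c by exact: lt_le_trans c1.
have cm n : 1 <= c ^+ n by exact: exprn_ege1.
(* Chosen so that even after [m] steps the defect does not exceed y/2. *)
pose dl := y / 2 / c ^+ m.
have dl0 : 0 < dl by rewrite !divr_gt0 // exprn_gt0.
have [y' [T1 h1] y'lt] := inf_adherent dl0 Sinf.
have [T2 h2] := vr _ dl0.
pose X := \sum_a x a.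
have xX a : x a <= X by rewrite /X (bigD1 a) //= lerDl sumr_ge0 // => ? _; exact: ltW.
(* [t] lies so far out that every point t - j x b - x a with j < m is still beyond both
   thresholds. *)
have [t [Tt Dt]] : exists t, Num.max T1 T2 + m%:R * x b + X <= t /\ y - dl < D t.
  have : ~ S (y - dl).
    move=> Sy; have : y <= y - dl by apply: ge_inf => //; case: Sinf.
    lra.
  move=> /forallNP/(_ (Num.max T1 T2 + m%:R * x b + X)) /existsNP[t /not_implyP[Tt /negP]].
  by rewrite -ltNge => Dt; exists t.
have Dj j : (j <= m)%N -> y - c ^+ j * dl <= D (t - j%:R * x b).
  elim: j => [|j IH] jm; first by rewrite mul0r subr0 expr0 mul1r ltW.
  have {IH} := IH (ltnW jm); set s := t - j%:R * x b => IH.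
  have -> : t - j.+1%:R * x b = s - x b by rewrite /s -natr1; ring.
  have jx : j%:R * x b <= m%:R * x b by rewrite ler_wpM2r ?ler_nat ?ltW // ltnW.
  have sT : Num.max T1 T2 + X <= s by rewrite /s; lra.
  have sT1 a : T1 <= s - x a.
    have := xX a; have : T1 <= Num.max T1 T2 by rewrite le_max lexx.
    lra.
  have X0 : 0 <= X by apply: sumr_ge0 => a _; exact: ltW.
  have sT2 : T2 <= s.
    have : T2 <= Num.max T1 T2 by rewrite le_max lexx orbT.
    lra.
  have : D s <= dl + (p b * D (s - x b) + (1 - p b) * (y + dl)).
    rewrite DE; apply: lerD; first exact: le_trans (ler_norm _) (h2 _ sT2).
    rewrite (bigD1 b) //= lerD2l.
    have -> : 1 - p b = \sum_(a | a != b) p a.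
      by rewrite -p_sum (bigD1 b) //= addrAC subrr add0r.
    rewrite mulr_suml; apply: ler_sum => a _; rewrite ler_wpM2l ?(ltW (p_gt0 a)) //.
    by apply: le_trans (h1 _ (sT1 a)) _; exact: ltW.
  move=> Ds; have cj := cm j.
  have cdl : dl <= c ^+ j * dl by rewrite ler_peMl // ltW.
  have : p b * (y - c ^+ j.+1 * dl) <= p b * D (s - x b).
    have pc : p b * c = 3 by rewrite /c mulrC divfK // gt_eqF.
    have -> : p b * (y - c ^+ j.+1 * dl) = p b * y - (p b * c) * (c ^+ j * dl).
      by rewrite [c ^+ _.+1]exprS; ring.
    have : 0 <= p b * dl by rewrite mulr_ge0 // ltW.
    rewrite pc; lra.
  by rewrite ler_pM2l.
have tel : Z t - Z (t - m%:R * x b) = \sum_(0 <= j < m) D (t - j%:R * x b).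
  have := @telescope_sumr R 0 m (fun j => - Z (t - j%:R * x b)) isT.
  rewrite mul0r subr0 opprK addrC => <-.
  apply: eq_bigr => j _; rewrite /D opprK addrC -natr1; congr (_ - Z _); ring.
have : m%:R * (y / 2) <= Z t - Z (t - m%:R * x b).
  rewrite tel mulr_natl -[X in _ *+ X]subn0 -sumr_const_nat big_nat [leRHS]big_nat.
  apply: ler_sum => j /andP[_ jm]; apply: le_trans (Dj j (ltnW jm)).
  have : c ^+ j * dl <= y / 2.
    rewrite /dl mulrCA ger_pMr ?divr_gt0 // ler_pdivrMr ?exprn_gt0 // mul1r.
    by rewrite ler_weXn2l // ltnW.
  lra.
by have := ZZ t (t - m%:R * x b); lra.
Qed.

Lemma renewal_increment (Z g : R -> R) B b :
  (forall t, Z t = g t + \sum_a p a * Z (t - x a)) ->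
  (forall t, `|Z t| <= B) -> vanishing g ->
  vanishing (fun t => Z t - Z (t - x b)).
Proof.
move=> ZE ZB vg e e0.
have [T1 h1] := renewal_increment_le b ZE ZB vg e0.
have NE t : - Z t = - g t + \sum_a p a * - Z (t - x a).
  by rewrite {1}ZE opprD -sumrN; congr (_ + _); apply: eq_bigr => a _; rewrite mulrN.
have NB t : `|- Z t| <= B by rewrite normrN.
have [T2 h2] := renewal_increment_le b NE NB (vanishingN vg) e0.
exists (Num.max T1 T2) => t; rewrite ge_max => /andP[/h1 ? /h2 ?].
by rewrite ler_norml; apply/andP; split; lra.
Qed.

End Renewal.

Section RenewalLimit.
Variables (R : realType) (A : finType) (p x : A -> R).
Hypotheses (p_gt0 : forall a, 0 < p a) (p_sum : \sum_a p a = 1) (x_gt0 : forall a, 0 < x a).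
Variables (Z g : R -> R) (B : R).
Hypotheses (ZE : forall t, Z t = g t + \sum_a p a * Z (t - x a))
  (ZB : forall t, `|Z t| <= B) (vg : vanishing g).

Definition step_group := [set s : R | exists c : A -> int, s = \sum_a (c a)%:~R * x a].

Lemma step_groupB s t : step_group s -> step_group t -> step_group (s - t).
Proof.
move=> [c ->] [c' ->]; exists (fun a => c a - c' a); rewrite -sumrB.
by apply: eq_bigr => a _; rewrite rmorphB mulrBl.
Qed.

Lemma step_group_letter a : step_group (x a).
Proof.
exists (fun b => (b == a)%:Z); rewrite (bigD1 a) //= eqxx mul1r big1 ?addr0 // => b ba.
by rewrite (negbTE ba) mul0r.
Qed.

Let slow := [set s : R | vanishing (fun t => Z t - Z (t - s))].

Lemma slow_increment s : step_group s -> vanishing (fun t => Z t - Z (t - s)).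
Proof.
have slowB u v : slow u -> slow v -> slow (u - v).
  rewrite /slow /= => su sv.
  have -> : (fun t => Z t - Z (t - (u - v))) =
      (fun t => (Z t - Z (t - u)) - (Z (t - (u - v)) - Z (t - (u - v) - v))).
    by apply/funext => t; rewrite (_ : t - (u - v) - v = t - u); ring.
  apply: vanishingD => //; apply: vanishingN.
  exact: (@vanishing_shift _ (u - v) (fun t => Z t - Z (t - v))).
move=> [c ->]; apply: (subgroup_sum slowB).
  rewrite /slow /=; under eq_fun do rewrite subr0 subrr; exact: vanishing0.
move=> a; apply: (subgroupMz slowB).
exact: (renewal_increment p_gt0 p_sum x_gt0 a ZE ZB vg).
Qed.

Section NonLattice.
Hypothesis dense : forall e, 0 < e -> exists s, [/\ step_group s, 0 < s & s < e].
Hypothesis Zunif : forall e, 0 < e -> exists2 dl, 0 < dl &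
  forall t s, 0 <= s <= dl -> `|Z (t + s) - Z t| <= e.

(** Density gives an element [s0] of the group below the modulus of continuity. The finitely many
    multiples of [s0] up to [X] are slow shifts, and any other shift is within one [s0] of such a
    multiple. *)
Lemma nonlattice_slow X e : 0 < e ->
  exists T, forall t, T <= t -> forall s, 0 <= s <= X -> `|Z t - Z (t - s)| <= e.
Proof.
move=> e0; have e2 : 0 < e / 2 by rewrite divr_gt0.
have [dl dl0 hdl] := Zunif e2; have [s0 [Gs0 s00 s0dl]] := dense dl0.
pose n := (Num.truncn (X / s0)).+1.
have : vanishing (fun t => \sum_(j < n) `|Z t - Z (t - j%:R * s0)|).
  apply: vanishing_sum => j; apply: vanishing_norm; apply: slow_increment.
  have := @subgroupMz _ _ step_groupB s0 j Gs0; by [].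
move=> /(_ _ e2)[T hT]; exists T => t /hT ht s /andP[sge0 sX].
pose j := Num.truncn (s / s0).
have js : j%:R * s0 <= s by rewrite -ler_pdivlMr // truncn_le divr_ge0 // ltW.
have sj : s < j%:R * s0 + s0.
  by rewrite -{2}[s0]mul1r -mulrDl natr1 -ltr_pdivrMr // truncnS_gt.
have jn : (j < n)%N by rewrite ltnS le_truncn // ler_wpM2r // invr_ge0 ltW.
rewrite -(subrKA (Z (t - j%:R * s0))) (splitr e); apply: le_trans (ler_normD _ _) _.
apply: lerD.
  apply: le_trans ht; apply: le_trans (ler_norm _).
  by rewrite (bigD1 (Ordinal jn)) //= lerDl sumr_ge0.
rewrite (_ : t - j%:R * s0 = (t - s) + (s - j%:R * s0)); last by ring.
by apply: hdl; apply/andP; split; lra.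
Qed.

(** [V] is a primitive of [Z], used only through the mean value property: each difference is x a
    times a value of [Z] in a window of length x a, where [Z] is nearly constant. *)
Lemma nonlattice_limit (V : R -> R) :
  (forall t s, 0 < s -> exists2 u, t - s <= u <= t & V t - V (t - s) = s * Z u) ->
  vanishing (fun t => (\sum_a p a * x a) * Z t - \sum_a p a * (V t - V (t - x a))).
Proof.
move=> VZ; pose X := \sum_a x a.
have xX a : x a <= X by rewrite /X (bigD1 a) //= lerDl sumr_ge0 // => ? _; exact: ltW.
pose H := \sum_a p a * x a.
have H0 : 0 <= H by apply: sumr_ge0 => a _; rewrite mulr_ge0 // ltW.
move=> e e0; have eH : 0 < e / (H + 1) by rewrite divr_gt0 // ltr_wpDl.
have [T hT] := nonlattice_slow X eH; exists T => t Tt.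
rewrite mulr_suml -sumrB; apply: le_trans (ler_norm_sum _ _ _) _.
apply: (@le_trans _ _ (\sum_a p a * x a * (e / (H + 1)))); last first.
  by rewrite -mulr_suml -/H mulrCA ger_pMr // ler_pdivrMr ?ltr_wpDl // mul1r lerDl.
apply: ler_sum => a _; have [u /andP[u1 u2] ->] := VZ t _ (x_gt0 a).
rewrite mulrA -mulrBr normrM ger0_norm ?mulr_ge0 ?(ltW (p_gt0 _)) ?(ltW (x_gt0 _)) //.
rewrite ler_wpM2l ?mulr_ge0 ?(ltW (p_gt0 _)) ?(ltW (x_gt0 _)) //.
rewrite (_ : u = t - (t - u)); last by ring.
by apply: hT => //; apply/andP; split; have := xX a; lra.
Qed.

End NonLattice.

Section Lattice.
Variables (d : R) (k : A -> nat) (C : R).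
Hypotheses (d_gt0 : 0 < d) (xk : forall a, x a = (k a)%:R * d) (Gd : step_group d).
Hypotheses (ZC : forall t, `|Z t| <= C * expR t) (gC : forall t, `|g t| <= C * expR (- t)).

(** The lattice analogue of the sum of p a (V t - V (t - x a)): integrals of [Z] become sums over
    the [k a] lattice points in each window. *)
Let W t := \sum_a p a * \sum_(0 <= j < k a) Z (t - j%:R * d).

Let Wstep t : W t - W (t - d) = g t.
Proof.
rewrite -sumrB.
rewrite (eq_bigr (fun a => p a * Z t - p a * Z (t - x a))) => [|a _].
  by rewrite sumrB -mulr_suml p_sum mul1r {1}ZE addrK.
rewrite -!mulrBr -sumrB xk; congr (_ * _).
have := @telescope_sumr R 0 (k a) (fun j => - Z (t - j%:R * d)) isT.
rewrite mul0r subr0 opprK addrC => <-; apply: eq_bigr => j _.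
by rewrite opprK [in RHS]addrC -natr1; congr (_ - Z _); ring.
Qed.

Let Wpartial t n : series (fun j => g (t - j%:R * d)) n = W t - W (t - n%:R * d).
Proof.
rewrite /series /= (eq_bigr (fun j => - W (t - j.+1%:R * d) - - W (t - j%:R * d))) => [|j _].
  by rewrite telescope_sumr // mul0r subr0 opprK addrC.
by rewrite -Wstep opprK [in RHS]addrC -natr1; congr (_ - W _); ring.
Qed.

Let C0 : 0 <= C.
Proof. by have := le_trans (normr_ge0 _) (ZC 0); rewrite expR0 mulr1. Qed.

Let Wbound t : `|W t| <= (\sum_a (k a)%:R) * C * expR t.
Proof.
apply: le_trans (ler_norm_sum _ _ _) _; rewrite -mulrA mulr_suml; apply: ler_sum => a _.
have pa1 : p a <= 1 by rewrite -p_sum (bigD1 a) //= lerDl sumr_ge0 // => b _; exact: ltW.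
rewrite normrM ger0_norm; last exact: ltW.
apply: (@le_trans _ _ (1 * (\sum_(0 <= j < k a) C * expR t))); last first.
  by rewrite mul1r sumr_const_nat subn0 mulr_natl.
apply: ler_pM => //; first exact: ltW.
apply: le_trans (ler_norm_sum _ _ _) _; apply: ler_sum => j _.
apply: le_trans (ZC _) _; rewrite ler_wpM2l // ler_expR lerBlDr lerDl.
by rewrite mulr_ge0 // ltW.
Qed.

Let q := expR (- d).
Let q0 : 0 <= q. Proof. exact: expR_ge0. Qed.
Let q1 : `|q| < 1.
Proof. by rewrite ger0_norm // -expR0 ltr_expR oppr_lt0. Qed.

Let expRq t n : expR (t - n%:R * d) = expR t * q ^+ n.
Proof. by rewrite expRD /q -expRM_natl mulrN. Qed.

(** The partial sums telescope to W t - W (t - n d), and the last term decays geometrically because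
    [Z] is O(e^t) at minus infinity. *)
Let Wseries t : series (fun j => g (t - j%:R * d)) @ \oo --> W t.
Proof.
rewrite [X in X @ _ --> _](_ : _ = (fun n => W t - W (t - n%:R * d))); last first.
  by apply/funext => n; exact: Wpartial.
rewrite -[X in _ --> X]subr0; apply: cvgB; first exact: cvg_cst.
apply: (norm_cvg0 (V := R)); pose K := (\sum_a (k a)%:R) * C * expR t.
apply: (@squeeze_cvgr _ _ _ _ (fun=> 0) (fun n => K * q ^+ n)).
- by apply: nearW => n; rewrite normr_ge0 /= /K -mulrA -expRq Wbound.
- exact: cvg_cst.
- by rewrite -(mulr0 K); apply: cvgMr; exact: cvg_expr.
Qed.

Let tail t := limn (series (fun j : nat => g (t + j.+1%:R * d))).

Let gm t := geometric (C * q * expR (- t)) q.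

Let gm_le t n : `|g (t + n.+1%:R * d)| <= gm t n.
Proof.
apply: le_trans (gC _) _; rewrite opprD expRq exprS /gm /geometric /=.
by rewrite -!mulrA ler_wpM2l // mulrCA.
Qed.

Let cvg_gm t : cvgn (series (gm t)). Proof. exact: is_cvg_geometric_series. Qed.

Let cvg_norm_tail t : cvgn [normed series (fun j : nat => g (t + j.+1%:R * d))].
Proof.
apply: (@series_le_cvg _ _ (gm t)) => [n|n|n|].
- exact: normr_ge0.
- exact: le_trans (normr_ge0 _) (gm_le t n).
- exact: gm_le.
- exact: cvg_gm.
Qed.

Lemma lattice_series_cvg t :
  cvgn (series (fun k : nat => g (t - k%:Z%:~R * d))) /\
  cvgn (series (fun k : nat => g (t - (- k.+1%:Z)%:~R * d))).
Proof.
split; first by apply: (cvgP (W t)); exact: Wseries.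
rewrite [X in cvgn X](_ : _ = series (fun j : nat => g (t + j.+1%:R * d))).
  exact: (normed_cvg (@cvg_norm_tail t)).
by congr series; apply/funext => j; rewrite rmorphN mulNr opprK.
Qed.

Let tail_bound t : `|tail t| <= C * (q / (1 - q)) * expR (- t).
Proof.
apply: le_trans (lim_series_norm (@cvg_norm_tail t)) _.
apply: le_trans (lim_series_le (@cvg_norm_tail t) (@cvg_gm t) (gm_le t)) _.
rewrite (cvg_lim _ (cvg_geometric_series (a := C * q * expR (- t)) q1)) //.
by rewrite le_eqVlt; apply/orP; left; apply/eqP; ring.
Qed.

(** The indices m >= 0 sum to [W t] exactly. The negative ones evaluate [g] to the right of [t],
    where it is O(e^-t), and only contribute a vanishing tail. *)
Lemma lattice_sumZ t : sumZ (fun m : int => g (t - m%:~R * d)) = W t + tail t.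
Proof.
rewrite /sumZ; congr (_ + _); first by apply: cvg_lim => //; exact: Wseries.
congr (limn (series _)); apply/funext => j.
by rewrite rmorphN mulNr opprK.
Qed.

Lemma lattice_limit :
  vanishing (fun t => (\sum_a p a * x a) * Z t - d * sumZ (fun m : int => g (t - m%:~R * d))).
Proof.
under eq_fun => t.
  rewrite lattice_sumZ mulrDr opprD addrA.
  (* As x a = k a d, the coefficient of [Z t] counts the terms of d W t, leaving a finite
     combination of increments along the lattice. *)
  rewrite (_ : _ - d * W t = \sum_a (p a * d) * \sum_(0 <= j < k a) (Z t - Z (t - j%:R * d))); last first.
    rewrite mulr_suml mulr_sumr -sumrB; apply: eq_bigr => a _.
    by rewrite sumrB sumr_const_nat subn0 xk -mulr_natl; ring.
  over.
apply: vanishingD.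
  apply: vanishing_sum => a; apply: vanishingZ; apply: vanishing_sum => j.
  by apply: slow_increment; exact: (@subgroupMz _ _ step_groupB d j Gd).
apply: vanishingN; apply: vanishingZ.
apply: (vanishing_le tail_bound); apply: vanishingZ; apply/vanishingP.
rewrite -[X in X @ _ --> _]/((fun y => expR (- y)) : R -> R).
exact: cvgr_expR.
Qed.

End Lattice.
End RenewalLimit.

Section LatticeStep.
Variables (R : realType) (A : finType) (p : A -> R).
Hypotheses (p_gt0 : forall a, 0 < p a) (p_lt1 : forall a, p a < 1) (a0 : A).
Let x a := - ln (p a).

Lemma neg_ln_gt0 a : 0 < x a.
Proof. by rewrite /x oppr_gt0 ln_lt0 // p_gt0 p_lt1. Qed.

Lemma lattice_step_group d s : lattice_step p d -> step_group x s ->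
  exists k : int, s = k%:~R * d.
Proof.
move=> [d0 hd] [c ->]; have [k hk] := choice hd.
exists (- \sum_a c a * k a); rewrite rmorphN rmorph_sum mulNr mulr_suml -sumrN.
by apply: eq_bigr => a _; rewrite /x hk rmorphM /=; ring.
Qed.

(** In the dense case no lattice step exists, as arbitrarily small positive group elements cannot be
    multiples of one, and [xget] returns its default 0. Otherwise the positive generator is itself a
    lattice step and a positive multiple of every other, hence the largest. *)
Lemma dp_dichotomy :
  (dp p = 0 /\ forall e, 0 < e -> exists s, [/\ step_group x s, 0 < s & s < e]) \/
  [/\ 0 < dp p, step_group x (dp p) & forall a, exists k : nat, x a = k%:R * dp p].
Proof.
have [small|[d [Gd d0 hd]]] :=
  subgroup_dichotomy (@step_groupB _ _ x) (step_group_letter x a0) (neg_ln_gt0 a0).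
  left; split=> //; rewrite /dp; case: xgetP => // d _ [[d0 hd] _].
  have [s [Gs s0 sd]] := small _ d0; exfalso.
  have [k sk] := lattice_step_group (conj d0 hd) Gs.
  by move: s0 sd; rewrite sk pmulr_lgt0 // gtr_pMl // ltr0z ltrz1; lia.
have max_d : lattice_step p d /\ forall d', lattice_step p d' -> d' <= d.
  split; first split=> // a.
    have [k] := hd _ (step_group_letter x a); rewrite /x => /eqP.
    by rewrite eqr_oppLR => /eqP ->; exists (- k); rewrite rmorphN mulNr.
  move=> d' hd'; have [k dk] := lattice_step_group hd' Gd.
  have [d'0 _] := hd'; have k0 : 0 < k by move: d0; rewrite dk pmulr_lgt0 // ltr0z.
  by rewrite dk ler_peMl ?(ltW d'0) // ler1z; lia.
have dpd : dp p = d.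
  have : exists d', lattice_step p d' /\ forall d'', lattice_step p d'' -> d'' <= d'.
    by exists d.
  move=> /(xgetPex 0) [h1 h2]; apply: le_anti; case: max_d => h3 h4.
  by rewrite h4 ?h2.
right; rewrite dpd; split=> // a.
have [k xk] := hd _ (step_group_letter x a); have xa := neg_ln_gt0 a.
case: k xk => n xk; first by exists n.
by move: xa; rewrite xk NegzE pmulr_lgt0 // ltr0z.
Qed.

End LatticeStep.

(** * Asymptotics of the Poisson mean *)

Section HalfLineIntegrals.
Variable R : realType.
Local Notation mu := (@lebesgue_measure R).

Lemma continuous_halfline_measurable (q : R -> R) :
  (forall x, 0 < x -> {for x, continuous q}) -> measurable_fun `](0 : R), +oo[ q.
Proof.
move=> cq; apply: open_continuous_measurable_fun; first exact: interval_open.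
by move=> x; rewrite inE /= in_itv /= andbT; exact: cq.
Qed.

Lemma continuous_halfline_integrable (q : R -> R) (C y : R) :
  (forall x, 0 < x -> {for x, continuous q}) ->
  (forall x, 0 < x -> `|q x| <= C) -> mu.-integrable `]0, y] (EFin \o q).
Proof.
move=> cq qC; apply: measurable_bounded_integrable => //.
- by rewrite /= lebesgue_measure_itv /=; case: ifPn => _ //; rewrite -EFinD ltry.
- apply: measurable_funS (continuous_halfline_measurable cq) => // x /=.
  by rewrite !in_itv /= andbT => /andP[].
- exists C; split; first exact: num_real.
  move=> K CK x /=; rewrite in_itv /= => /andP[x0 _].
  by apply: le_trans (qC _ x0) _; exact: ltW.
Qed.

Lemma is_derive_halfline_integral (q : R -> R) (C y : R) :
  (forall x, 0 < x -> {for x, continuous q}) ->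
  (forall x, 0 < x -> `|q x| <= C) -> 0 < y ->
  is_derive y 1 (fun z => \int[mu]_(x in `]0, z]) q x) (q y).
Proof.
move=> cq qC y0.
have ay : (BRight (0 : R) < BRight y)%O by rewrite bnd_simp.
have yy : y < y + 1 by rewrite ltrDl.
have [dF F'] := continuous_FTC1 yy (continuous_halfline_integrable (y + 1) cq qC) ay (cq _ y0).
by apply: DeriveDef; [exact: dF|rewrite -derive1E; exact: F'].
Qed.

Lemma halfline_integral_bound (q : R -> R) (C y : R) :
  (forall x, 0 < x -> {for x, continuous q}) ->
  (forall x, 0 < x -> `|q x| <= C) -> 0 < y ->
  `|\int[mu]_(x in `]0, y]) q x| <= C * y.
Proof.
move=> cq qC y0; have iq := continuous_halfline_integrable y cq qC.
apply: le_trans (le_normr_Rintegral _ iq) _ => //.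
apply: (@le_trans _ _ (\int[mu]_(x in `]0, y]) C)).
  apply: le_Rintegral => //.
  - exact: integrable_norm.
  - apply: (@continuous_halfline_integrable (cst C) `|C|) => // x _.
    exact: cst_continuous.
  - by move=> x /=; rewrite in_itv /= => /andP[x0 _]; exact: qC.
rewrite Rintegral_cst //=.
by rewrite lebesgue_measure_itv /= lte_fin y0 -EFinB subr0.
Qed.

Lemma is_derive_inv1D (x : R) : 0 <= x ->
  is_derive x 1 (fun x => - (1 + x)^-1) ((1 + x) ^- 2).
Proof.
move=> x0; have x1 : 1 + x != 0 by rewrite gt_eqF // ltr_wpDr.
have d1 : is_derive x 1 (fun z : R => 1 + z) (0 + 1).
  by apply: is_deriveD.
have := is_deriveN (is_deriveV x1 d1).
by rewrite add0r scaleNr opprK /GRing.scale /= mulr1.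
Qed.

Lemma continuous_inv_sqr (x : R) : 0 <= x -> {for x, continuous (fun x : R => (1 + x) ^- 2)}.
Proof.
move=> x0; apply: cvgV; first by rewrite expf_neq0 // gt_eqF // ltr_wpDr.
by apply: cvgM; apply: cvgD => //; exact: cvg_cst.
Qed.

Lemma inv_sqr_integral (y : R) : 0 <= y ->
  (\int[mu]_(x in `[y, +oo[) ((1 + x) ^- 2)%:E = ((1 + y)^-1)%:E)%E.
Proof.
move=> y0; have yx x : y <= x -> 0 <= x by exact: le_trans.
have dF x : y <= x -> is_derive x 1 (fun x => - (1 + x)^-1) ((1 + x) ^- 2).
  by move=> /yx; exact: is_derive_inv1D.
have cF x : y <= x -> {for x, continuous (fun x : R => - (1 + x)^-1)}.
  by move=> /dF [dx _]; apply: differentiable_continuous; exact/derivable1_diffP.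
have cf x : y <= x -> {for x, continuous (fun x : R => (1 + x) ^- 2)}.
  by move=> /yx; exact: continuous_inv_sqr.
rewrite (@ge0_continuous_FTC2y _ _ (fun x => - (1 + x)^-1) _ 0).
- by rewrite -EFinB sub0r opprK.
- by move=> x _; rewrite invr_ge0 sqr_ge0.
- apply/continuous_within_itvcyP; split.
    by move=> x; rewrite in_itv /= andbT => /ltW; exact: cf.
  by apply: cvg_at_right_filter; exact: cf.
- rewrite -oppr0; apply: cvgN; apply/cvgrPdist_le => e e0.
  near=> x; have x0 : 0 < 1 + x.
    suff : 0 < x by lra.
    by near: x; apply: nbhs_pinfty_gt; exact: num_real.
  rewrite sub0r normrN ger0_norm ?invr_ge0 ?(ltW x0) // -[e]invrK lef_pV2 ?posrE ?invr_gt0 //.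
  suff : e^-1 <= x by lra.
  by near: x; apply: nbhs_pinfty_ge; exact: num_real.
- by move=> x /ltW /dF[].
- by apply: cvg_at_right_filter; exact: cF.
- by move=> x; rewrite in_itv /= andbT => /ltW /dF[_ <-]; rewrite derive1E.
Unshelve. all: by end_near. Qed.

Lemma inv_sqr_integrable : mu.-integrable `](0 : R), +oo[ (EFin \o (fun x => (1 + x) ^- 2)).
Proof.
have mk : measurable_fun `](0 : R), +oo[ (EFin \o (fun x => (1 + x) ^- 2)).
  apply/measurable_EFinP; apply: continuous_halfline_measurable => x /ltW.
  exact: continuous_inv_sqr.
apply/integrableP; split => //.
under eq_integral do rewrite /= ger0_norm ?invr_ge0 ?sqr_ge0 //.
by rewrite integral_itv_obnd_cbnd // inv_sqr_integral // ltry.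
Qed.

Lemma halfline_integrable_tail (q : R -> R) (C : R) :
  (forall x, 0 < x -> {for x, continuous q}) ->
  (forall x, 0 < x -> `|q x| <= C * (1 + x) ^- 2) ->
  mu.-integrable `](0 : R), +oo[ (EFin \o q).
Proof.
move=> cq qC.
have ik : mu.-integrable `](0 : R), +oo[ (EFin \o (fun x => C * (1 + x) ^- 2)).
  rewrite [X in mu.-integrable _ X](_ : _ = (fun x => C%:E * (EFin \o (fun x => (1 + x) ^- 2)) x)%E) //.
  exact: (integrableZl (mu := mu) (measurable_itv _) C inv_sqr_integrable).
apply: le_integrable ik => //.
  by apply/measurable_EFinP; exact: continuous_halfline_measurable.
move=> x /=; rewrite in_itv /= andbT => x0; rewrite lee_fin.
by apply: le_trans (qC _ x0) _; exact: ler_norm.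
Qed.

Lemma halfline_integral_tail (q : R -> R) (C y : R) :
  (forall x, 0 < x -> {for x, continuous q}) ->
  (forall x, 0 < x -> `|q x| <= C * (1 + x) ^- 2) -> 0 < y ->
  `|\int[mu]_(x in `]0, +oo[) q x - \int[mu]_(x in `]0, y]) q x| <= C / (1 + y).
Proof.
move=> cq qC y0; have iq := halfline_integrable_tail cq qC.
have ij : mu.-integrable `]y, +oo[ (EFin \o (fun x => (1 + x) ^- 2)).
  apply: integrableS inv_sqr_integrable => //.
  by apply: subset_itvr; rewrite bnd_simp ltW.
rewrite Rintegral_itvB //; last by rewrite bnd_simp ltW.
have sub : `]y, +oo[ `<=` (`]0, +oo[ : set R).
  by apply: subset_itvr; rewrite bnd_simp ltW.
have iq' : mu.-integrable `]y, +oo[ (EFin \o q) by apply: integrableS iq.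
have ik' : mu.-integrable `]y, +oo[ (EFin \o (fun x => C * (1 + x) ^- 2)).
  rewrite [X in mu.-integrable _ X](_ : _ = (fun x => C%:E * (EFin \o (fun x => (1 + x) ^- 2)) x)%E) //.
  exact: (integrableZl (mu := mu) (measurable_itv _) C ij).
apply: le_trans (le_normr_Rintegral _ iq') _ => //.
apply: (@le_trans _ _ (\int[mu]_(x in `]y, +oo[) (C * (1 + x) ^- 2))).
  apply: le_Rintegral => //; first exact: integrable_norm.
  by move=> x /=; rewrite in_itv /= andbT => yx; apply: qC; exact: lt_trans yx.
rewrite RintegralZl // Rintegral_itv_obnd_cbnd //.
by rewrite /Rintegral (inv_sqr_integral (ltW y0)) /= lexx.
Qed.

End HalfLineIntegrals.

Lemma is_derive_fin_sum (R : realType) (I : Type) (r : seq I) (h : I -> R -> R)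
    (dh : I -> R) (t : R) :
  (forall i, is_derive t 1 (h i) (dh i)) ->
  is_derive t 1 (fun s => \sum_(i <- r) h i s) (\sum_(i <- r) dh i).
Proof.
move=> hd; elim: r => [|i r IH].
  by under eq_fun do rewrite big_nil; rewrite big_nil; exact: is_derive_cst.
under eq_fun do rewrite big_cons; rewrite big_cons; exact: is_deriveD.
Qed.

(** * The renewal equation in logarithmic scale *)

Section TreeSumAsymptotics.
Variables (R : realType) (A : finType) (p : A -> R) (a0 : A).
Hypotheses (p_gt0 : forall a, 0 < p a) (p_sum : \sum_a p a = 1) (p_lt1 : forall a, p a < 1).
Variables (M : R) (c : nat -> R).
Hypotheses (cM : forall n, `|c n| <= M) (c_small : forall n, (n <= 1)%N -> c n = 0).

Lemma coincidence_lt1 : coincidence p < 1.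
Proof.
rewrite -p_sum /coincidence (bigD1 a0) //= [ltRHS](bigD1 a0) //=.
apply: ltr_leD; first by rewrite expr2 gtr_pMl.
by apply: ler_sum => a _; rewrite expr2 ger_pMl // ltW.
Qed.

Local Notation mu := (@lebesgue_measure R).
Let th1 := coincidence_lt1.
Let f lam := poisson_mean lam c.
Let F := tree_sum p f.
Let x a := - ln (p a).
Let x_gt0 a : 0 < x a. Proof. exact: neg_ln_gt0. Qed.
Let Z t := expR (- t) * F (expR t).
Let g t := expR (- t) * f (expR t).
Let M0 : 0 <= M. Proof. exact: bound_ge0 cM. Qed.
Let c0 : 0 < 1 - coincidence p. Proof. by rewrite subr_gt0. Qed.
(** One constant for all bounds on [F], [Z] and [g]: the first term serves [F], the second the toll
    [f]. *)
Let C := 4 * M / (1 - coincidence p) + M.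
Let C0 : 0 <= C. Proof. by rewrite addr_ge0 // divr_ge0 ?mulr_ge0 // ltW. Qed.
Let e0 (t : R) : 0 <= expR t. Proof. exact: expR_ge0. Qed.

Let FC lam : 0 <= lam -> `|F lam| <= C * (lam ^+ 2 / (1 + lam)).
Proof.
move=> l0; apply: le_trans (tree_sum_poisson_bound p_gt0 p_sum th1 cM c_small l0) _.
by rewrite ler_wpM2r ?lerDl // divr_ge0 ?sqr_ge0 // addr_ge0.
Qed.

Lemma tree_sum_poisson_linear lam : 0 <= lam -> `|F lam| <= C * lam.
Proof.
move=> l0; apply: le_trans (FC l0) _; rewrite ler_wpM2l // ler_pdivrMr ?ltr_wpDr //.
by rewrite expr2 ler_wpM2l // lerDr.
Qed.

Lemma tree_sum_poisson_quadratic lam : 0 <= lam -> `|F lam| <= C * lam ^+ 2.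
Proof.
move=> l0; apply: le_trans (FC l0) _; rewrite ler_wpM2l // ler_pdivrMr ?ltr_wpDr //.
by rewrite ler_peMr ?sqr_ge0 // lerDl.
Qed.

Let expRx t a : expR (t - x a) = p a * expR t.
Proof. by rewrite /x opprK expRD lnK ?posrE // mulrC. Qed.

Let ZE t : Z t = g t + \sum_a p a * Z (t - x a).
Proof.
rewrite /Z /g /F (tree_sum_poisson_eq p_gt0 th1 cM c_small) // mulrDr; congr (_ + _).
rewrite mulr_sumr; apply: eq_bigr => a _; rewrite expRx opprB expRD mulrA.
rewrite (_ : expR (x a) = (p a)^-1); last by rewrite /x expRN lnK ?posrE.
by rewrite mulrA mulfV ?gt_eqF // mul1r.
Qed.

Let ZB t : `|Z t| <= C.
Proof.
rewrite /Z normrM ger0_norm // mulrC expRN ler_pdivrMr ?expR_gt0 //.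
exact: tree_sum_poisson_linear.
Qed.

Let ZC t : `|Z t| <= C * expR t.
Proof.
rewrite /Z normrM ger0_norm // mulrC expRN ler_pdivrMr ?expR_gt0 // -mulrA -expr2.
exact: tree_sum_poisson_quadratic.
Qed.

Let gC t : `|g t| <= C * expR (- t).
Proof.
rewrite /g normrM ger0_norm // mulrC ler_wpM2r //.
apply: le_trans (poisson_mean_bound cM (e0 t)) _.
by rewrite /C lerDr divr_ge0 ?mulr_ge0 // ltW.
Qed.

Lemma vanishing_expRN : vanishing (fun t : R => expR (- t)).
Proof. by apply/vanishingP; exact: cvgr_expR. Qed.

Let vg : vanishing g.
Proof. by apply: (vanishing_le gC); apply: vanishingZ; exact: vanishing_expRN. Qed.

(* The parameter [L] of [tree_sum_poisson_dist] is chosen first, and then [r]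
   close enough to 1. *)
Lemma tree_sum_poisson_unif e : 0 < e -> exists2 r0, 1 < r0 &
  forall lam r, 0 <= lam -> 1 <= r <= r0 -> `|F (r * lam) - F lam| <= e * lam.
Proof.
move=> ee; pose K := 8 * M / (1 - coincidence p).
have K0 : 0 <= K by rewrite divr_ge0 ?mulr_ge0 // ltW.
pose L := 2 * K / e + 1.
have KL0 : 0 <= 2 * K / e by apply: divr_ge0; [exact: mulr_ge0|exact: ltW].
have L0 : 0 < L by rewrite /L ltr_wpDl.
pose K2 := 4 * M * (1 + L) ^+ 2 / (1 - coincidence p).
have K20 : 0 <= K2.
  by apply: divr_ge0; [apply: mulr_ge0; [exact: mulr_ge0|exact: sqr_ge0]|exact: ltW].
have K21 : 0 < K2 + 1 by rewrite ltr_wpDl.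
have eK : 0 < e / 2 / (K2 + 1) by rewrite divr_gt0 ?divr_gt0.
(* The cap 1 keeps r / 2 <= 1; the other one makes the first term of the modulus at most e/2. *)
pose dl := Num.min 1 (e / 2 / (K2 + 1)).
have dl0 : 0 < dl by rewrite /dl lt_min ltr01.
exists (1 + dl); first by rewrite ltrDl.
move=> lam r l0 /andP[r1 rd].
apply: le_trans (tree_sum_poisson_dist p_gt0 p_sum th1 cM c_small l0 r1 L0) _.
rewrite ler_wpM2r // mulrDl.
have : 8 * M / L / (1 - coincidence p) <= e / 2.
  rewrite mulrAC -/K ler_pdivrMr // /L mulrDr mulr1.
  have -> : e / 2 * (2 * K / e) = K by field; rewrite gt_eqF.
  by rewrite lerDl divr_ge0 // ltW.
have : 2 * M * ((r - 1) * r) * (1 + L) ^+ 2 / (1 - coincidence p) <= e / 2.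
  have -> : 2 * M * ((r - 1) * r) * (1 + L) ^+ 2 / (1 - coincidence p) =
    K2 * ((r - 1) * (r / 2)) by rewrite /K2; field; rewrite gt_eqF.
  have r2 : r / 2 <= 1.
    have : dl <= 1 by rewrite /dl ge_min lexx.
    lra.
  have d2 : dl * (K2 + 1) <= e / 2.
    by rewrite -ler_pdivlMr // /dl ge_min lexx orbT.
  have X0 : (r - 1) * (r / 2) <= r - 1 by rewrite ler_piMr // subr_ge0.
  have Xd : (r - 1) * (r / 2) <= dl by apply: le_trans X0 _; rewrite lerBlDl.
  apply: le_trans (ler_wpM2l K20 Xd) _; apply: le_trans d2.
  by rewrite mulrC ler_wpM2l ?lerDl // ltW.
lra.
Qed.

(** The increment of [Z] splits into an increment of [F], controlled uniformly, and the change of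
    the factor e^-t, controlled by the linear bound on [F]. [r1] is small enough for both. *)
Let Zunif e : 0 < e -> exists2 dl, 0 < dl &
  forall t s, 0 <= s <= dl -> `|Z (t + s) - Z t| <= e.
Proof.
move=> ee; have e2 : 0 < e / 2 by rewrite divr_gt0.
have [r0 r01 hr] := tree_sum_poisson_unif e2.
pose r1 := Num.min r0 (1 + e / 2 / (C + 1)).
have C1 : 0 < C + 1 by rewrite ltr_wpDl.
have r11 : 1 < r1 by rewrite lt_min r01 ltrDl divr_gt0.
exists (ln r1); first by rewrite ln_gt0.
move=> t s /andP[s0 sr]; set r := expR s.
have rge1 : 1 <= r by rewrite /r -expR0 ler_expR.
have rler1 : r <= r1 by rewrite -[leRHS]lnK ?posrE ?ler_expR // (lt_trans _ r11).
have r_gt0 : 0 < r by exact: expR_gt0.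
have -> : Z (t + s) - Z t = expR (- t) *
    ((F (r * expR t) - F (expR t)) - (1 - r^-1) * F (r * expR t)).
  by rewrite /Z opprD !expRD [expR (- s)]expRN -/r [expR t * r]mulrC; ring.
rewrite normrM ger0_norm // expRN mulrC ler_pdivrMr ?expR_gt0 //.
apply: le_trans (ler_normB _ _) _; rewrite (splitr e) [leRHS]mulrDl; apply: lerD.
  by apply: hr => //; rewrite rge1 (le_trans rler1) // ge_min lexx.
have rV : 0 <= 1 - r^-1 by rewrite subr_ge0 invf_le1.
rewrite normrM ger0_norm //.
have rt0 : 0 <= r * expR t by rewrite mulr_ge0 // ltW.
apply: le_trans (ler_wpM2l rV (tree_sum_poisson_linear rt0)) _.
have -> : (1 - r^-1) * (C * (r * expR t)) = (r - 1) * C * expR t.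
  by field; rewrite gt_eqF.
rewrite ler_wpM2r //; apply: (@le_trans _ _ ((r - 1) * (C + 1))).
  by rewrite ler_wpM2l ?subr_ge0 // lerDl.
rewrite -ler_pdivlMr // lerBlDl (le_trans rler1) // ge_min.
by apply/orP; right.
Qed.

Let Zcont : continuous Z.
Proof.
move=> t; apply/cvgrPdist_le => /= e ee; have [dl dl0 hdl] := Zunif ee.
near=> s; have h : `|t - s| <= dl by near: s; exact: cvgr_dist_le.
move: h; rewrite ler_norml lerNl opprB => /andP[h1 h2].
have [st|ts] := lerP s t.
  by have := hdl s (t - s); rewrite subrKC subr_ge0 st h2 => /(_ isT).
by rewrite distrC; have := hdl t (s - t); rewrite subrKC subr_ge0 (ltW ts) h1 => /(_ isT).
Unshelve. all: by end_near. Qed.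

Let FZ lam : 0 < lam -> F lam = lam * Z (ln lam).
Proof. by move=> l0; rewrite /Z expRN lnK ?posrE // mulrA mulfV ?gt_eqF // mul1r. Qed.

Lemma tree_sum_poisson_continuous lam : 0 < lam -> {for lam, continuous F}.
Proof.
move=> l0; have : (fun y => y * Z (ln y)) @ lam --> lam * Z (ln lam).
  apply: cvgM; first exact: cvg_id.
  by apply: continuous_comp; [exact: continuous_ln|exact: Zcont].
rewrite /prop_for /continuous_at -FZ //; apply: cvg_trans; apply: near_eq_cvg.
near=> y; rewrite FZ //; near: y; exact: lt_nbhsr.
Unshelve. all: by end_near. Qed.

(** Read off the functional equation, which expresses [f] through finitely many values of the
    continuous function [F]. *)
Lemma poisson_mean_continuous lam : 0 < lam -> {for lam, continuous f}.
Proof.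
move=> l0; have : (fun y => F y - \sum_a F (p a * y)) @ lam --> F lam - \sum_a F (p a * lam).
  apply: cvgB; first exact: tree_sum_poisson_continuous.
  apply: cvg_fin_sum => a; apply: (@continuous_comp _ _ _ (fun y => p a * y) F).
    by apply: cvgMr; exact: cvg_id.
  by apply: tree_sum_poisson_continuous; rewrite mulr_gt0.
have fF y : 0 < y -> F y - \sum_a F (p a * y) = f y.
  by move=> y0; rewrite /F (tree_sum_poisson_eq p_gt0 th1 cM c_small) ?(ltW y0) // addrK.
rewrite /prop_for /continuous_at fF //; apply: cvg_trans; apply: near_eq_cvg.
near=> y; rewrite fF //; near: y; exact: lt_nbhsr.
Unshelve. all: by end_near. Qed.

Let sum_entropy : \sum_a p a * x a = entropy p.
Proof. by rewrite /entropy -sumrN; apply: eq_bigr => a _; rewrite mulrN. Qed.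

Lemma entropy_gt0 : 0 < entropy p.
Proof.
rewrite -sum_entropy (bigD1 a0) //= ltr_pwDl ?mulr_gt0 // sumr_ge0 // => a _.
by rewrite mulr_ge0 // ltW.
Qed.

Let qF y := F y * y ^- 2.
Let qf y := f y * y ^- 2.

Let cont_sqrV (y : R) : 0 < y -> {for y, continuous (fun z : R => z ^- 2)}.
Proof.
by move=> y0; apply: cvgV; [rewrite expf_neq0 // gt_eqF|apply: cvgM; exact: cvg_id].
Qed.

Let qF_cont y : 0 < y -> {for y, continuous qF}.
Proof.
by move=> y0; apply: cvgM; [exact: tree_sum_poisson_continuous|exact: cont_sqrV].
Qed.

Let qf_cont y : 0 < y -> {for y, continuous qf}.
Proof.
by move=> y0; apply: cvgM; [exact: poisson_mean_continuous|exact: cont_sqrV].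
Qed.

Let qF_bound y : 0 < y -> `|qF y| <= C.
Proof.
move=> y0; rewrite /qF normrM normfV (ger0_norm (sqr_ge0 y)) ler_pdivrMr ?exprn_gt0 //.
exact: tree_sum_poisson_quadratic (ltW y0).
Qed.

Let qf_tail y : 0 < y -> `|qf y| <= 4 * M * (1 + y) ^- 2.
Proof.
move=> y0; rewrite /qf normrM normfV (ger0_norm (sqr_ge0 y)) ler_pdivrMr ?exprn_gt0 //.
apply: le_trans (poisson_mean_ratio_bound cM c_small (ltW y0)) _.
rewrite le_eqVlt; apply/orP; left; apply/eqP.
by field; rewrite gt_eqF // addr_gt0.
Qed.

Let qf_bound y : 0 < y -> `|qf y| <= 4 * M.
Proof.
move=> y0; apply: le_trans (qf_tail y0) _.
rewrite ler_pdivrMr ?exprn_gt0 ?addr_gt0 // ler_peMr ?mulr_ge0 // exprn_ege1 //.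
by rewrite lerDl ltW.
Qed.

(** Substituting z = e^s, [V] and [J] are the integrals of [Z] and [g] from minus infinity to [t];
    the limit of [J] is the Mellin transform at -1. *)
Let V t := \int[mu]_(z in `]0, expR t]) qF z.
Let J t := \int[mu]_(z in `]0, expR t]) qf z.

Let dV (t : R) : is_derive t 1 V (Z t).
Proof.
have h1 := is_derive_halfline_integral qF_cont qF_bound (expR_gt0 t).
have := is_derive1_comp h1 (is_derive_expR t).
rewrite /qF (_ : _ * expR t = Z t) //.
by rewrite /Z expRN; field; rewrite gt_eqF // expR_gt0.
Qed.

Let dJ (t : R) : is_derive t 1 J (g t).
Proof.
have h1 := is_derive_halfline_integral qf_cont qf_bound (expR_gt0 t).
have := is_derive1_comp h1 (is_derive_expR t).
rewrite /qf (_ : _ * expR t = g t) //.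
by rewrite /g expRN; field; rewrite gt_eqF // expR_gt0.
Qed.

Let V_mean_value (t s : R) : 0 < s -> exists2 u, t - s <= u <= t & V t - V (t - s) = s * Z u.
Proof.
move=> s0; have ts : t - s < t by rewrite ltrBlDr ltrDl.
have [u|u] := @MVT R V Z _ _ ts (fun y _ => dV y).
  apply: continuous_subspaceT => y; apply: differentiable_continuous.
  by apply/derivable1_diffP; case: (dV y).
rewrite in_itv /= => /andP[u1 u2] E; exists u; first by rewrite !ltW.
by rewrite E opprB addrCA subrr addr0 mulrC.
Qed.

(** The renewal equation, integrated: the difference [U] of the two sides has derivative zero and is
    O(e^t) at minus infinity, hence vanishes. *)
Let V_renewal (t : R) : \sum_a p a * (V t - V (t - x a)) = J t.
Proof.
pose U t := \sum_a p a * (V t - V (t - x a)) - J t.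
have dU (s : R) : is_derive s 1 U 0.
  have dVs a : is_derive s 1 (fun y => V (y - x a)) (Z (s - x a)).
    have h : is_derive s 1 (fun y => y - x a) (1 - 0) by apply: is_deriveB.
    by have := @is_derive1_comp R V (fun y => y - x a) s _ _ (dV (s - x a)) h; rewrite subr0 mulr1.
  have h : is_derive s 1 U (\sum_a p a * (Z s - Z (s - x a)) - g s).
    have ha a : is_derive s 1 (fun y => p a * (V y - V (y - x a))) (p a * (Z s - Z (s - x a))).
      exact: (is_deriveZ (p a) (is_deriveB (dV s) (dVs a))).
    exact: (is_deriveB (is_derive_fin_sum (index_enum A) ha) (dJ s)).
  move: h; rewrite (_ : _ - g s = 0) //.
  under eq_bigr do rewrite mulrBr; rewrite sumrB -mulr_suml p_sum mul1r {1}ZE.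
  by rewrite addrK subrr.
have Vb s : `|V s| <= C * expR s := halfline_integral_bound qF_cont qF_bound (expR_gt0 s).
have Jb s : `|J s| <= 4 * M * expR s := halfline_integral_bound qf_cont qf_bound (expR_gt0 s).
have Ub s : `|U s| <= (2 * C + 4 * M) * expR s.
  apply: le_trans (ler_normB _ _) _; rewrite mulrDl; apply: lerD => //.
  rewrite -[leRHS]mul1r -[X in _ <= X * _]p_sum mulr_suml; apply: le_trans (ler_norm_sum _ _ _) _.
  apply: ler_sum => a _; rewrite normrM (ger0_norm (ltW (p_gt0 a))) ler_wpM2l ?(ltW (p_gt0 a)) //.
  apply: le_trans (ler_normB _ _) _; rewrite -[leRHS]mulrA [leRHS]mulr_natl mulr2n; apply: lerD => //.
  apply: le_trans (Vb _) _; rewrite ler_wpM2l // expRx ger_pMl ?expR_gt0 //.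
  by rewrite ltW.
suff : U t = 0 by move/eqP; rewrite subr_eq0 => /eqP.
apply/eqP; rewrite -normr_eq0 eq_le normr_ge0 andbT; apply/ler_addgt0Pl => e ee.
rewrite addr0; pose K := 2 * C + 4 * M + 1.
have K0 : 0 < K by rewrite ltr_wpDl // addr_ge0 // mulr_ge0.
(* The constant [U] is evaluated at ln (e / K), where its exponential bound is below [e]. *)
rewrite (is_derive_0_is_cst t (ln (e / K)) dU); apply: le_trans (Ub _) _.
rewrite lnK ?posrE ?divr_gt0 // mulrA ler_pdivrMr // mulrC ler_wpM2l ?(ltW ee) //.
by rewrite lerDl.
Qed.

(** [ff] stands for [fE], which is identified with a Poisson mean at positive arguments only; [psiE]
    looks at no others. *)
Lemma tree_sum_psi (ff : R -> R) : (forall lam, 0 < lam -> ff lam = poisson_mean lam c) ->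
  vanishing (fun t => expR (- t) * tree_sum p (fun lam => poisson_mean lam c) (expR t)
                      - (entropy p)^-1 * psiE p ff t).
Proof.
move=> ffE; have H0 := entropy_gt0.
suff : vanishing (fun t => entropy p * Z t - psiE p ff t).
  move=> /(vanishingZ (entropy p)^-1) /vanishing_norm; apply: vanishing_le => t.
  by rewrite mulrBr mulKf ?gt_eqF // lexx.
rewrite -sum_entropy /psiE.
have [[-> dense]|[d0 Gd /choice[k xk]]] := dp_dichotomy p_gt0 p_lt1 a0.
  rewrite eqxx.
  have -> : mellin ff (-1) = \int[mu]_(z in `]0, +oo[) qf z.
    apply: eq_Rintegral => z; rewrite inE /= in_itv /= andbT => z0.
    rewrite ffE // /qf (_ : -1 - 1 = - 2%:R); last by ring.
    by rewrite powRN powR_mulrn // ltW.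
  under eq_fun => t.
    rewrite (_ : _ - _ = ((\sum_a p a * x a) * Z t - \sum_a p a * (V t - V (t - x a)))
      - (\int[mu]_(z in `]0, +oo[) qf z - J t)); last by rewrite V_renewal; ring.
    over.
  apply: vanishingD.
    exact: (nonlattice_limit p_gt0 p_sum x_gt0 ZE ZB vg dense Zunif V_mean_value).
  apply: vanishingN.
  apply: (@vanishing_le _ _ (fun t => 4 * M * expR (- t))); last first.
    by apply: vanishingZ; exact: vanishing_expRN.
  move=> t; apply: le_trans (halfline_integral_tail qf_cont qf_tail (expR_gt0 t)) _.
  rewrite expRN ler_wpM2l ?mulr_ge0 // lef_pV2 ?posrE ?expR_gt0 ?addr_gt0 //.
    by rewrite lerDr.
  exact: expR_gt0.
rewrite gt_eqF //.
have E t : sumZ (fun m : int => expR (m%:~R * dp p - t) * ff (expR (t - m%:~R * dp p))) =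
    sumZ (fun m : int => g (t - m%:~R * dp p)).
  by congr sumZ; apply/funext => m; rewrite /g opprB ffE // expR_gt0.
under eq_fun do rewrite E.
exact: (lattice_limit p_gt0 p_sum x_gt0 ZE ZB vg d0 xk Gd ZC gC).
Qed.

Lemma sumZ_ge (u : int -> R) k : (forall j, 0 <= u j) ->
  cvgn (series (fun j : nat => u j%:Z)) -> cvgn (series (fun j : nat => u (- j.+1%:Z))) ->
  u k <= sumZ u.
Proof.
move=> u0.
have ge (v : nat -> R) n : (forall j, 0 <= v j) -> cvgn (series v) -> v n <= limn (series v).
  move=> v0 cv; apply: (@le_trans _ _ (series v n.+1)).
    by rewrite /series /= big_nat_recr //= lerDr sumr_ge0.
  apply: nondecreasing_cvgn_le => //; apply/nondecreasing_seqP => m.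
  by rewrite /series /= [leRHS]big_nat_recr //= lerDl.
move=> c1 c2; have z1 := le_trans (u0 0) (ge _ 0%N (fun j : nat => u0 j%:Z) c1).
have z2 := le_trans (u0 (- 1%:Z)) (ge _ 0%N (fun j : nat => u0 (- j.+1%:Z)) c2).
case: k => n; first by rewrite /sumZ -[leLHS]addr0 lerD // (ge _ n (fun j : nat => u0 j%:Z)).
by rewrite /sumZ NegzE -[leLHS]add0r lerD // (ge _ n (fun j : nat => u0 (- j.+1%:Z))).
Qed.

(** Without lattice, the part of the integral over ]1, 2], where z^-2 >= 1/4, is enough. With
    lattice, one term of the series is: some shift of [t] falls in [0, dp p], where the argument of
    [ff] lies between 1 and e^(dp p). The interval assumed for [k] covers both cases. *)
Lemma psiE_ge (ff : R -> R) (k : R) :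
  (forall lam, 0 < lam -> ff lam = poisson_mean lam c) ->
  0 <= k -> (forall lam, 0 < lam -> 0 <= poisson_mean lam c) ->
  (forall lam, 1 <= lam <= Num.max 2 (expR (dp p)) -> k <= poisson_mean lam c) ->
  forall t, (if dp p == 0 then k / 4 else dp p * (expR (- dp p) * k)) <= psiE p ff t.
Proof.
move=> ffE k0 f0 fk t; rewrite /psiE.
have [[dp0 dense]|[d0 Gd /choice[kk xk]]] := dp_dichotomy p_gt0 p_lt1 a0.
  rewrite dp0 eqxx.
  have -> : mellin ff (-1) = \int[mu]_(z in `]0, +oo[) qf z.
    apply: eq_Rintegral => z; rewrite inE /= in_itv /= andbT => z0.
    rewrite ffE // /qf (_ : -1 - 1 = - 2%:R); last by ring.
    by rewrite powRN powR_mulrn // ltW.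
  have iq := halfline_integrable_tail qf_cont qf_tail.
  have i2 : mu.-integrable `]0, 2] (EFin \o qf) := continuous_halfline_integrable 2 qf_cont qf_bound.
  have qf0 y : 0 < y -> 0 <= qf y.
    by move=> y0; rewrite /qf divr_ge0 ?sqr_ge0 // f0.
  have b2 : (BRight (0 : R) <= BRight 2)%O by rewrite bnd_simp.
  have b1 : (BRight (0 : R) <= BRight 1)%O by rewrite bnd_simp.
  have b12 : (BRight (1 : R) <= BRight 2)%O by rewrite bnd_simp ler1n.
  have b2y : (BRight (2 : R) <= +oo)%O by rewrite bnd_simp.
  have e1 := Rintegral_itvB iq b2 b2y.
  have e2 := Rintegral_itvB i2 b1 b12.
  have h1 : 0 <= \int[mu]_(z in `]2, +oo[) qf z.
    by apply: Rintegral_ge0 => z /=; rewrite in_itv /= andbT => z2; apply: qf0; exact: lt_trans z2.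
  have h2 : 0 <= \int[mu]_(z in `]0, 1]) qf z.
    by apply: Rintegral_ge0 => z /=; rewrite in_itv /= => /andP[z2 _]; exact: qf0.
  have h3 : k / 4 <= \int[mu]_(z in `]1, 2]) qf z.
    apply: (@le_trans _ _ (\int[mu]_(z in `]1, 2]) (k / 4))).
      rewrite Rintegral_cst //=; rewrite lebesgue_measure_itv /= lte_fin ltr1n -EFinB /=.
      by rewrite (_ : 2 - 1 = 1) ?mulr1 //; ring.
    have sub : `]1, 2] `<=` (`]0, 2] : set R) by apply: subset_itvr; rewrite bnd_simp.
    apply: le_Rintegral => //.
    - apply: (@integrableS _ _ _ mu `]0, 2]) => //.
      apply: (@continuous_halfline_integrable _ (cst (k / 4)) `|k / 4|) => // x0 _.
      exact: cst_continuous.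
    - exact: integrableS i2.
    - move=> z /=; rewrite in_itv /= => /andP[z1 z2].
      have z0 : 0 < z by exact: lt_trans z1.
      rewrite /qf ler_pdivlMr ?exprn_gt0 // mulrAC ler_pdivrMr //.
      apply: (@le_trans _ _ (k * 4)).
        rewrite ler_wpM2l // (_ : 4 = 2 ^+ 2); last by ring.
        by rewrite lerXn2r ?nnegrE // ltW.
      by rewrite ler_wpM2r // fk // (ltW z1) le_max z2.
  apply: le_trans h3 _; apply: (@le_trans _ _ (\int[mu]_(z in `]0, 2]) qf z)).
    by rewrite -e2 gerBl.
  by rewrite -subr_ge0 e1.
rewrite gt_eqF // ler_pM2l //.
have E (m : int) : expR (m%:~R * dp p - t) * ff (expR (t - m%:~R * dp p)) = g (t - m%:~R * dp p).
  by rewrite /g opprB ffE // expR_gt0.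
under [X in sumZ X]eq_fun do rewrite E.
have [c1 c2] := lattice_series_cvg p_gt0 p_sum ZE d0 xk ZC gC t.
have g0 s : 0 <= g s by rewrite mulr_ge0 // f0 // expR_gt0.
(* The index whose shift brings [t] into one period to the right of 0. *)
pose m := Num.floor (t / dp p).
apply: le_trans (@sumZ_ge (fun m : int => g (t - m%:~R * dp p)) m (fun j => g0 _) c1 c2).
have um : 0 <= t - m%:~R * dp p by rewrite subr_ge0 -ler_pdivlMr // floor_le.
have ud : t - m%:~R * dp p <= dp p.
  have := floorD1_gt (t / dp p); rewrite ltr_pdivrMr // intrD mulrDl mul1r -/m => h.
  by rewrite lerBlDl ltW.
apply: ler_pM => //; first by rewrite ler_expR lerN2.
apply: fk; apply/andP; split; first by rewrite -[leLHS]expR0 ler_expR.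
by rewrite le_max ler_expR ud orbT.
Qed.

End TreeSumAsymptotics.

(** * Laws of random tries *)

Section TupleSums.
Variables (R : realType) (X : finType) (Y : Type) (w : X -> R) (v : X -> Y)
  (mu : (Y -> R) -> R).
Hypothesis muE : forall f, mu f = \sum_x w x * f (v x).

Lemma sum_tuple_cons n (G : n.+1.-tuple X -> R) :
  \sum_t G t = \sum_x \sum_(t : n.-tuple X) G [tuple of x :: t].
Proof.
rewrite pair_big /=; apply: (reindex (fun q : X * n.-tuple X => [tuple of q.1 :: q.2])).
exists (fun t : n.+1.-tuple X => (thead t, [tuple of behead t])) => [[x t] _|t _] /=.
  by rewrite theadE; congr (_, _); apply: val_inj.
by rewrite -tuple_eta.
Qed.

(** The iterated mean as a finite weighted sum, a form in which it can be matched with probabilities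
    of events. *)
Lemma list_mean_tuple n f :
  list_mean mu n f = \sum_(t : n.-tuple X) (\prod_(x <- t) w x) * f (map v t).
Proof.
elim: n f => [|n IH] f /=.
  rewrite (eq_bigr (fun=> f [::])) => [|t _]; last by rewrite tuple0 big_nil mul1r.
  by rewrite sumr_const card_tuple expn0.
rewrite sum_tuple_cons muE; apply: eq_bigr => x _; rewrite IH mulr_sumr.
by apply: eq_bigr => t _; rewrite /= big_cons mulrA.
Qed.

End TupleSums.

Section PrefixLaw.
Variables (R : realType) (A : finType) (p : A -> R) (a0 : A).
Hypotheses (p_gt0 : forall a, 0 < p a) (p_sum : \sum_a p a = 1).
Context d (Omega : measurableType d) (P : probability Omega R).
Variable Xi : nat -> Omega -> nat -> A.
Hypothesis hXi : iid_strings P p Xi.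

Definition random_prefixes n K (w : Omega) := prefixes n K (fun i => Xi i w).

Definition string_weight (u : seq A) : R := \prod_(a <- u) p a.

Lemma strings_mean_tuple K n f :
  strings_mean p K n f = \sum_(t : n.-tuple (K.-tuple A))
    (\prod_(u <- t) string_weight u) * f (map val t).
Proof.
apply: (@list_mean_tuple _ (K.-tuple A) _ (fun u => string_weight u) val) => g.
rewrite /string_mean (@list_mean_tuple _ A _ p id) //.
by apply: eq_bigr => u _; rewrite map_id.
Qed.

Let string_event i (u : seq A) := [set w | mkseq (Xi i w) (size u) = u].

Let interval_fset n : {fset nat} := [fset k in iota 0 n]%fset.

Let mem_interval n k : (k \in interval_fset n) = (k < n)%N.
Proof. by rewrite !inE mem_iota. Qed.

Let big_interval (T : Type) (idx : T) (op : Monoid.com_law idx) n (F : nat -> T) :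
  \big[op/idx]_(k <- interval_fset n) F k = \big[op/idx]_(k <- iota 0 n) F k.
Proof.
apply: perm_big; apply: uniq_perm; rewrite ?fset_uniq ?iota_uniq // => k.
by rewrite mem_interval mem_iota.
Qed.

Let string_eventE i u :
  string_event i u = \bigcap_(k in [set` interval_fset (size u)]) [set w | Xi i w k = nth a0 u k].
Proof.
apply/seteqP; split=> w /=.
  move=> <- k /=; rewrite mem_interval size_mkseq => kn.
  by rewrite nth_mkseq.
move=> h; apply: (@eq_from_nth _ a0); rewrite size_mkseq // => k ku.
by rewrite nth_mkseq //; apply: h; rewrite /= mem_interval.
Qed.

Lemma string_event_sigma i u : sigma_string (Xi i) (string_event i u).
Proof.
rewrite string_eventE.
pose G := \bigcup_k sigma_discrete (fun w => Xi i w k).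
apply: (@fin_bigcap_measurable _ (g_sigma_algebraType G)) => [|k _]; first exact: finite_fset.
by apply: sub_gen_smallest; exists k => //; exists [set nth a0 u k].
Qed.

Lemma string_event_prob i u : P (string_event i u) = (string_weight u)%:E.
Proof.
have [_ hp hi _] := hXi.
rewrite string_eventE (hi i); last by move=> k _; exists [set nth a0 u k].
rewrite big_interval; under eq_bigr do rewrite hp.
rewrite /string_weight -prodEFin.
by rewrite [in RHS](big_nth a0) /index_iota subn0.
Qed.

Lemma prefixes_eventE K n (t : n.-tuple (K.-tuple A)) :
  [set w | random_prefixes n K w = map val t] =
  \bigcap_(i in [set` interval_fset n]) string_event i (nth [::] (map val t) i).
Proof.
have szt i : (i < n)%N -> size (nth [::] (map val t) i) = K.
  move=> ni; rewrite (nth_map (tnth t (Ordinal ni))) ?size_tuple //.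
apply/seteqP; split=> w /=.
  move=> E i /=; rewrite mem_interval => ni; rewrite /string_event /= szt //.
  by rewrite -E /random_prefixes /prefixes (nth_map 0%N) ?size_iota // nth_iota.
move=> h; apply: (@eq_from_nth _ [::]); rewrite ?size_map ?size_iota ?size_tuple // => i ni.
rewrite (nth_map 0%N) ?size_iota // nth_iota // add0n.
have /= := h i; rewrite mem_interval => /(_ ni).
by rewrite /string_event /= szt.
Qed.

Lemma prefixes_event_sigma K n (t : n.-tuple (K.-tuple A)) :
  sigma_strings Xi [set w | random_prefixes n K w = map val t].
Proof.
rewrite prefixes_eventE.
pose G := \bigcup_i sigma_string (Xi i).
apply: (@fin_bigcap_measurable _ (g_sigma_algebraType G)) => [|i _]; first exact: finite_fset.
by apply: sub_gen_smallest; exists i => //; exact: string_event_sigma.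
Qed.

Lemma prefixes_event_prob K n (t : n.-tuple (K.-tuple A)) :
  P [set w | random_prefixes n K w = map val t] = (\prod_(u <- t) string_weight u)%:E.
Proof.
have [_ _ _ hI] := hXi.
rewrite prefixes_eventE hI; last by move=> i _; exact: string_event_sigma.
rewrite big_interval; under eq_bigr do rewrite string_event_prob.
rewrite -prodEFin -(big_map val xpredT (EFin \o string_weight)) [in RHS](big_nth [::]).
by rewrite size_map size_tuple /index_iota subn0.
Qed.

Lemma prefixes_event_measurable K n (t : n.-tuple (K.-tuple A)) :
  measurable [set w | random_prefixes n K w = map val t].
Proof.
rewrite prefixes_eventE; apply: fin_bigcap_measurable => [|i _]; first exact: finite_fset.
rewrite string_eventE; apply: fin_bigcap_measurable => [|k _]; first exact: finite_fset.
by have [hm _ _ _] := hXi.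
Qed.

Lemma random_prefixes_tuple K n w :
  exists t : n.-tuple (K.-tuple A), random_prefixes n K w = map val t.
Proof.
have sz i : size (mkseq (Xi i w) K) == K by rewrite size_mkseq.
exists (map_tuple (fun i => Tuple (sz i)) (iota_tuple n 0)).
by rewrite /= -map_comp.
Qed.

(** Used for the whole space, which gives the model with fixed n, and for the events that the
    Poisson count equals n. *)
Definition indep_event (E : set Omega) := measurable E /\
  forall F, sigma_strings Xi F -> P (E `&` F) = (P E * P F)%E.

(** The bridge from [P] to the combinatorial means: random prefixes take finitely many values, and
    each of these has the product of its letter weights as probability, independently of [E]. *)
Lemma integral_prefixes E K n (g : seq (seq A) -> R) : indep_event E ->
  (\int[P]_(w in E) (g (random_prefixes n K w))%:E = P E * (strings_mean p K n g)%:E)%E.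
Proof.
move=> [mE hE].
pose B (t : n.-tuple (K.-tuple A)) := [set w | random_prefixes n K w = map val t].
have mB t : measurable (B t) by exact: prefixes_event_measurable.
transitivity (\int[P]_(w in E) (\sum_(t : n.-tuple (K.-tuple A))
    ((g (map val t))%:E * (\1_(B t) w)%:E)))%E.
  apply: eq_integral => w _; have [t0 t0E] := random_prefixes_tuple K n w.
  rewrite (bigD1 t0) //= big1 ?adde0 => [|t tt0].
    by rewrite indicE mem_set //= mule1 t0E.
  rewrite indicE memNset ?mule0 // /B /= t0E => /inj_map/val_inj tE.
  by move: tt0; rewrite tE ?eqxx //; exact: val_inj.
rewrite integral_sum //; last first.
  by move=> t; apply: integrableZl => //; exact: integrableS (integrable_indic _ (mB t)).
have PE : P E = (fine (P E))%:E by rewrite fineK // fin_num_measure.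
rewrite strings_mean_tuple PE -EFinM mulr_sumr -sumEFin; apply: eq_bigr => t _.
rewrite integralZl //; last exact: integrableS (integrable_indic _ (mB t)).
rewrite integral_indic // setIC.
have hBt := hE (B t) (prefixes_event_sigma t); rewrite prefixes_event_prob PE in hBt.
transitivity ((g (map val t))%:E * ((fine (P E))%:E * (\prod_(u <- t) string_weight u)%:E))%E.
  by congr (_ * _)%E; exact: hBt.
by rewrite -!EFinM; congr EFin; ring.
Qed.

End PrefixLaw.

(** * Measurability and mean tolls of random tries *)

Section TrieLaw.
Variables (R : realType) (A : finType) (p : A -> R) (a0 : A).
Hypotheses (p_gt0 : forall a, 0 < p a) (p_sum : \sum_a p a = 1).
Context d (Omega : measurableType d) (P : probability Omega R).
Variable Xi : nat -> Omega -> nat -> A.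
Hypothesis hXi : iid_strings P p Xi.
Local Notation indep_event := (indep_event P Xi).

Lemma prefixes_pred_sigma n K (B : set (seq (seq A))) :
  sigma_strings Xi [set w | B (random_prefixes Xi n K w)].
Proof.
pose G := \bigcup_i sigma_string (Xi i).
rewrite (_ : [set w | _] = \bigcup_(t in [set t : n.-tuple (K.-tuple A) | B (map val t)])
    [set w | random_prefixes Xi n K w = map val t]).
  apply: (@fin_bigcup_measurable _ (g_sigma_algebraType G)) => [|t _]; first exact: finite_finset.
  exact: (prefixes_event_sigma a0).
apply/seteqP; split=> w /=; last by move=> [t /= Bt ->].
by have [t tE] := random_prefixes_tuple Xi K n w; rewrite tE => Bt; exists t.
Qed.

Lemma sigma_strings_measurable F : sigma_strings Xi F -> measurable F.
Proof.
have [hm _ _ _] := hXi.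
apply: smallest_sub; first exact: sigma_algebra_measurable.
move=> {}F [i _]; apply: smallest_sub; first exact: sigma_algebra_measurable.
move=> {}F [k _] [B _ <-].
rewrite (_ : _ @^-1` _ = \bigcup_(a in B) [set w | Xi i w k = a]).
  by apply: fin_bigcup_measurable => [|a _]; [exact: finite_finset|exact: hm].
by apply/seteqP; split=> w /=; [move=> Bw; exists (Xi i w k)|move=> [a Ba /= ->]].
Qed.

(** Where some [K] separates the strings, the trie is a function of finitely many letters; where
    none does, two strings coincide and the trie is the default [fset0]. Hence an arbitrary [Q] is
    admissible. *)
Lemma trie_pred_sigma n (Q : set {fset seq A}) : sigma_strings Xi [set w | Q (trie_n Xi n w)].
Proof.
pose G := \bigcup_i sigma_string (Xi i).
pose U K := [set w | uniq (random_prefixes Xi n K w)].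
pose Q' K := [set w | Q (list_trie (random_prefixes Xi n K w))].
have mU K : measurable (U K : set (g_sigma_algebraType G)).
  exact: (prefixes_pred_sigma n K (fun s => uniq s)).
have mQ' K : measurable (Q' K : set (g_sigma_algebraType G)).
  exact: (prefixes_pred_sigma n K (fun s => Q (list_trie s))).
rewrite (_ : [set w | _] = \bigcup_K (U K `&` Q' K) `|`
   (~` (\bigcup_K U K) `&` [set w | Q fset0])).
  apply: (@measurableU _ (g_sigma_algebraType G)).
    by apply: bigcupT_measurable => K; exact: measurableI.
  apply: (@measurableI _ (g_sigma_algebraType G)).
    by apply: measurableC; exact: bigcupT_measurable.
  have [Q0|Q0] := pselect (Q fset0).
    by rewrite (_ : [set w | _] = setT); [exact: measurableT|apply/seteqP; split].
  by rewrite (_ : [set w | _] = set0); [exact: measurable0|apply/seteqP; split].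
apply/seteqP; split=> w /=.
  move=> Qw; have [[K _ UK]|nU] := pselect ((\bigcup_K U K) w).
    by left; exists K => //; split=> //; rewrite /Q' /= -(trie_prefixes UK).
  right; split=> //; move: Qw; rewrite /trie_n trie_not_distinct // => dx.
  by apply: nU; have [K UK] := distinct_uniq_prefixes dx; exists K.
move=> [[K _ [UK]]|[nU]]; first by rewrite /Q' /= -(trie_prefixes UK).
rewrite /trie_n trie_not_distinct // => dx.
by apply: nU; have [K UK] := distinct_uniq_prefixes dx; exists K.
Qed.

Lemma trie_pred_measurable n (Q : set {fset seq A}) :
  measurable [set w | Q (trie_n Xi n w)].
Proof. exact: (sigma_strings_measurable (trie_pred_sigma n Q)). Qed.

Lemma indep_setT : indep_event setT.
Proof.
split=> [|F _]; first exact: measurableT.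
by rewrite setTI probability_setT mul1e.
Qed.

Lemma prefixes_prob E n K (B : pred (seq (seq A))) : indep_event E ->
  P (E `&` [set w | B (random_prefixes Xi n K w)])
  = (P E * (strings_mean p K n (fun s => (B s)%:R))%:E)%E.
Proof.
move=> hE; have [mE _] := hE; rewrite -(integral_prefixes a0 hXi _ _ _ hE).
have mB : measurable [set w | B (random_prefixes Xi n K w)].
  exact: (sigma_strings_measurable (prefixes_pred_sigma n K (fun s => B s))).
rewrite setIC -[LHS](integral_indic P mE mB); apply: eq_integral => w _.
by rewrite indicE; case: (boolP (B _)) => h; [rewrite mem_set|rewrite memNset //; exact/negP].
Qed.

Lemma collision_prob E n K : indep_event E ->
  (P (E `&` [set w | ~~ uniq (random_prefixes Xi n K w)])
   <= P E * ((n * n.-1)%:R * coincidence p ^+ K)%:E)%E.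
Proof.
move=> hE; rewrite (prefixes_prob n K (fun s => ~~ uniq s) hE).
by apply: lee_wpmul2l => //; rewrite lee_fin; exact: mean_collision.
Qed.

Variables (phi : {fset seq A} -> R) (M : R).
Hypothesis phiM : forall T, is_trie T -> `|phi T| <= M.

Let phi_trie n w := phi (trie_n Xi n w).

Lemma toll_measurable n : measurable_fun setT (phi_trie n).
Proof.
move=> _ B mB; rewrite setTI.
exact: (trie_pred_measurable n (fun T => B (phi T))).
Qed.

Lemma toll_integrable E n : measurable E -> P.-integrable E (EFin \o phi_trie n).
Proof.
move=> mE; apply: measurable_bounded_integrable => //.
- by rewrite (le_lt_trans (probability_le1 P mE)) // ltry.
- exact: measurable_funTS (toll_measurable n).
- exists M; split; first exact: num_real.
  move=> x Mx w _; apply: le_trans (ltW Mx); apply: phiM; exact: trie_is_trie.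
Qed.

Lemma prefixes_integrable E n K (g : seq (seq A) -> R) (C : R) : measurable E ->
  (forall s, `|g s| <= C) -> P.-integrable E (EFin \o (fun w => g (random_prefixes Xi n K w))).
Proof.
move=> mE gC; apply: measurable_bounded_integrable => //.
- by rewrite (le_lt_trans (probability_le1 P mE)) // ltry.
- apply: measurable_funTS => _ B mB; rewrite setTI.
  exact: (sigma_strings_measurable (prefixes_pred_sigma n K (fun s => B (g s)))).
- exists C; split; first exact: num_real.
  by move=> x Cx w _; apply: le_trans (ltW Cx).
Qed.

(** The toll of the trie and that of its truncation agree unless two prefixes coincide, and then
    differ by at most 2 M. Two strings are needed because [list_toll] ignores leaves. *)
Lemma toll_integral_approx E n K : indep_event E -> (2 <= n)%N ->
  `|\int[P]_(w in E) phi_trie n w - fine (P E) * mean_toll p phi K n|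
  <= fine (P E) * (2 * M * ((n * n.-1)%:R * coincidence p ^+ K)).
Proof.
move=> hE n2; have [mE _] := hE; have M0 := toll_bound_ge0 a0 phiM.
have fE : P E \is a fin_num by exact: fin_num_measure.
have int g : \int[P]_(w in E) g (random_prefixes Xi n K w) = fine (P E) * strings_mean p K n g.
  by rewrite /Rintegral (integral_prefixes a0 hXi _ _ _ hE) fineM.
pose nu (s : seq (seq A)) : R := 2 * M * (~~ uniq s)%:R.
have it := toll_integrable n mE.
have il := prefixes_integrable n K mE (list_toll_bound a0 phiM).
have inu : P.-integrable E (EFin \o (fun w => nu (random_prefixes Xi n K w))).
  apply: (@prefixes_integrable E n K nu (2 * M)) => // s; rewrite /nu.
  rewrite ger0_norm ?mulr_ge0 //; case: uniq; rewrite ?mulr0 ?mulr1 ?mulr_ge0 //.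
rewrite -int -RintegralB //.
have ib := integrableB mE it il.
apply: le_trans (le_normr_Rintegral mE ib) _.
apply: (@le_trans _ _ (\int[P]_(w in E) nu (random_prefixes Xi n K w))).
  apply: le_Rintegral => //; first exact: integrable_norm.
  move=> w _ /=; rewrite /nu; case: (boolP (uniq _)) => us; last first.
    rewrite mulr1 mulr_natl mulr2n; apply: le_trans (ler_normB _ _) _.
    apply: lerD; last exact: (list_toll_bound a0 phiM).
    by apply: phiM; exact: trie_is_trie.
  rewrite mulr0 /list_toll /phi_trie /trie_n (trie_prefixes us).
  rewrite size_map size_iota n2 /= (asboolT (list_trie_is_trie a0 us (size_prefixes _ _ _))).
  by rewrite subrr normr0.
rewrite int ler_wpM2l ?fine_ge0 // /nu.
rewrite (meanZ (strings_mean_is_mean p_gt0 p_sum K n)) ler_wpM2l ?mulr_ge0 //.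
exact: mean_collision.
Qed.

Hypotheses (p_lt1 : coincidence p < 1) (phi0 : phi fset0 = 0).

Let mul_prob1 (c : R) : c * fine (P setT) = c.
Proof. by rewrite probability_setT mulr1. Qed.

Definition mean_trie_toll n : R := \int[P]_w phi_trie n w.

Lemma trie1 (x : nat -> nat -> A) : trie 1 x = bullet A.
Proof. by rewrite (@trie_prefixes _ 1 0 x) // list_trie1. Qed.

(** For n >= 2 both sides are close to [fine (P E)] times the mean toll at depth [K], with an error
    proportional to theta^K; letting [K] tend to infinity gives equality. For n <= 1 the toll is
    constant. *)
Lemma toll_integral E n : indep_event E ->
  \int[P]_(w in E) phi_trie n w = fine (P E) * mean_trie_toll n.
Proof.
move=> hE; have [mE _] := hE.
have cst c : phi_trie n = cst c -> \int[P]_(w in E) phi_trie n w = fine (P E) * mean_trie_toll n.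
  move=> hc; rewrite /mean_trie_toll hc (Rintegral_cst P mE) (Rintegral_cst P measurableT).
  by rewrite mul_prob1 mulrC.
case: n cst => [|[|n]] cst.
- by apply: (cst 0); apply/funext => w; rewrite /phi_trie /trie_n trie0.
- by apply: (cst (phi (bullet A))); apply/funext => w; rewrite /phi_trie /trie_n trie1.
have M0 := toll_bound_ge0 a0 phiM.
have pE0 : 0 <= fine (P E) by rewrite fine_ge0.
apply/eqP; rewrite -subr_eq0 -normr_eq0 eq_le normr_ge0 andbT.
pose B K := 2 * fine (P E) * (2 * M * ((n.+2 * n.+1)%:R * coincidence p ^+ K)).
have cB : B @ \oo --> (0 : R).
  rewrite -(mulr0 (2 * fine (P E))) -(mulr0 (2 * M)) -(mulr0 (n.+2 * n.+1)%:R).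
  apply: cvgMr; apply: cvgMr; apply: cvgMr; apply: cvg_expr.
  by rewrite ger0_norm // sumr_ge0 // => a _; exact: sqr_ge0.
rewrite -(cvg_lim (@norm_hausdorff _ R) cB); apply: limr_ge; first exact: (cvgP _ cB).
apply: nearW => K; have h1 := toll_integral_approx K hE (isT : 2 <= n.+2)%N.
have := toll_integral_approx K indep_setT (isT : 2 <= n.+2)%N.
rewrite probability_setT !mul1r -/(mean_trie_toll _) => h2.
rewrite -(subrKA (fine (P E) * mean_toll p phi K n.+2)); apply: le_trans (ler_normD _ _) _.
rewrite /B -mulrA [leRHS]mulr_natl mulr2n; apply: lerD; first exact: h1.
by rewrite -mulrBr normrM ger0_norm // distrC ler_wpM2l.
Qed.

Lemma mean_trie_toll_approx n K : (2 <= n)%N ->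
  `|mean_trie_toll n - mean_toll p phi K n| <= 2 * M * (n * n.-1)%:R * coincidence p ^+ K.
Proof.
move=> n2; have := toll_integral_approx K indep_setT n2.
rewrite probability_setT !mul1r => h; apply: le_trans h _.
by rewrite [leLHS]mulrA.
Qed.

Lemma mean_trie_toll_bound n : `|mean_trie_toll n| <= M.
Proof.
apply: le_trans (le_normr_Rintegral _ (toll_integrable n measurableT)) _ => //.
apply: (@le_trans _ _ (\int[P]_(w in setT) M)).
  apply: le_Rintegral => //.
  - by apply: integrable_norm; exact: toll_integrable.
  - exact: finite_measure_integrable_cst.
  - by move=> w _; apply: phiM; exact: trie_is_trie.
by rewrite (Rintegral_cst P measurableT) mul_prob1.
Qed.

Lemma nneseries_poisson (lam : R) (h : nat -> R) : 0 < lam -> geometric_growth h ->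
  (\sum_(n <oo) (poisson_pmf lam n * h n)%:E = (poisson_mean lam h)%:E)%E.
Proof.
move=> l0 gh; apply: cvg_lim => //.
rewrite [X in X @ _ --> _](_ : _ = (fun N => (expR (- lam) *
    series (fun n => h n * exp_coeff lam n) N)%:E)).
  apply/fine_cvgP; split; first exact: nearW.
  exact: (poisson_mean_cvg (ltW l0) gh).
apply/funext => N; rewrite sumEFin; congr EFin; rewrite /series /= mulr_sumr.
by apply: eq_bigr => n _; rewrite /poisson_pmf l0 /exp_coeff /=; ring.
Qed.

Section Poisson.
Variables (N : R -> Omega -> nat) (lam : R).
Hypotheses (lam0 : 0 < lam) (hN : poisson_variable P lam (N lam))
  (hNXi : independent_of_strings P Xi (N lam)).

Let Nn n := [set w | N lam w = n].

Let mNn n : measurable (Nn n). Proof. by have [h _] := hN; exact: h. Qed.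

Lemma indep_count n : indep_event (Nn n).
Proof.
split=> [|F hF]; first by have [h _] := hN; exact: h.
by apply: hNXi => //; exists [set n].
Qed.

Let Nn_cover : \bigcup_n Nn n = setT.
Proof. by apply/seteqP; split=> // w _; exists (N lam w). Qed.

Let Nn_triv : trivIset setT Nn.
Proof. by apply/trivIsetP => i j _ _ ij; apply/seteqP; split=> // w [/= wi wj]; move/eqP: ij; rewrite -wi -wj. Qed.

Lemma trie_poisson_pred (Q : set {fset seq A}) :
  [set w | Q (trie_poisson Xi N lam w)] = \bigcup_n (Nn n `&` [set w | Q (trie_n Xi n w)]).
Proof.
apply/seteqP; split=> w /=; first by move=> Qw; exists (N lam w).
by move=> [n _ [/= <-]].
Qed.

Lemma trie_poisson_pred_measurable (Q : set {fset seq A}) :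
  measurable [set w | Q (trie_poisson Xi N lam w)].
Proof.
rewrite trie_poisson_pred; apply: bigcupT_measurable => n.
by apply: measurableI => //; exact: trie_pred_measurable.
Qed.

Lemma expectation_toll_poisson :
  fine 'E_P[fun w => phi (trie_poisson Xi N lam w)] = poisson_mean lam mean_trie_toll.
Proof.
have M0 := toll_bound_ge0 a0 phiM.
have gm : geometric_growth mean_trie_toll.
  exact: geometric_growth_le mean_trie_toll_bound (geometric_growth_cst M).
have mf : measurable_fun setT (fun w => phi (trie_poisson Xi N lam w)).
  move=> _ B mB; rewrite setTI.
  exact: (trie_poisson_pred_measurable (fun T => B (phi T))).
have intf : P.-integrable setT (EFin \o (fun w => phi (trie_poisson Xi N lam w))).
  apply: measurable_bounded_integrable => //.
    by rewrite (le_lt_trans (probability_le1 P measurableT)) // ltry.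
  exists M; split; first exact: num_real.
  by move=> x Mx w _; apply: le_trans (ltW Mx); apply: phiM; exact: trie_is_trie.
rewrite unlock -Nn_cover integral_bigcup //; last by rewrite Nn_cover.
transitivity (fine (\sum_(n <oo) (poisson_pmf lam n * mean_trie_toll n)%:E)%E); last first.
  by rewrite nneseries_poisson.
congr fine; apply: eq_eseriesr => n _.
transitivity (\int[P]_(w in Nn n) (phi_trie n w)%:E)%E.
  by apply: eq_integral => w; rewrite inE /= => <-.
have := toll_integral n (indep_count n).
have [_ ->] := hN; rewrite /= => <-.
by rewrite /Rintegral fineK // integrable_fin_num //; exact: toll_integrable.
Qed.

(** The subtracted chi lambda e^-lambda is precisely the term n = 1 of the Poisson mean, and the
    term n = 0 vanishes because [phi fset0] does. *)
Lemma fE_poisson_mean :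
  fE P Xi N phi lam = poisson_mean lam (fun n => if (n <= 1)%N then 0 else mean_trie_toll n).
Proof.
have l0 := ltW lam0.
have gm : geometric_growth mean_trie_toll.
  exact: geometric_growth_le mean_trie_toll_bound (geometric_growth_cst M).
have g0 : geometric_growth (fun n => (n == 0%N)%:R : R).
  by apply: geometric_growth_le (geometric_growth_cst 1) => -[|n]; rewrite ?normr1 ?normr0.
have g1 : geometric_growth (fun n => (n == 1%N)%:R : R).
  by apply: geometric_growth_le (geometric_growth_cst 1) => -[|[|n]]; rewrite ?normr1 ?normr0.
have e0 : poisson_mean lam (fun n => (n == 0%N)%:R) = expR (- lam).
  apply: poisson_mean_lim => //; rewrite -cvg_shiftS /=.
  rewrite [X in X @ _ --> _](_ : _ = fun=> expR (- lam)); first exact: cvg_cst.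
  apply/funext => k; rewrite /series /= big_nat_recl //= big1 => [|i _]; last by rewrite mul0r.
  by rewrite addr0 mul1r /exp_coeff /= fact0 expr0 divr1 mulr1.
have e1 : poisson_mean lam (fun n => (n == 1%N)%:R) = lam * expR (- lam).
  rewrite -e0; apply: poisson_mean_shift => // -[|n] /=; by rewrite ?mulr1 ?mulr0.
rewrite /fE expectation_toll_poisson -mulrA -e1 -poisson_meanZ // -poisson_meanB //; last first.
  exact: geometric_growthZ.
congr poisson_mean; apply/funext => -[|[|n]] /=; rewrite ?mulr0 ?mulr1 ?subr0 //.
  by rewrite /mean_trie_toll /phi_trie /trie_n; under eq_Rintegral do rewrite trie0 phi0;
     rewrite Rintegral_cst // mul0r.
by rewrite /mean_trie_toll /phi_trie /trie_n; under eq_Rintegral do rewrite trie1;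
   rewrite (Rintegral_cst P measurableT) mul_prob1 subrr.
Qed.

(** Chebyshev's inequality for the count: far from [lam] the conditional probability is bounded by
    1, hence by (n - lam)^2 / dl^2, and the Poisson variance is [lam]. *)
Lemma poisson_mixture_le (Q : set {fset seq A}) (b dl : R) : 0 < dl -> 0 <= b ->
  (forall n, `|n%:R - lam| <= dl -> (P [set w | Q (trie_n Xi n w)] <= b%:E)%E) ->
  (P [set w | Q (trie_poisson Xi N lam w)] <= (b + lam / dl ^+ 2)%:E)%E.
Proof.
move=> dl0 b0 hb; have l0 := ltW lam0.
pose h n := b + dl ^- 2 * (n%:R - lam) ^+ 2.
have gs := geometric_growthZ (dl ^- 2) (geometric_growth_sqr_dist lam).
have gh : geometric_growth h by apply: geometric_growthD => //; exact: geometric_growth_cst.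
have -> : b + lam / dl ^+ 2 = poisson_mean lam h.
  rewrite poisson_meanD //; last exact: geometric_growth_cst.
  rewrite poisson_mean_cst // poisson_meanZ //; last exact: geometric_growth_sqr_dist.
  by rewrite poisson_mean_variance // mulrC.
rewrite -nneseries_poisson // trie_poisson_pred measure_bigcup //=; first last.
- by apply/trivIsetP => i j _ _ ij; move/trivIsetP: Nn_triv => /(_ i j I I ij) hij;
     rewrite setIACA hij set0I.
- by move=> n _; apply: measurableI => //; exact: trie_pred_measurable.
rewrite (@eq_eseriesl _ _ xpredT) => [|i]; last by rewrite in_setT.
apply: lee_nneseries => [n _ _|n _]; first exact: measure_ge0.
have [_ hind] := indep_count n.
rewrite (_ : P _ = (P (Nn n) * P [set w | Q (trie_n Xi n w)])%E); last first.
  by apply: hind; exact: trie_pred_sigma.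
have [_ ->] := hN; rewrite EFinM; apply: lee_wpmul2l.
  by rewrite lee_fin poisson_pmf_ge0.
have h0 : 0 <= dl ^- 2 * (n%:R - lam) ^+ 2 by rewrite mulr_ge0 ?invr_ge0 ?sqr_ge0.
have [nl|nl] := lerP `|n%:R - lam| dl.
  by apply: le_trans (hb n nl) _; rewrite lee_fin lerDl.
apply: (@le_trans _ _ 1%E); first by apply: probability_le1; exact: trie_pred_measurable.
rewrite lee_fin /h -[leLHS]add0r lerD // mulrC ler_pdivlMr ?exprn_gt0 // mul1r.
by rewrite -[leRHS]real_normK ?num_real // lerXn2r ?nnegrE // ltW.
Qed.

End Poisson.
End TrieLaw.

(** * Concentration and convergence in probability *)

Section PolyGeometric.
Variable R : realType.

(** The quantity s^K (1 + K (1 - s)) does not increase with [K], starts at 1, and dominates the left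
    side times 1 - s. *)
Lemma geometric_linear_bound (s : R) K : 0 <= s -> s < 1 ->
  K.+1%:R * s ^+ K <= (1 - s)^-1.
Proof.
move=> s0 s1; have s10 : 0 < 1 - s by rewrite subr_gt0.
rewrite -[leRHS]mul1r ler_pdivlMr //.
apply: (@le_trans _ _ (s ^+ K * (1 + K%:R * (1 - s)))).
  rewrite mulrAC mulrC ler_wpM2l ?exprn_ge0 // -natr1 mulrDl mul1r addrC lerD2r.
  by rewrite gerBl.
elim: K => [|K IH]; first by rewrite expr0 mul0r addr0 mulr1.
apply: le_trans IH; rewrite exprSr -mulrA ler_wpM2l ?exprn_ge0 //.
rewrite -natr1 -subr_ge0 (_ : _ - _ = (1 - s) ^+ 2 * (1 + K%:R)); last by ring.
by rewrite mulr_ge0 ?sqr_ge0 // addr_ge0.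
Qed.

(** With s^K split into two equal factors, one absorbs a single power of K + 1 and the other is left
    to the induction. *)
Lemma geometric_poly_bound (m : nat) (s : R) : 0 <= s -> s < 1 ->
  exists b, forall K, K.+1%:R ^+ m * s ^+ K <= b.
Proof.
elim: m s => [|m IH] s s0 s1.
  by exists 1 => K; rewrite expr0 mul1r exprn_ile1 // ltW.
have r0 := sqrtr_ge0 s.
have r1 : Num.sqrt s < 1 by rewrite -[ltRHS]sqrtr1 ltr_sqrt.
have [b hb] := IH _ r0 r1; exists (b * (1 - Num.sqrt s)^-1) => K.
have -> : K.+1%:R ^+ m.+1 * s ^+ K =
    (K.+1%:R ^+ m * Num.sqrt s ^+ K) * (K.+1%:R * Num.sqrt s ^+ K).
  rewrite -[in s ^+ K](sqr_sqrtr s0) [K.+1%:R ^+ m.+1]exprSr -exprM mulnC exprM expr2.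
  by rewrite mulrACA.
apply: ler_pM => //; try by rewrite mulr_ge0 ?exprn_ge0.
exact: geometric_linear_bound.
Qed.

End PolyGeometric.

Section Concentration.
Variables (R : realType) (A : finType) (p : A -> R) (a0 : A).
Hypotheses (p_gt0 : forall a, 0 < p a) (p_sum : \sum_a p a = 1) (p_lt1 : forall a, p a < 1).
Context d (Omega : measurableType d) (P : probability Omega R).
Variable Xi : nat -> Omega -> nat -> A.
Hypothesis hXi : iid_strings P p Xi.
Variables (phi : {fset seq A} -> R) (M : R).
Hypotheses (phiM : forall T, is_trie T -> `|phi T| <= M) (phi0 : phi fset0 = 0).

Let Phi := additive_functional phi.
Let chi := phi (bullet A).
Let theta := coincidence p.
Let th0 : 0 <= theta. Proof. exact: coincidence_ge0. Qed.
Let th1 : theta < 1. Proof. exact: coincidence_lt1. Qed.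
Let M0 : 0 <= M. Proof. exact: (toll_bound_ge0 a0 phiM). Qed.

Definition toll_coeff n : R := if (n <= 1)%N then 0 else mean_trie_toll P Xi phi n.

Lemma toll_coeff_bound n : `|toll_coeff n| <= M.
Proof.
rewrite /toll_coeff; case: ifP => _; first by rewrite normr0.
exact: (mean_trie_toll_bound a0 hXi phiM).
Qed.

Lemma toll_coeff_small n : (n <= 1)%N -> toll_coeff n = 0.
Proof. by rewrite /toll_coeff => ->. Qed.

Let f lam := poisson_mean lam toll_coeff.
(** It plays the part of the Poisson mean of Phi - chi N, but is defined as a tree sum and compared
    directly with the means at finite depth, so that no expectation of [Phi] itself is taken. *)
Definition mean_profile := tree_sum p f.
Let F := mean_profile.
Let m K := mean_sum_tolls p phi K.

Lemma tail_le_second_moment K n (e v : R) : 0 < e ->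
  strings_mean p K n (fun s => (e < `|list_sum phi K s - v|)%R%:R)
  <= (n%:R * (2 * M * K%:R) ^+ 2 + (m K n - v) ^+ 2) / e ^+ 2.
Proof.
move=> e0; have hn := strings_mean_is_mean p_gt0 p_sum K n.
have e20 : 0 < e ^+ 2 by exact: exprn_gt0.
apply: (@le_trans _ _ (e ^- 2 * strings_mean p K n (fun s => (list_sum phi K s - v) ^+ 2))).
  rewrite -(meanZ hn); apply: (mean_le hn) => s.
  case: ltP => h; last by rewrite mulr_ge0 ?invr_ge0 ?sqr_ge0.
  rewrite mulrC ler_pdivlMr // mul1r -[leRHS]real_normK ?num_real //.
  by rewrite lerXn2r ?nnegrE // ltW.
rewrite mulrC ler_pM2r ?invr_gt0 // (mean_sqr_dist hn) lerD2r.
exact: (variance_sum_tolls p_gt0 p_sum a0 phiM).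
Qed.

Lemma trie_tail K n (e v : R) : 0 < e ->
  (P [set w | (e < `|Phi (trie_n Xi n w) - chi * n%:R - v|)%R] <=
   ((n * n.-1)%:R * theta ^+ K +
    (n%:R * (2 * M * K%:R) ^+ 2 + (m K n - v) ^+ 2) / e ^+ 2)%:E)%E.
Proof.
move=> e0; set E := [set w | _].
pose U := [set w | ~~ uniq (random_prefixes Xi n K w)].
pose V := [set w | e < `|list_sum phi K (random_prefixes Xi n K w) - v|].
have mU : measurable U.
  have h := prefixes_pred_sigma (Xi := Xi) a0 n K (fun s : seq (seq A) => ~~ uniq s).
  exact: (sigma_strings_measurable hXi h).
have mV : measurable V.
  have h := prefixes_pred_sigma (Xi := Xi) a0 n K
    (fun s : seq (seq A) => (e < `|list_sum phi K s - v|)%R).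
  exact: (sigma_strings_measurable hXi h).
have mE : measurable E.
  exact: (trie_pred_measurable a0 hXi n (fun T => e < `|Phi T - chi * n%:R - v|)).
have EUV : E `<=` U `|` V.
  move=> w /= Ew; have [us|us] := boolP (uniq (random_prefixes Xi n K w)); last by left.
  have tE : trie_n Xi n w = list_trie (random_prefixes Xi n K w) := trie_prefixes us.
  right; rewrite /V /=; move: Ew; rewrite /E /= tE /Phi.
  rewrite (additive_functional_list_sum a0 phi0 us (size_prefixes _ _ _)).
  by rewrite size_map size_iota [_ + list_sum _ _ _]addrC addrK.
have PEUV : (P E <= P (U `|` V))%E.
  by apply: le_measure => //; rewrite inE //; exact: measurableU.
apply: le_trans PEUV _.
have PUV : (P (U `|` V) <= P U + P V)%E by exact: measureU2.
apply: le_trans PUV _; rewrite EFinD; apply: leeD.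
  have := collision_prob a0 p_gt0 p_sum hXi n K (indep_setT P Xi).
  by rewrite setTI probability_setT mul1e.
have := prefixes_prob a0 hXi n K (fun s => e < `|list_sum phi K s - v|) (indep_setT P Xi).
rewrite setTI probability_setT mul1e => ->; rewrite lee_fin.
exact: tail_le_second_moment.
Qed.

Let G K lam := poisson_mean lam (m K).

Lemma mean_sum_tolls_growth K : geometric_growth (m K).
Proof.
apply: (@geometric_growth_le _ _ (fun n => 2 * M * K%:R * n%:R)); last first.
  exact/geometric_growthZ/geometric_growth_nat.
move=> n; have := mean_sum_tolls_dist p_gt0 p_sum a0 phiM K n 0.
by rewrite -/(m K) /m (mean_sum_tolls_small p_gt0 p_sum phi K (leq0n 1)) !subr0 normr_nat.
Qed.

Lemma mean_toll_growth K : geometric_growth (mean_toll p phi K).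
Proof.
apply: geometric_growth_le (geometric_growth_cst M).
exact: (mean_toll_bound p_gt0 p_sum a0 phiM).
Qed.

Lemma poisson_mean_sum_tollsS K lam : 0 <= lam ->
  G K.+1 lam = poisson_mean lam (mean_toll p phi K.+1) + \sum_a G K (p a * lam).
Proof.
move=> l0; have p01 a : 0 <= p a <= 1 by rewrite (ltW (p_gt0 a)) ltW.
have gb a := binomial_mean_growth (p01 a) (mean_sum_tolls_growth K).
rewrite /G (_ : m K.+1 = fun n => mean_toll p phi K.+1 n +
    \sum_a binomial_mean (p a) n (m K)); last first.
  by apply/funext => n; exact: mean_sum_tollsS.
rewrite poisson_meanD //; last 2 first.
- exact: mean_toll_growth.
- apply: (@geometric_growth_le _ _ (fun n => \sum_a `|binomial_mean (p a) n (m K)|)).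
    by move=> n; exact: ler_norm_sum.
  elim: (index_enum A) => [|a r IH].
    by under eq_fun do rewrite big_nil; exact: geometric_growth_cst.
  under eq_fun do rewrite big_cons; apply: geometric_growthD => //.
  by have [C hC] := gb a; exists C => n; rewrite normr_id.
congr (_ + _); rewrite poisson_mean_sum //; apply: eq_bigr => a _.
by rewrite poisson_thinning //; exact: mean_sum_tolls_growth.
Qed.

Let C := 4 * M / (1 - theta) + M.

(** Thinning turns the binomial recursion of the depth-[K] means into the functional equation of
    [F]. The defect at each level is the truncation error of the toll, at most 2 M n (n - 1)
    theta^(K+1), whose Poisson mean is explicit. *)
Lemma mean_profile_approx K lam : 0 <= lam ->
  `|F lam - G K lam| <= (C + 2 * M * K%:R) * lam ^+ 2 * theta ^+ K.
Proof.
apply: (tree_sum_approx p_gt0 (poisson_mean_sqr_bound toll_coeff_bound toll_coeff_small) th1).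
- exact: (tree_sum_poisson_quadratic a0 p_gt0 p_sum p_lt1 toll_coeff_bound toll_coeff_small).
- move=> {}lam l0; rewrite /G (_ : m 0 = fun=> 0); first exact: poisson_mean_cst.
  apply/funext => n; rewrite /m /mean_sum_tolls.
  exact: (mean_cst (strings_mean_is_mean p_gt0 p_sum 0 n)).
- move=> {}K {}lam l0; rewrite poisson_mean_sum_tollsS // opprD addrACA subrr addr0.
  have gc := geometric_growth_le toll_coeff_bound (geometric_growth_cst M).
  rewrite -poisson_meanB //; last exact: mean_toll_growth.
  have gk := geometric_growthZ (2 * M * theta ^+ K.+1) (@geometric_growth_fact2 R).
  have -> : 2 * M * lam ^+ 2 * theta ^+ K.+1 =
      poisson_mean lam (fun n => 2 * M * theta ^+ K.+1 * (n * n.-1)%:R).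
    rewrite poisson_meanZ //; last exact: geometric_growth_fact2.
    by rewrite poisson_mean_fact2 // mulrAC.
  apply: poisson_mean_norm => // n; rewrite /toll_coeff; case: leqP => n1.
    by rewrite (mean_toll_small p_gt0 p_sum phi K.+1 n1) subrr normr0 mulr_ge0 // mulr_ge0 ?exprn_ge0 // mulr_ge0.
  rewrite mulrAC.
  exact: (mean_trie_toll_approx a0 p_gt0 p_sum hXi phiM).
Qed.

Lemma poisson_sum_tolls_dist K n : (0 < n)%N ->
  `|G K n%:R - m K n| <= 2 * M * K%:R * Num.sqrt n%:R.
Proof.
move=> n0; set s := Num.sqrt n%:R; have s0 : 0 < s by rewrite sqrtr_gt0 ltr0n.
have nR : 0 <= n%:R :> R by exact: ler0n.
have ss : s ^+ 2 = n%:R by rewrite sqr_sqrtr.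
have gs := geometric_growth_sqr_dist (n%:R : R).
have gm := mean_sum_tolls_growth K.
have gc := geometric_growth_cst (m K n).
rewrite -(poisson_mean_cst (m K n) nR) /G -poisson_meanB //.
(* The Lipschitz bound calls for the mean of |j - n|; the inequality z <= z^2 / (2 s) + s / 2 with s
   = sqrt n reduces it to the variance, and both halves give s / 2. *)
pose k j := 2 * M * K%:R * ((2 * s)^-1 * (j%:R - n%:R) ^+ 2 + s / 2).
have gq : geometric_growth (fun j : nat => (2 * s)^-1 * (j%:R - n%:R) ^+ 2 + s / 2).
  by apply: geometric_growthD; [exact: geometric_growthZ|exact: geometric_growth_cst].
have -> : 2 * M * K%:R * s = poisson_mean n%:R k.
  rewrite poisson_meanZ // poisson_meanD //; last 2 first.
  - exact: geometric_growthZ.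
  - exact: geometric_growth_cst.
  rewrite poisson_meanZ // poisson_mean_variance // poisson_mean_cst //; congr (_ * _).
  by rewrite -[in RHS]ss; field; rewrite gt_eqF.
apply: poisson_mean_norm => //; first exact: geometric_growthZ.
move=> j; apply: le_trans (mean_sum_tolls_dist p_gt0 p_sum a0 phiM K j n) _.
rewrite /k ler_wpM2l ?mulr_ge0 //.
rewrite -[(j%:R - n%:R) ^+ 2]real_normK ?num_real // -subr_ge0.
set z := `|_|; rewrite (_ : _ - _ = (z - s) ^+ 2 / (2 * s)).
  by rewrite divr_ge0 ?sqr_ge0 // mulr_ge0 // ltW.
by field; rewrite gt_eqF.
Qed.

(* With K of order n^(1/4), truncating the strings at K letters costs
   n^2 theta^K and the Efron-Stein bound n (2 M K)^2 is o(n^2). *)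
Lemma trie_concentration e : 0 < e -> exists B, forall n, (0 < n)%N ->
  (P [set w | (e * n%:R < `|Phi (trie_n Xi n w) - chi * n%:R - F n%:R|)%R] <=
   (B / Num.sqrt (Num.sqrt n%:R))%:E)%E.
Proof.
(* With y = n^(1/4), the collision bound n^2 theta^K contains y^8; one more power yields the rate
   1/y. *)
move=> e0; have [b hb] := geometric_poly_bound 9 th0 th1.
have b0 : 0 <= b.
  by apply: le_trans (hb 0%N); rewrite mulr_ge0 ?exprn_ge0.
have C0 : 0 <= C by rewrite addr_ge0 // divr_ge0 ?mulr_ge0 // subr_ge0 ltW.
pose D := (C + 2 * M) * b + 2 * M.
have M20 : 0 <= 2 * M by exact: mulr_ge0.
have D0 : 0 <= D by apply: addr_ge0 => //; apply: mulr_ge0 => //; exact: addr_ge0.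
exists (b + ((2 * M) ^+ 2 + D ^+ 2) / e ^+ 2) => n n0.
set y := Num.sqrt (Num.sqrt n%:R); have n1 : 1 <= n%:R :> R by rewrite ler1n.
have nR0 : 0 <= n%:R :> R by exact: ler0n.
have y1 : 1 <= y by rewrite -sqrtr1 ler_sqrt ?sqrtr_gt0 ?ltr0n // -[leLHS]sqrtr1 ler_sqrt ?ltr0n.
have y0 : 0 < y by exact: lt_le_trans y1.
have y2 : y ^+ 2 = Num.sqrt n%:R by rewrite sqr_sqrtr // sqrtr_ge0.
have y4 : y ^+ 4 = n%:R by rewrite (_ : 4 = 2 * 2)%N // exprM y2 sqr_sqrtr.
pose K := Num.truncn y.
have Ky : K%:R <= y by rewrite truncn_le // ltW.
have yK : y < K.+1%:R by exact: truncnS_gt.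
have tK j : (j <= 8)%N -> y ^+ j * theta ^+ K <= b / y.
  move=> j8; rewrite ler_pdivlMr // mulrAC -exprSr; apply: le_trans (hb K).
  apply: ler_wpM2r; first exact: exprn_ge0.
  apply: (@le_trans _ _ (y ^+ 9)); first by rewrite ler_weXn2l.
  by rewrite lerXn2r ?nnegrE ?ler0n ?ltW.
apply: le_trans (trie_tail K n _ _) _; first by rewrite mulr_gt0 // ltr0n.
rewrite lee_fin [leRHS]mulrDl; apply: lerD.
  apply: (@le_trans _ _ (y ^+ 8 * theta ^+ K)); last exact: tK.
  rewrite ler_wpM2r ?exprn_ge0 // (_ : 8 = 4 * 2)%N // exprM y4 -natrX ler_nat -mulnn.
  by rewrite leq_mul // leq_pred.
have nF : n%:R = y ^+ 4 by [].
(* The bias is O(n^(3/4)): replacing n by a Poisson count costs K sqrt n <= y^3, and the truncation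
   error is smaller. *)
have Dn : `|m K n - F n%:R| <= D * y ^+ 3.
  rewrite distrC -(subrKA (G K n%:R)); apply: le_trans (ler_normD _ _) _.
  rewrite /D [leRHS]mulrDl; apply: lerD.
    apply: le_trans (mean_profile_approx K nR0) _; rewrite -y4 -exprM.
    have KC : C + 2 * M * K%:R <= (C + 2 * M) * y.
      rewrite [leRHS]mulrDl; apply: lerD; first by rewrite ler_peMr.
      by rewrite ler_wpM2l ?mulr_ge0.
    have KC0 : 0 <= C + 2 * M * K%:R by rewrite addr_ge0 // !mulr_ge0.
    rewrite -mulrA; apply: (@le_trans _ _ ((C + 2 * M) * y * (b / y))).
      by apply: ler_pM => //; [rewrite mulr_ge0 ?exprn_ge0 // ltW|exact: tK].
    rewrite -[leLHS]mulrA (mulrC y) divfK ?gt_eqF //; apply: ler_peMr; last exact: exprn_ege1.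
    by apply: mulr_ge0 => //; exact: addr_ge0.
  apply: le_trans (poisson_sum_tolls_dist K n0) _.
  rewrite -y2 -[leLHS]mulrA ler_wpM2l ?mulr_ge0 // [leRHS]exprS ler_wpM2r ?exprn_ge0 //.
  exact: ltW.
have y60 : 0 < y ^+ 6 by exact: exprn_gt0.
have h1 : n%:R * (2 * M * K%:R) ^+ 2 <= (2 * M) ^+ 2 * y ^+ 6.
  rewrite exprMn mulrCA ler_wpM2l ?sqr_ge0 // -y4 (_ : 6 = 4 + 2)%N // exprD.
  by rewrite ler_wpM2l ?exprn_ge0 ?(ltW y0) // lerXn2r ?nnegrE // ltW.
have h2 : (m K n - F n%:R) ^+ 2 <= D ^+ 2 * y ^+ 6.
  rewrite -real_normK ?num_real // (_ : 6 = 3 * 2)%N // exprM -exprMn.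
  by rewrite lerXn2r ?nnegrE // mulr_ge0 ?exprn_ge0 // ltW.
apply: (@le_trans _ _ (((2 * M) ^+ 2 + D ^+ 2) * y ^+ 6 / (e * n%:R) ^+ 2)).
  rewrite ler_wpM2r ?invr_ge0 ?sqr_ge0 // [leRHS]mulrDl; exact: lerD.
(* Variance and squared bias are both of order y^6, against (e n)^2 = e^2 y^8; the quotient is of
   order y^-2, at most 1/y. *)
rewrite -y4 (_ : _ / (e * y ^+ 4) ^+ 2 = ((2 * M) ^+ 2 + D ^+ 2) / e ^+ 2 * (y ^+ 2)^-1); last first.
  by field; rewrite !gt_eqF.
rewrite ler_wpM2l ?divr_ge0 ?addr_ge0 ?sqr_ge0 //.
by rewrite lef_pV2 ?posrE ?exprn_gt0 // expr2 ler_peMl // ltW.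
Qed.

End Concentration.

Lemma poisson_mean_ge_term (R : realType) (lam : R) (h : nat -> R) n :
  0 <= lam -> geometric_growth h -> (forall m, 0 <= h m) ->
  h n * (expR (- lam) * exp_coeff lam n) <= poisson_mean lam h.
Proof.
move=> l0 gh h0; have ch := poisson_mean_cvg l0 gh.
rewrite -(cvg_lim _ ch) //; apply: limr_ge; first by apply: cvgP ch.
near=> m; have nm : (n < m)%N by near: m; exact: nbhs_infty_gt.
rewrite mulrCA ler_wpM2l ?expR_ge0 // /series /= big_mkord (bigD1 (Ordinal nm)) //= lerDl.
by apply: sumr_ge0 => i _; rewrite mulr_ge0 // exp_coeff_ge0.
Unshelve. all: by end_near. Qed.

Lemma cvge0_near (R : realType) (T : Type) (F : set_system T) (FF : Filter F)
    (u : T -> \bar R) :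
  (forall i, 0 <= u i)%E -> (forall e, 0 < e -> \forall i \near F, (u i <= e%:E)%E) ->
  u @ F --> 0%E.
Proof.
move=> u0 ue; apply/fine_cvgP; split.
  have := ue 1 ltr01; apply: filterS => i ui.
  by rewrite ge0_fin_numE // (le_lt_trans ui) // ltry.
apply/cvgrPdist_le => e e0; have := ue e e0; apply: filterS => i ui /=.
have fi : u i \is a fin_num by rewrite ge0_fin_numE // (le_lt_trans ui) // ltry.
by rewrite sub0r normrN ger0_norm ?fine_ge0 // -lee_fin fineK.
Qed.

Lemma sqrt_sqrt_decay (R : realType) (B e : R) : 0 < e ->
  exists N : R, forall n : nat, N <= n%:R -> B / Num.sqrt (Num.sqrt n%:R) <= e.
Proof.
move=> e0; pose c := `|B| / e; have c0 : 0 <= c by rewrite divr_ge0 // ltW.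
exists (c ^+ 4 + 1) => n nc.
have nc4 : c ^+ 4 <= n%:R by apply: le_trans nc; rewrite lerDl.
have n0 : 0 < n%:R :> R by apply: lt_le_trans nc; rewrite ltr_wpDl // exprn_ge0.
have y0 : 0 < Num.sqrt (Num.sqrt n%:R) :> R by rewrite !sqrtr_gt0.
rewrite ler_pdivrMr //; apply: le_trans (ler_norm B) _.
rewrite -ler_pdivrMl // mulrC -/c.
have -> : c = Num.sqrt (Num.sqrt (c ^+ 4)).
  by rewrite (_ : 4 = 2 * 2)%N // exprM sqrtr_sqr ger0_norm ?sqr_ge0 // sqrtr_sqr ger0_norm.
by rewrite ler_sqrt ?sqrtr_ge0 // ler_sqrt // ler0n.
Qed.

(** * Law of large numbers and linear lower bound *)

Section LawOfLargeNumbers.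
Variables (R : realType) (A : finType) (p : A -> R) (a0 : A).
Hypotheses (p_gt0 : forall a, 0 < p a) (p_sum : \sum_a p a = 1) (p_lt1 : forall a, p a < 1).
Context d (Omega : measurableType d) (P : probability Omega R).
Variables (Xi : nat -> Omega -> nat -> A) (N : R -> Omega -> nat).
Hypotheses (hXi : iid_strings P p Xi)
  (hN : forall lambda, 0 < lambda -> poisson_variable P lambda (N lambda))
  (hNXi : forall lambda, 0 < lambda -> independent_of_strings P Xi (N lambda)).
Variables (phi : {fset seq A} -> R) (M : R).
Hypotheses (phiM : forall T, is_trie T -> `|phi T| <= M) (phi0 : phi fset0 = 0).

Let Phi := additive_functional phi.
Let chi := phi (bullet A).
Let f := fE P Xi N phi.
Let psi := psiE p f.
Let H := entropy p.
Let c := toll_coeff P Xi phi.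
Let F := mean_profile p P Xi phi.
Let cM := toll_coeff_bound a0 hXi phiM.
Let cs := @toll_coeff_small R A d Omega P Xi phi.

Let fc lam : 0 < lam -> f lam = poisson_mean lam c.
Proof.
move=> l0; exact: (fE_poisson_mean a0 p_gt0 p_sum hXi phiM (coincidence_lt1 a0 p_gt0 p_sum p_lt1)
  phi0 l0 (hN l0) (hNXi l0)).
Qed.

Let F_psi : vanishing (fun t => expR (- t) * F (expR t) - H^-1 * psi t).
Proof. exact: (tree_sum_psi a0 p_gt0 p_sum p_lt1 cM cs fc). Qed.

Let F_psi_ratio e : 0 < e -> exists L, forall lam, 0 < lam -> L <= lam ->
  `|F lam / lam - H^-1 * psi (ln lam)| <= e.
Proof.
move=> e0; have [T hT] := F_psi e0; exists (expR T) => lam l0 Tl.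
have Tln : T <= ln lam by rewrite -ler_expR lnK ?posrE.
by have := hT _ Tln; rewrite expRN lnK ?posrE // (mulrC lam^-1).
Qed.

Lemma trie_n_cvg : cvg_in_probability P \oo
  (fun n w => Phi (trie_n Xi n w) / n%:R - H^-1 * psi (ln n%:R) - chi) 0.
Proof.
move=> e e0; apply: cvge0_near => [n|eta eta0]; first exact: measure_ge0.
have e2 : 0 < e / 2 by rewrite divr_gt0.
have [L hL] := F_psi_ratio e2.
have [B hB] := trie_concentration a0 p_gt0 p_sum p_lt1 hXi phiM phi0 e2.
have [n1 hn1] := sqrt_sqrt_decay B eta0.
near=> n; have n0 : (0 < n)%N by near: n; exact: nbhs_infty_gt.
have nL : L <= n%:R by near: n; exact: nbhs_infty_ger.
have nn1 : n1 <= n%:R by near: n; exact: nbhs_infty_ger.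
have nR : 0 < n%:R :> R by rewrite ltr0n.
apply: le_trans (_ : _ <= (B / Num.sqrt (Num.sqrt n%:R))%:E)%E _; last by rewrite lee_fin hn1.
apply: le_trans (hB n n0); apply: le_measure; rewrite ?inE.
- exact: (trie_pred_measurable a0 hXi n
    (fun T => e < `|Phi T / n%:R - H^-1 * psi (ln n%:R) - chi - 0|)).
- exact: (trie_pred_measurable a0 hXi n
    (fun T => e / 2 * n%:R < `|Phi T - chi * n%:R - F n%:R|)).
move=> w /=; rewrite subr0; apply: contraTT; rewrite -!leNgt => h.
have -> : Phi (trie_n Xi n w) / n%:R - H^-1 * psi (ln n%:R) - chi =
   (Phi (trie_n Xi n w) - chi * n%:R - F n%:R) / n%:R +
   (F n%:R / n%:R - H^-1 * psi (ln n%:R)) by move: (H^-1 * _) => z; field; rewrite gt_eqF.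
apply: le_trans (ler_normD _ _) _; rewrite (splitr e); apply: lerD; last exact: hL.
by rewrite normrM normfV (gtr0_norm nR) ler_pdivrMr.
Unshelve. all: by end_near. Qed.

(** Given N = n with n within dl lam of [lam], concentration for fixed n applies and it remains to
    replace n by [lam]. The deviation costs 2 e/8 lam, as n <= 2 lam, and the terms in [chi] and [F]
    cost e/8 lam each; the other e/2 goes to the distance between F lam / lam and its periodic or
    constant limit. *)
Lemma trie_poisson_cvg : cvg_in_probability P (pinfty_nbhs R)
  (fun lambda w => Phi (trie_poisson Xi N lambda w) / lambda - H^-1 * psi (ln lambda) - chi) 0.
Proof.
move=> e e0; apply: cvge0_near => [l|eta eta0]; first exact: measure_ge0.
have e2 : 0 < e / 2 by rewrite divr_gt0.
have e8 : 0 < e / 8 by rewrite divr_gt0.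
have eta2 : 0 < eta / 2 by rewrite divr_gt0.
have [L hL] := F_psi_ratio e2.
have [B hB] := trie_concentration a0 p_gt0 p_sum p_lt1 hXi phiM phi0 e8.
have [n1 hn1] := sqrt_sqrt_decay B eta2.
have [r0 r01 hr] := tree_sum_poisson_unif a0 p_gt0 p_sum p_lt1 cM cs e8.
have r0_gt0 : 0 < r0 by exact: lt_trans r01.
have ch1 : 0 < `|chi| + 1 by rewrite ltr_wpDl.
(* The three caps keep n between lam/2 and 2 lam, keep the ratio of n and [lam] in either order
   below [r0], and make chi (n - lam) small. *)
pose dl := Num.min 2^-1 (Num.min (1 - r0^-1) (e / 8 / (`|chi| + 1))).
have dl0 : 0 < dl by rewrite /dl !lt_min invr_gt0 ltr0n subr_gt0 invf_lt1 // r01 divr_gt0.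
have dl2 : dl <= 2^-1 by rewrite /dl ge_min lexx.
have dlr : dl <= 1 - r0^-1 by rewrite /dl !ge_min lexx orbT.
have dlc : dl <= e / 8 / (`|chi| + 1) by rewrite /dl !ge_min lexx !orbT.
near=> lam.
have l0 : 0 < lam by near: lam; apply: nbhs_pinfty_gt; exact: num_real.
have lL : L <= lam by near: lam; apply: nbhs_pinfty_ge; exact: num_real.
have ln1 : 2 * n1 <= lam by near: lam; apply: nbhs_pinfty_ge; exact: num_real.
have leta : 2 / (dl ^+ 2 * eta) <= lam by near: lam; apply: nbhs_pinfty_ge; exact: num_real.
pose Q T := e < `|Phi T / lam - H^-1 * psi (ln lam) - chi - 0|.
have dll : 0 < dl * lam by rewrite mulr_gt0.
apply: le_trans (poisson_mixture_le (Q := Q) (b := eta / 2) a0 hXi l0 (hN l0) (hNXi l0) dll (ltW eta2) _) _.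
  move=> n nl; have /andP[nl1 nl2] : lam - dl * lam <= n%:R <= lam + dl * lam.
    by rewrite -ler_distl.
  have dlam : dl * lam <= 2^-1 * lam by rewrite ler_wpM2r // ltW.
  have nR : 0 < n%:R :> R by lra.
  have n0 : (0 < n)%N by rewrite -(ltr0n R).
  have nn1 : n1 <= n%:R by lra.
  apply: le_trans (_ : _ <= (B / Num.sqrt (Num.sqrt n%:R))%:E)%E _; last by rewrite lee_fin hn1.
  apply: le_trans (hB n n0); apply: le_measure; rewrite ?inE.
  - exact: (trie_pred_measurable a0 hXi n Q).
  - exact: (trie_pred_measurable a0 hXi n
      (fun T => e / 8 * n%:R < `|Phi T - chi * n%:R - F n%:R|)).
  move=> w; rewrite /Q /= subr0; apply: contraTT; rewrite -!leNgt => h.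
  have hF : `|F n%:R - F lam| <= e / 8 * lam.
    have [ln|nl'] := lerP lam n%:R.
      have {1}-> : n%:R = (n%:R / lam) * lam by rewrite divfK // gt_eqF.
      apply: hr; first exact: ltW.
      rewrite ler_pdivlMr // mul1r ln ler_pdivrMr //=.
      apply: le_trans nl2 _; rewrite -{1}[lam]mul1r -mulrDl ler_wpM2r ?(ltW l0) //.
      (* The cap on [dl] is set by the case n < lam; for n >= lam the weaker r0 - 1 would do. *)
      have : 1 - r0^-1 <= r0 - 1.
        rewrite -subr_ge0 (_ : _ - _ = (r0 - 1) ^+ 2 / r0); last by field; rewrite gt_eqF.
        by rewrite divr_ge0 ?sqr_ge0 // ltW.
      lra.
    rewrite distrC.
    have {1}-> : lam = (lam / n%:R) * n%:R by rewrite divfK // gt_eqF.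
    apply: le_trans (hr _ _ (ltW nR) _) _; last by rewrite ler_wpM2l ?(ltW e8) // ltW.
    rewrite ler_pdivlMr // mul1r (ltW nl') ler_pdivrMr //=.
    rewrite -ler_pdivrMl //; apply: le_trans nl1.
    have : dl * lam <= (1 - r0^-1) * lam by rewrite ler_wpM2r // ltW.
    by rewrite mulrBl mul1r; lra.
  have hchi : `|chi * (n%:R - lam)| <= e / 8 * lam.
    rewrite normrM; apply: (@le_trans _ _ ((`|chi| + 1) * (dl * lam))).
      by apply: ler_pM => //; rewrite lerDl.
    by rewrite mulrA ler_wpM2r ?(ltW l0) // mulrC -ler_pdivlMr.
  have hL' := hL lam l0 lL.
  have -> : Phi (trie_n Xi n w) / lam - H^-1 * psi (ln lam) - chi =
     ((Phi (trie_n Xi n w) - chi * n%:R - F n%:R) + (chi * (n%:R - lam)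
       + (F n%:R - F lam))) / lam + (F lam / lam - H^-1 * psi (ln lam)).
    by move: (H^-1 * _) => z; field; rewrite gt_eqF.
  apply: le_trans (ler_normD _ _) _; rewrite (splitr e); apply: lerD => //.
  rewrite normrM normfV (gtr0_norm l0) ler_pdivrMr //.
  apply: le_trans (ler_normD _ _) _.
  have h1 : e / 8 * n%:R <= e / 8 * (2 * lam) by rewrite ler_wpM2l ?(ltW e8) //; lra.
  have h2 := ler_normD (chi * (n%:R - lam)) (F n%:R - F lam).
  have -> : e / 2 * lam = e / 8 * (2 * lam) + (e / 8 * lam + e / 8 * lam) by field.
  apply: lerD; first exact: le_trans h1.
  by apply: le_trans h2 _; exact: lerD.
rewrite lee_fin [leRHS]splitr lerD2l.
have -> : lam / (dl * lam) ^+ 2 = (dl ^+ 2 * lam)^-1 by field; rewrite !gt_eqF.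
rewrite -[eta / 2]invrK lef_pV2 ?posrE ?invr_gt0 ?mulr_gt0 ?exprn_gt0 //.
have -> : (eta / 2)^-1 = dl ^+ 2 * (2 / (dl ^+ 2 * eta)) by field; rewrite !gt_eqF.
by rewrite ler_wpM2l ?sqr_ge0.
Unshelve. all: by end_near. Qed.

Lemma trie_n_cvg_nonlattice : dp p = 0 ->
  cvg_in_probability P \oo (fun n w => Phi (trie_n Xi n w) / n%:R) (H^-1 * mellin f (-1) + chi).
Proof.
move=> dp0 e e0.
rewrite (_ : (fun n => _) = fun n => P [set w |
  e < `|Phi (trie_n Xi n w) / n%:R - H^-1 * psi (ln n%:R) - chi - 0|]).
  exact: (trie_n_cvg e0).
apply/funext => n; congr (P _); apply/seteqP.
by split=> w /=; rewrite /psi /psiE dp0 eqxx subr0 opprD addrA.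
Qed.

Lemma mellinN1 : mellin f (-1) = \int[@lebesgue_measure R]_(x in `]0, +oo[) (f x * x ^- 2).
Proof.
apply: eq_Rintegral => z; rewrite inE /= in_itv /= andbT => z0.
by rewrite (_ : -1 - 1 = - 2%:R); [rewrite powRN powR_mulrn // ltW|ring].
Qed.

Hypothesis phi_ge0 : forall T, is_trie T -> 0 <= phi T.

Let chi_ge0 : 0 <= chi.
Proof. by rewrite /chi -(trie1 (fun _ _ => a0)); apply: phi_ge0; exact: trie_is_trie. Qed.

Let phi_trie_ge0 n w : 0 <= phi (trie_n Xi n w).
Proof. by apply: phi_ge0; exact: trie_is_trie. Qed.

Let c_ge0 n : 0 <= c n.
Proof.
rewrite /c /toll_coeff; case: ifP => // _.
by rewrite /mean_trie_toll; apply: Rintegral_ge0 => w _; exact: phi_trie_ge0.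
Qed.

Let c_growth : geometric_growth c.
Proof. exact: (geometric_growth_le cM (geometric_growth_cst M)). Qed.

Lemma mean_trie_toll_gt0 n : (0 < P [set w | (0 < phi (trie_n Xi n w))%R])%E ->
  0 < mean_trie_toll P Xi phi n.
Proof.
rewrite lt0e => /andP[P0 _]; rewrite lt_neqAle eq_sym; apply/andP; split; last first.
  by rewrite /mean_trie_toll; apply: Rintegral_ge0 => w _; exact: phi_trie_ge0.
apply: contra_neq P0 => m0.
have fi : (\int[P]_w (phi (trie_n Xi n w))%:E \is a fin_num)%E.
  exact: integrable_fin_num (toll_integrable a0 hXi phiM n measurableT).
have i0 : (\int[P]_w `|(phi (trie_n Xi n w))%:E| = 0)%E.
  under eq_integral do rewrite gee0_abs ?lee_fin ?phi_trie_ge0 //.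
  by rewrite -(fineK fi) -[fine _]/(mean_trie_toll P Xi phi n) m0.
have mf : measurable_fun setT (EFin \o (fun w => phi (trie_n Xi n w))).
  by apply/measurable_EFinP; exact: (toll_measurable a0 hXi).
have /(ae_eq_integral_abs P measurableT mf) h := i0.
have mE := trie_pred_measurable a0 hXi n (fun T => 0 < phi T).
apply: (measure_negligible mE); apply: negligibleS h => w /= hw; apply/not_implyP; split=> //.
by case=> /eqP; rewrite gt_eqF.
Qed.

(** One term of the Poisson series bounds the toll mean below on [1, L], because lam^n >= 1 and
    e^-lam >= e^-L there. *)
Lemma psi_ge : (exists n, (1 <= n)%N /\ (0 < P [set w | (0 < phi (trie_n Xi n w))%R])%E) ->
  exists2 m, 0 < m & forall t, m <= H^-1 * psi t + chi.
Proof.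
move=> [n [n1 Pn]]; have H0 : 0 < H := entropy_gt0 a0 p_gt0 p_lt1.
pose L := Num.max 2 (expR (dp p)).
pose k := c n * (expR (- L) / n`!%:R).
have k0 : 0 <= k by rewrite mulr_ge0 // divr_ge0 ?expR_ge0.
have fk lam : 1 <= lam <= L -> k <= poisson_mean lam c.
  move=> /andP[l1 lL]; have l0 : 0 <= lam := le_trans ler01 l1.
  apply: le_trans (poisson_mean_ge_term n l0 c_growth c_ge0).
  rewrite ler_wpM2l // ler_pM ?expR_ge0 ?invr_ge0 ?ler_expR ?lerN2 //.
  by rewrite /exp_coeff ler_peMl ?invr_ge0 // exprn_ege1.
have f0 lam : 0 < lam -> 0 <= poisson_mean lam c.
  move=> l0; rewrite -(poisson_mean_cst 0 (ltW l0)); apply: poisson_mean_le => //.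
  - exact: ltW.
  - exact: geometric_growth_cst.
have psik := psiE_ge a0 p_gt0 p_sum p_lt1 cM cs fc k0 f0 fk.
set b := (if _ then _ else _) in psik.
have dp0 : 0 <= dp p.
  rewrite /dp; case: xgetP => // x -> [[/ltW //]].
have b0 : 0 <= b by rewrite /b; case: ifP => _; rewrite ?mulr_ge0 ?expR_ge0 ?divr_ge0.
exists (H^-1 * b + chi) => [|t]; last by rewrite lerD2r ler_wpM2l ?invr_ge0 ?(ltW H0) //; exact: psik.
(* For n = 1 the coefficient [c n] is zero by convention, but the random toll is then [chi] itself,
   which must be positive. *)
have [n1'|n2] := leqP n 1.
  apply: ltr_wpDl; first by rewrite mulr_ge0 // invr_ge0 ltW.
  have n1E : n = 1%N by apply/eqP; rewrite eqn_leq n1' n1.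
  rewrite lt_neqAle chi_ge0 andbT eq_sym; apply/eqP => chi0; move: Pn.
  rewrite (_ : [set w | _] = set0) ?measure0 ?ltxx // -subset0 => w /=.
  by rewrite /trie_n n1E trie1 -/chi chi0 ltxx.
rewrite ltr_pwDl // mulr_gt0 ?invr_gt0 //.
have kp : 0 < k.
  rewrite /k /c /toll_coeff leqNgt n2 /= mulr_gt0 ?mean_trie_toll_gt0 //.
  by rewrite divr_gt0 ?expR_gt0 // ltr0n fact_gt0.
rewrite /b; case: eqP => [_|/eqP dpn]; first by rewrite divr_gt0.
have dpp : 0 < dp p by rewrite lt_neqAle eq_sym dpn.
by apply: mulr_gt0 => //; apply: mulr_gt0; rewrite ?expR_gt0.
Qed.

(** If Phi / n falls below m/2 while the centre is at least m, the deviation exceeds m/4, an event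
    of vanishing probability. *)
Lemma trie_n_lower m : 0 < m -> (forall t, m <= H^-1 * psi t + chi) ->
  P [set w | m / 2 * n%:R <= Phi (trie_n Xi n w)] @[n --> \oo] --> 1%E.
Proof.
move=> m0 mpsi; have m4 : 0 < m / 4 by rewrite divr_gt0.
pose Y n w := Phi (trie_n Xi n w) / n%:R - H^-1 * psi (ln n%:R) - chi.
have cY : P [set w | m / 4 < `|Y n w - 0|] @[n --> \oo] --> 0%E.
  exact: (trie_n_cvg m4).
have mE n := trie_pred_measurable a0 hXi n (fun T => m / 2 * n%:R <= Phi T).
have cE : P (~` [set w | m / 2 * n%:R <= Phi (trie_n Xi n w)]) @[n --> \oo] --> 0%E.
  apply: (squeeze_cvge _ (cvg_cst 0%E) cY).
  near=> n; rewrite measure_ge0 /=; apply: le_measure; rewrite ?inE.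
  - exact: measurableC.
  - exact: (trie_pred_measurable a0 hXi n
      (fun T => m / 4 < `|Phi T / n%:R - H^-1 * psi (ln n%:R) - chi - 0|)).
  have n0 : 0 < n%:R :> R by rewrite ltr0n; near: n; exact: nbhs_infty_gt.
  move=> w /= /negP; rewrite -ltNge => hw.
  have {hw} : Phi (trie_n Xi n w) / n%:R < m / 2 by rewrite ltr_pdivrMr.
  have := mpsi (ln n%:R); rewrite /Y subr0 ltr_normr.
  move: (_ / n%:R) (H^-1 * _) => x y h1 h2; apply/orP; right; lra.
rewrite (_ : (fun n => _) = (fun n => 1 - P (~` [set w | (m / 2 * n%:R <= Phi (trie_n Xi n w))%R]))%E).
  rewrite -[X in _ --> X](sube0 1%E); apply: cvgeB => //; exact: cvg_cst.
by apply/funext => n; rewrite -probability_setC ?setCK //; exact: measurableC.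
Unshelve. all: by end_near. Qed.

End LawOfLargeNumbers.

Theorem theorem3p12 (R : realType) (A : finType) (p : A -> R)
  (d : measure_display) (Omega : measurableType d) (P : probability Omega R)
  (Xi : nat -> Omega -> nat -> A) (N : R -> Omega -> nat)
  (phi phi_plus phi_minus : {fset seq A} -> R)
  (hA : (2 <= #|A|)%N)
  (hp_pos : forall a, 0 < p a)
  (hp_sum : \sum_a p a = 1)
  (hXi : iid_strings P p Xi)
  (hN : forall lambda, 0 < lambda -> poisson_variable P lambda (N lambda))
  (hNXi : forall lambda, 0 < lambda ->
     independent_of_strings P Xi (N lambda))
  (hphi : bounded_toll phi)
  (hphi_plus : bounded_toll phi_plus)
  (hphi_minus : bounded_toll phi_minus)
  (hphi_diff : forall T, is_trie T -> phi T = phi_plus T - phi_minus T)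
  (hPhi_plus : increasing_functional (additive_functional phi_plus))
  (hPhi_minus : increasing_functional (additive_functional phi_minus)) :
  let Phi := additive_functional phi in
  let chi := phi (bullet A) in
  let f := fE P Xi N phi in
  let psi := psiE p f in
  let H := entropy p in
  (cvg_in_probability P (pinfty_nbhs R)
     (fun lambda w => Phi (trie_poisson Xi N lambda w) / lambda
                      - H^-1 * psi (ln lambda) - chi) 0 /\
   cvg_in_probability P \oo
     (fun n w => Phi (trie_n Xi n w) / n%:R
                 - H^-1 * psi (ln n%:R) - chi) 0 /\
   (dp p = 0 ->
     cvg_in_probability P \oo (fun n w => Phi (trie_n Xi n w) / n%:R)
       (H^-1 * mellin f (-1) + chi) /\
     H^-1 * mellin f (-1) + chi =
     H^-1 * (\int[@lebesgue_measure R]_(x in `]0, +oo[) (f x * x ^- 2)) + chi))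
  /\
  ((forall T, is_trie T -> 0 <= phi T) ->
   (exists n, (1 <= n)%N /\ (0 < P [set w | (0 < phi (trie_n Xi n w))%R])%E) ->
   0 < inf (range (fun t => H^-1 * psi t + chi)) /\
   exists c : R, 0 < c /\
     P [set w | c * n%:R <= Phi (trie_n Xi n w)] @[n --> \oo] --> 1%E).
Proof.
move=> Phi chi f psi H.
have [a0 [b0 [_ _ ab]]] := card_gt1P hA.
(* A second letter of positive probability keeps every [p a] below 1, so that all steps - log (p a)
   are positive and [coincidence p] is below 1. *)
have p_lt1 a : p a < 1.
  have [b ba] : exists b, b != a.
    by have [<-|] := eqVneq b0 a; [exists a0|exists b0].
  rewrite -hp_sum (bigD1 a) //= (bigD1 b) //= ltrDl ltr_pwDl // sumr_ge0 // => i _.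
  exact: ltW.
have [phi0 [M phiM]] := hphi.
split.
  split; first exact: (trie_poisson_cvg a0 hp_pos hp_sum p_lt1 hXi hN hNXi phiM phi0).
  split; first exact: (trie_n_cvg a0 hp_pos hp_sum p_lt1 hXi hN hNXi phiM phi0).
  move=> dp0; split; last by rewrite mellinN1.
  exact: (trie_n_cvg_nonlattice a0 hp_pos hp_sum p_lt1 hXi hN hNXi phiM phi0).
move=> phi_ge0 phi_pos.
have [m m0 mpsi] := psi_ge a0 hp_pos hp_sum p_lt1 hXi hN hNXi phiM phi0 phi_ge0 phi_pos.
split.
  apply: lt_le_trans m0 _; apply: lb_le_inf; first by exists (H^-1 * psi 0 + chi); exists 0.
  by move=> _ [t _ <-]; exact: mpsi.
exists (m / 2); split; first by rewrite divr_gt0.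
exact: (trie_n_lower a0 hp_pos hp_sum p_lt1 hXi hN hNXi phiM phi0 m0 mpsi).
Qed.
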